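(* Let $u \in \mathcal{A}(\Omega) \cap \mathcal{T}(\mathbb{R}^{n})$ be a weak solution to $\mathcal{L}u=0$ in $\Omega$ under assumptions (A1)–(A4) of the context with $a(\cdot,\cdot)\equiv 1$. If $u$ is nonnegative in a ball $B_{10r}=B_{10r}(x_0) \Subset \Omega$ with $10r \leq R_{0}$, then $$\sup_{B_{r}}u \le c\inf_{B_{r}}u + c\,g_{B_{r}}^{-1}\big(T(u_{-};x_0,10r,10r)\big)$$ for a constant $c>0$ depending only on $n,s,t,p,\nu,L,\alpha,[b]_{\alpha}$.
   Context: Setting. $\Omega\subset\mathbb{R}^n$ is a bounded domain. All of $K_{sp},K_{tp},a,b:\mathbb{R}^n\times\mathbb{R}^n\to\mathbb{R}$ are measurable and symmetric ($F(x,y)=F(y,x)$), and $a,b\ge 0$. (A1) $0<s<t<1<p<\infty$. (A2) There are constants $0<\nu\le 1\le L<\infty$ with $\frac{\nu}{|x-y|^{n+sp}}\le K_{sp}(x,y)\le\frac{L}{|x-y|^{n+sp}}$ and $\frac{\nu}{|x-y|^{n+tp}}\le K_{tp}(x,y)\le\frac{L}{|x-y|^{n+tp}}$ for a.e. $x\ne y$. (A3) $\nu\le a(x,y)+b(x,y)\le L$ for a.e. $x,y\in\mathbb{R}^n$. (A4) There are $[b]_\alpha\ge 0$ and $\alpha\in(0,1]$ with $|b(x_1,y_1)-b(x_2,y_2)|\le [b]_\alpha(|x_1-x_2|+|y_1-y_2|)^\alpha$ for all $(x_1,y_1),(x_2,y_2)\in\mathbb{R}^n\times\mathbb{R}^n$,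 and $(t-s)p\le\alpha$. $R_0\in(0,1)$ is a fixed small radius, depending only on $\nu,\alpha,[b]_\alpha$, satisfying $[b]_\alpha(2R_0)^\alpha\le\nu/8$. Operator: $\mathcal{L}u(x)=\mathrm{P.V.}\int_{\mathbb{R}^n}|u(x)-u(y)|^{p-2}(u(x)-u(y))\,[a(x,y)K_{sp}(x,y)+b(x,y)K_{tp}(x,y)]\,dy$. Let $\mathcal{C}_\Omega=(\mathbb{R}^n\times\mathbb{R}^n)\setminus((\mathbb{R}^n\setminus\Omega)\times(\mathbb{R}^n\setminus\Omega))$. A function $f:\mathbb{R}^n\to\mathbb{R}$ belongs to $\mathcal{A}(\Omega)$ iff $f|_\Omega\in L^p(\Omega)$ and $\iint_{\mathcal{C}_\Omega}\big(a(x,y)\frac{|f(x)-f(y)|^p}{|x-y|^{n+sp}}+b(x,y)\frac{|f(x)-f(y)|^p}{|x-y|^{n+tp}}\big)\,dx\,dy<\infty$. $u\in\mathcal{A}(\Omega)$ is a weak solution to $\mathcal{L}u=0$ in $\Omega$ if $$\iint_{\mathcal{C}_\Omega}|u(x)-u(y)|^{p-2}(u(x)-u(y))(\varphi(x)-\varphi(y))\,[a(x,y)K_{sp}(x,y)+b(x,y)K_{tp}(x,y)]\,dx\,dy=0$$ for every $\varphi\in\mathcal{A}(\Omega)$ with $\varphi=0$ a.e. in $\mathbb{R}^n\setminus\Omega$. (Weak solutions are locally Hölder continuous in $\Omega$ under (A1)–(A4), so $\sup$ and $\inf$ refer to the continuous representative, i.e. to the essential supremum and infimum.) Nonlocal tail: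 for $x_0\in\mathbb{R}^n$, $r,\rho>0$, $$T(f;x_0,r,\rho)=\sup_{x\in B_\rho(x_0)}\int_{\mathbb{R}^n\setminus B_r(x_0)}\Big(a(x,y)\frac{|f(y)|^{p-1}}{|y-x_0|^{n+sp}}+b(x,y)\frac{|f(y)|^{p-1}}{|y-x_0|^{n+tp}}\Big)\,dy,$$ and $\mathcal{T}(\mathbb{R}^n)$ is the set of $f\in L^{p-1}_{\mathrm{loc}}(\mathbb{R}^n)$ with $T(f;x_0,r,\rho)<\infty$ for all $x_0\in\mathbb{R}^n$, $r,\rho>0$. For a ball $B_r$ of radius $r$ and $\tau\ge0$: $G_{B_r}(\tau)=\sup_{x,y\in B_r}\big(a(x,y)\frac{\tau^p}{r^{sp}}+b(x,y)\frac{\tau^p}{r^{tp}}\big)$ and $g_{B_r}(\tau)=G_{B_r}(\tau)/\tau$ (so $g_{B_r}(\tau)=G_{B_r}(1)\tau^{p-1}$); $g_{B_r}^{-1}$ is its inverse on $[0,\infty)$. Notation: $B_r(x_0)$ is the open ball, balls of different radii are concentric, $f_\pm=\max\{\pm f,0\}$. *)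

(* Defs.v *)
From HB Require Import structures.
From mathcomp Require Import all_boot all_order all_algebra.
From mathcomp Require Import all_classical all_reals all_analysis.

Set Implicit Arguments.
Unset Strict Implicit.
Unset Printing Implicit Defensive.

Import Order.TTheory GRing.Theory Num.Def Num.Theory.
Import numFieldNormedType.Exports.

Local Open Scope classical_set_scope.
Local Open Scope ring_scope.

(** R^n is ['rV[R]_n] with the library's (product) topology. It carries the
    sigma-algebra generated by the coordinates, that is, the Borel one. *)
Definition rV_display : measure_display -> measure_display.
Proof. exact. Qed.

Section measurable_rV.
Context {R : realType} (n : nat).

Let coors : 'I_n -> 'rV[R]_n -> measurableTypeR R := fun i x => x ord0 i.

Let rV_set0 : g_sigma_preimage coors set0.
Proof. exact: sigma_algebra0. Qed.

Let rV_setC A : g_sigma_preimage coors A -> g_sigma_preimage coors (~` A).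
Proof. exact: sigma_algebraC. Qed.

Let rV_bigcup (F : _^nat) : (forall i, g_sigma_preimage coors (F i)) ->
  g_sigma_preimage coors (\bigcup_i (F i)).
Proof. exact: sigma_algebra_bigcup. Qed.

HB.instance Definition _ :=
  @isMeasurable.Build (rV_display default_measure_display)
    'rV[R]_n (g_sigma_preimage coors) rV_set0 rV_setC rV_bigcup.

Lemma measurable_coord_rV (i : 'I_n) :
  measurable_fun [set: 'rV[R]_n] (coors i).
Proof.
move=> _ Y mY; rewrite setTI; apply: sub_sigma_algebra => /=.
rewrite -bigcup_seq/=; exists i => /=; first by rewrite mem_index_enum.
by exists Y => //; rewrite setTI.
Qed.

Lemma measurable_fun_rV d (T : measurableType d) (f : T -> 'rV[R]_n) :
  (forall i, measurable_fun [set: T] (coors i \o f)) ->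
  measurable_fun [set: T] f.
Proof.
move=> mf.
have H : g_sigma_preimage (fun i => coors i \o f) `<=` measurable.
  apply: smallest_sub; first exact: sigma_algebra_measurable.
  rewrite -bigcup_seq; apply: bigcup_sub => i _ A [B mB <-].
  exact: mf.
move=> _ A mA; apply: H; rewrite g_sigma_preimage_comp.
by exists A.
Qed.

End measurable_rV.

Section lebesgue_rV.
Context {R : realType}.

Definition cons_rV n (z : measurableTypeR R * 'rV[R]_n) : 'rV[R]_n.+1 :=
  row_mx (const_mx z.1 : 'rV[R]_1) z.2.

Definition uncons_rV n (x : 'rV[R]_n.+1) : measurableTypeR R * 'rV[R]_n :=
  (x ord0 ord0, \row_i x ord0 (lift ord0 i)).

Lemma cons_rV0 n (z : measurableTypeR R * 'rV[R]_n) :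
  cons_rV z ord0 ord0 = z.1.
Proof.
apply: etrans (etrans (row_mxEl (const_mx z.1 : 'rV[R]_1) z.2 ord0 ord0) _).
  by congr (fun_of_matrix _ _ _); exact: val_inj.
by rewrite mxE.
Qed.

Lemma cons_rVS n (z : measurableTypeR R * 'rV[R]_n) (i : 'I_n) :
  cons_rV z ord0 (lift ord0 i) = z.2 ord0 i.
Proof.
rewrite -[RHS](row_mxEr (const_mx z.1 : 'rV[R]_1)).
by congr (fun_of_matrix _ _ _); exact: val_inj.
Qed.

Lemma cons_rVK n : cancel (@cons_rV n) (@uncons_rV n).
Proof.
case=> a v; rewrite /uncons_rV cons_rV0; congr pair.
by apply/rowP => i; rewrite mxE cons_rVS.
Qed.

Lemma measurable_cons_rV n : measurable_fun setT (@cons_rV n).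
Proof.
apply: measurable_fun_rV => i; have [j ->|->] := unliftP ord0 i.
- apply: (eq_measurable_fun
    (fun z : measurableTypeR R * 'rV[R]_n => z.2 ord0 j)).
    by move=> z _ /=; rewrite cons_rVS.
  exact: (measurableT_comp (measurable_coord_rV j) measurable_snd).
- apply: (eq_measurable_fun (fun z : measurableTypeR R * 'rV[R]_n => z.1)).
    by move=> z _ /=; rewrite cons_rV0.
  exact: measurable_fst.
Qed.

HB.instance Definition _ n :=
  isMeasurableFun.Build _ _ _ _ (@cons_rV n) (@measurable_cons_rV n).

Lemma measurable_uncons_rV n : measurable_fun setT (@uncons_rV n).
Proof.
apply: measurable_fun_pair; first exact: (measurable_coord_rV ord0).
apply: measurable_fun_rV => i.
apply: (eq_measurable_fun (fun x : 'rV[R]_n.+1 =>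
  (x ord0 (lift ord0 i) : measurableTypeR R))).
  by move=> x _ /=; rewrite mxE.
exact: (measurable_coord_rV (lift ord0 i)).
Qed.

Section step.
Context (n : nat) (m : {sigma_finite_measure set 'rV[R]_n -> \bar R}).

Definition lebesgue_rVS : set 'rV[R]_n.+1 -> \bar R :=
  pushforward (lebesgue_measure \x m)%E (@cons_rV n).

Let lebesgue_rVS0 : lebesgue_rVS set0 = 0%E.
Proof. exact: measure0. Qed.

Let lebesgue_rVS_ge0 A : (0 <= lebesgue_rVS A)%E.
Proof. exact: measure_ge0. Qed.

Let lebesgue_rVS_sigma_additive : semi_sigma_additive lebesgue_rVS.
Proof. exact: measure_semi_sigma_additive. Qed.

HB.instance Definition _ := isMeasure.Build _ _ _ lebesgue_rVS
  lebesgue_rVS0 lebesgue_rVS_ge0 lebesgue_rVS_sigma_additive.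

Let lebesgue_rVS_sigma_finite : sigma_finite setT lebesgue_rVS.
Proof.
have /sigma_finiteP[F [TF ndF Foo]] := sigma_finiteT (@lebesgue_measure R).
have /sigma_finiteP[G [TG ndG Goo]] := sigma_finiteT m.
exists (fun i => @uncons_rV n @^-1` (F i `*` G i)).
  rewrite -preimage_bigcup (_ : \bigcup_i _ = setT) ?preimage_setT//.
  rewrite -setXTT TF TG predeqE => -[x y]; split.
    by move=> [i _ []/= ? ?]; split; exists i.
  move=> [/= [i _ Fix] [j _ Gjy]]; exists (maxn i j) => //; split.
  - by move: x Fix; exact/subsetPset/ndF/leq_maxl.
  - by move: y Gjy; exact/subsetPset/ndG/leq_maxr.
move=> i; have [mFi Fi] := Foo i; have [mGi Gi] := Goo i; split.
  rewrite -[X in measurable X]setTI.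
  by apply: measurable_uncons_rV => //; exact: measurableX.
rewrite /lebesgue_rVS /pushforward -comp_preimage.
rewrite (_ : _ \o _ = id); last by apply/funext => z; exact: cons_rVK.
by rewrite preimage_id product_measure1E// lte_mul_pinfty// ge0_fin_numE.
Qed.

HB.instance Definition _ :=
  @Measure_isSigmaFinite.Build _ _ _ lebesgue_rVS lebesgue_rVS_sigma_finite.

End step.

Fixpoint lebesgue_rV n : {sigma_finite_measure set 'rV[R]_n -> \bar R} :=
  if n is n'.+1 then lebesgue_rVS (lebesgue_rV n') else \d_(0 : 'rV[R]_0).

End lebesgue_rV.

Lemma lebesgue_rV_box {R : realType} n (A : 'I_n -> set R) :
  (forall i, measurable (A i : set (measurableTypeR R))) ->
  lebesgue_rV n [set x : 'rV[R]_n | forall i, A i (x ord0 i)] =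
  (\prod_(i < n) lebesgue_measure (A i))%E.
Proof.
elim: n A => [|n IH] A mA; first by rewrite big_ord0 /= diracE mem_set// => -[].
rewrite big_ord_recl -(IH (fun i => A (lift ord0 i)))//=.
rewrite /lebesgue_rVS /pushforward.
pose B := [set x : 'rV[R]_n | forall i, A (lift ord0 i) (x ord0 i)].
have mB : measurable B.
  rewrite (_ : B = \big[setI/setT]_(i < n)
      ((fun x : 'rV[R]_n => x ord0 i) @^-1` A (lift ord0 i))).
    apply: bigsetI_measurable => i _; rewrite -[X in measurable X]setTI.
    by apply: (measurable_coord_rV i) => //; exact: mA.
  rewrite -bigcap_seq; apply/seteqP; split => [x Bx i _|x Bx i].
    exact: Bx.
  exact: (Bx i (mem_index_enum i)).
rewrite -product_measure1E//; congr product_measure1.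
apply/seteqP; split => -[y v] /=.
  move=> H; split => [|i]; first by have := H ord0; rewrite cons_rV0.
  by have := H (lift ord0 i); rewrite cons_rVS.
move=> [Ay Bv] i; have [j ->|->] := unliftP ord0 i.
  by rewrite cons_rVS; exact: Bv.
by rewrite cons_rV0.
Qed.

(** The norm of the library on ['rV[R]_n] is the sup norm, hence its [ball] is
    not the Euclidean one. *)
Definition enorm {R : realType} n (x : 'rV[R]_n) : R :=
  Num.sqrt (\sum_(i < n) x ord0 i ^+ 2).

Definition eball {R : realType} n (x0 : 'rV[R]_n) (r : R) : set 'rV[R]_n :=
  [set x | enorm (x - x0) < r].

Definition compactly_contained {R : realType} n (A D : set 'rV[R]_n) : Prop :=
  compact (closure A) /\ closure A `<=` D.

(** Measurability with respect to the completion of [mu]. *)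
Definition ae_measurable d (T : measurableType d) (R : realType)
    (mu : {measure set T -> \bar R}) (f : T -> R) : Prop :=
  exists2 g : T -> R, measurable_fun setT g & {ae mu, forall x, f x = g x}.

(** The library's [ess_sup] and [ess_inf] are those over the whole space. *)
Definition ess_sup_on d (T : measurableType d) (R : realType)
    (mu : {measure set T -> \bar R}) (D : set T) (f : T -> R) : \bar R :=
  ereal_inf [set y | {ae mu, forall x, D x -> ((f x)%:E <= y)%E}].

Definition ess_inf_on d (T : measurableType d) (R : realType)
    (mu : {measure set T -> \bar R}) (D : set T) (f : T -> R) : \bar R :=
  ereal_sup [set y | {ae mu, forall x, D x -> (y <= (f x)%:E)%E}].

Section nonlocal_double_phase.
Context {R : realType} (n : nat).

Local Notation Rn := 'rV[R]_n.
Local Notation mu := (@lebesgue_rV R n).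
Local Notation mu2 := (mu \x mu)%E.

Definition bounded_domain (Omega : set Rn) : Prop :=
  [/\ open Omega, connected Omega & bounded_set Omega].

Definition measurable_symmetric (F : Rn -> Rn -> R) : Prop :=
  ae_measurable mu2 (fun z => F z.1 z.2) /\ forall x y, F x y = F y x.

Definition kernel_bounds (nu L s p : R) (K : Rn -> Rn -> R) : Prop :=
  {ae mu2, forall z, z.1 != z.2 ->
    nu / enorm (z.1 - z.2) `^ (n%:R + s * p) <= K z.1 z.2
      <= L / enorm (z.1 - z.2) `^ (n%:R + s * p)}.

Definition coeff_bounds (nu L : R) (a b : Rn -> Rn -> R) : Prop :=
  {ae mu2, forall z, nu <= a z.1 z.2 + b z.1 z.2 <= L}.

Definition holder_coeff (balpha alpha : R) (b : Rn -> Rn -> R) : Prop :=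
  forall x1 y1 x2 y2 : Rn,
    `|b x1 y1 - b x2 y2| <= balpha * (enorm (x1 - x2) + enorm (y1 - y2)) `^ alpha.

Definition COmega (Omega : set Rn) : set (Rn * Rn) :=
  ~` ((~` Omega) `*` (~` Omega)).

Definition energy_space (s t p : R) (a b : Rn -> Rn -> R) (Omega : set Rn)
    (f : Rn -> R) : Prop :=
  [/\ ae_measurable mu f,
      (\int[mu]_(x in Omega) (`|f x| `^ p)%:E < +oo)%E &
      (\int[mu2]_(z in COmega Omega)
         (a z.1 z.2 * (`|f z.1 - f z.2| `^ p /
                         enorm (z.1 - z.2) `^ (n%:R + s * p)) +
          b z.1 z.2 * (`|f z.1 - f z.2| `^ p /
                         enorm (z.1 - z.2) `^ (n%:R + t * p)))%:E < +oo)%E].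

Definition weak_solution (s t p : R) (Ksp Ktp a b : Rn -> Rn -> R)
    (Omega : set Rn) (u : Rn -> R) : Prop :=
  energy_space s t p a b Omega u /\
  forall phi : Rn -> R, energy_space s t p a b Omega phi ->
    {ae mu, forall x, ~ Omega x -> phi x = 0} ->
    (\int[mu2]_(z in COmega Omega)
       (`|u z.1 - u z.2| `^ (p - 2) * (u z.1 - u z.2) * (phi z.1 - phi z.2) *
        (a z.1 z.2 * Ksp z.1 z.2 + b z.1 z.2 * Ktp z.1 z.2))%:E = 0)%E.

Definition nonlocal_tail (s t p : R) (a b : Rn -> Rn -> R) (f : Rn -> R)
    (x0 : Rn) (r rho : R) : \bar R :=
  ereal_sup [set (\int[mu]_(y in ~` eball x0 r)
     (a x y * (`|f y| `^ (p - 1) / enorm (y - x0) `^ (n%:R + s * p)) +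
      b x y * (`|f y| `^ (p - 1) / enorm (y - x0) `^ (n%:R + t * p)))%:E)%E
   | x in eball x0 rho].

Definition tail_space (s t p : R) (a b : Rn -> Rn -> R) (f : Rn -> R) : Prop :=
  [/\ ae_measurable mu f,
      forall C : set Rn, compact C ->
        (\int[mu]_(x in C) (`|f x| `^ (p - 1))%:E < +oo)%E &
      forall (x0 : Rn) (r rho : R), 0 < r -> 0 < rho ->
        (nonlocal_tail s t p a b f x0 r rho < +oo)%E].

Definition Gball (s t p : R) (a b : Rn -> Rn -> R) (x0 : Rn) (r tau : R)
    : \bar R :=
  ereal_sup [set (a z.1 z.2 * (tau `^ p / r `^ (s * p)) +
                  b z.1 z.2 * (tau `^ p / r `^ (t * p)))%:E
            | z in eball x0 r `*` eball x0 r].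

(** At [tau = 0] the library convention [0^-1 = 0] gives the value 0 of
    [G_{B_r}(1) * tau `^ (p - 1)]. *)
Definition gball (s t p : R) (a b : Rn -> Rn -> R) (x0 : Rn) (r tau : R)
    : \bar R :=
  (Gball s t p a b x0 r tau * (tau^-1)%:E)%E.

Definition gball_inv (s t p : R) (a b : Rn -> Rn -> R) (x0 : Rn) (r : R)
    : \bar R -> R :=
  'pinv_(fun=> 0) `[0, +oo[%classic (gball s t p a b x0 r).

End nonlocal_double_phase.

(* Main.v *)
Require Import Defs.
From mathcomp Require Import all_boot all_order all_algebra.
From mathcomp Require Import all_classical all_reals all_analysis.
From mathcomp Require Import measurable_realfun ring lra.

(** Let [d > g_{B_r}^{-1}(T(u_-))] and [v = u + d], measure lengths in units of
    [r] and divide the kernel by [G_{B_r}(1)]. As [b] is bounded, it is Hölder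
    continuous of exponent exactly [(t - s) p], and then all bounds on the
    rescaled kernel [J] are uniform in [r]; no dichotomy between the two phases
    is needed.

    Testing the equation with [eta ^ m * v ^ (1 - p)], the pairs [(x, y)] at
    which [v y] is much larger than [v x] give
    [\iint_{x \in B_7} ((v_+(y) / v(x)) ^ (p - 1) - 2 ^ (p - 1))_+ J(x, y) <= C |B|].
    Since [J] is bounded below on the ball, this is an A_2 condition
    [\int v ^ (p - 1) * \int v ^ (1 - p) <= C |B| ^ 2], obtained without any
    covering or John-Nirenberg argument; since [J(x, y)] and [J(x', y)] are
    comparable for [y] away from [x] and [x'], it also bounds the tail of [v] by
    [k ^ (p - 1)], where [k ^ (p - 1)] is the mean of [v ^ (p - 1)].

    De Giorgi's iteration only uses the cross term of the Caccioppoli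
    inequality: instead of a Sobolev embedding, [\int_{B \ A} J(x, y) dy] is at
    least [c |A| ^ (- s p / n)] for a small set [A]. Applied to [- v] it gives
    [v >= c k], and applied to [v], after interpolation between radii,
    [v <= C k]. Finally [d] tends to [g_{B_r}^{-1}(T(u_-))]. *)

Import Order.TTheory GRing.Theory Num.Def Num.Theory.
Import numFieldNormedType.Exports.

Local Open Scope classical_set_scope.
Local Open Scope ring_scope.

Set Implicit Arguments.
Unset Strict Implicit.
Unset Printing Implicit Defensive.

(** * Pointwise inequalities *)

(** Why no phase dichotomy arises: for [b] of exponent (t - s) p, moving both arguments by a
    multiple of r changes b r^(-tp) by at most a multiple of r^(-sp). That is the size of the first
    phase, which is always present because a = 1. After division by G_{B_r}(1), the weight of the
    second phase therefore oscillates, at distances of order r, only by an amount the first phase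
    controls. The radii form a ladder in units of r. The solution is nonnegative up to 10,
    admissible cutoffs vanish from 9 on, the logarithmic cutoff falls from 1 to 0 between 7 and 8,
    means are taken over 7, all iterations stay within 7, and the conclusion is read at 1. The gaps
    keep the far parts of the integrals away from the singularity of the kernel. Cutoffs are raised
    to an integer power m + 1 >= p, so that a power of the cutoff left over in a product rule still
    dominates the real power that is needed. The shift [d] has to be strictly positive even when the
    tail vanishes, since v^(1-p) is only a Lipschitz function of u when v stays away from 0. *)

Section pointwise.
Context {R : realType}.
Implicit Types (a b c p t x y X Y : R).

Lemma le_of_eq x y : x = y -> x <= y. Proof. by move->. Qed.

Lemma powRS t p : 0 <= t -> p != 0 -> t `^ p = t `^ (p - 1) * t.
Proof.
move=> t0 p0; have := t0; rewrite le_eqVlt => /predU1P[<-|tp].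
  by rewrite powR0// mulr0.
rewrite -[X in _ * X](powRr1 t0) -powRD ?subrK//.
by rewrite (gt_eqF tp) implybT.
Qed.

Lemma powRV c p : 0 <= c -> c^-1 `^ p = (c `^ p)^-1.
Proof. by move=> c0; rewrite -powR_inv1// -powRrM mulN1r powRN. Qed.

Lemma ler_wpowR q x y : 0 <= q -> 0 <= x -> x <= y -> x `^ q <= y `^ q.
Proof.
by move=> q0 x0 xy; apply: ge0_ler_powR; rewrite ?nnegrE// (le_trans x0).
Qed.

Lemma powRD_le q a b : 0 <= q -> 0 <= a -> 0 <= b ->
  (a + b) `^ q <= 2 `^ q * (a `^ q + b `^ q).
Proof.
move=> q0 a0 b0; wlog ab : a b a0 b0 / a <= b.
  move=> H; have /orP[ab|ab] := le_total a b; first exact: H.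
  by rewrite addrC [X in _ * X]addrC; exact: H.
apply: (@le_trans _ _ ((2 * b) `^ q)).
  by apply: ge0_ler_powR; rewrite ?nnegrE//; lra.
by rewrite powRM// ler_wpM2l ?powR_ge0// lerDr powR_ge0.
Qed.

Definition Jp p t : R := `|t| `^ (p - 2) * t.

Lemma JpN p t : Jp p (- t) = - Jp p t.
Proof. by rewrite /Jp normrN mulrN. Qed.

Lemma Jp_powR p t : 1 < p -> 0 <= t -> Jp p t = t `^ (p - 1).
Proof.
move=> p1 t0; rewrite /Jp ger0_norm// (@powRS t (p - 1))//; last first.
  by rewrite subr_eq0 gt_eqF.
by congr (_ `^ _ * _); ring.
Qed.

Lemma Jp_ge0 p t : 0 <= t -> 0 <= Jp p t.
Proof. by move=> t0; rewrite /Jp mulr_ge0// powR_ge0. Qed.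

Lemma exprB_le m X Y : 0 <= X -> X <= Y ->
  Y ^+ m.+1 - X ^+ m.+1 <= m.+1%:R * Y ^+ m * (Y - X).
Proof.
move=> X0 XY; have Y0 := le_trans X0 XY.
elim: m => [|m IH]; first by rewrite !expr0 !expr1; lra.
have -> : Y ^+ m.+2 - X ^+ m.+2 =
    Y * (Y ^+ m.+1 - X ^+ m.+1) + X ^+ m.+1 * (Y - X).
  by rewrite !exprS; ring.
have -> : m.+2%:R * Y ^+ m.+1 * (Y - X) =
    Y * (m.+1%:R * Y ^+ m * (Y - X)) + Y ^+ m.+1 * (Y - X).
  by rewrite -(addn1 m.+1) natrD !exprS; ring.
by rewrite lerD ?ler_wpM2l// ler_wpM2r ?subr_ge0// lerXn2r// nnegrE.
Qed.

Lemma powR_le1 t p : 0 <= t <= 1 -> 0 <= p -> t `^ p <= 1.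
Proof.
move=> /andP[t0 t1] p0; have <- : 1 `^ p = 1 :> R by rewrite powR1.
by rewrite ge0_ler_powR// nnegrE.
Qed.

Lemma expr_le_powR m p X : 0 <= X <= 1 -> 0 <= p -> p <= m%:R -> (0 < m)%N ->
  X ^+ m <= X `^ p.
Proof.
move=> /andP[X0 X1] p0 pm m0; have := X0; rewrite le_eqVlt => /predU1P[<-|Xp].
  by rewrite expr0n -[m == 0%N]negbK -lt0n m0 powR_ge0.
by rewrite -powR_mulrn// ger_powR// Xp.
Qed.

(* The one inequality behind both energy estimates: a discrete product rule in
   which the bad term [Y ^+ m - X ^+ m] is either dominated by the good term
   [t * X ^+ m] or forces [t * X] to be of the order of [Y - X]. *)
Definition cutoff_const p m c : R :=
  2 `^ p + (m%:R * 2 ^+ m.-1) `^ p / c `^ (p - 1).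

Lemma cutoff_const_gt0 p m c : 0 < c -> 0 < cutoff_const p m c.
Proof.
by move=> c0; rewrite ltr_pwDl ?powR_gt0// divr_ge0 ?powR_ge0.
Qed.

Lemma cutoff_ineq p m c t X Y : 1 < p -> p <= m.+1%:R -> 0 < c ->
  0 <= t <= 1 -> 0 <= X -> X <= Y -> Y <= 1 ->
  t `^ (p - 1) * ((Y ^+ m.+1 - X ^+ m.+1) - c * t * X ^+ m.+1) <=
  cutoff_const p m.+1 c * (Y - X) `^ p.
Proof.
move=> p1 pm c0 /andP[t0 t1] X0 XY Y1.
have p0 : 0 <= p by lra.
have Y0 : 0 <= Y by exact: le_trans XY.
have d0 : 0 <= Y - X by rewrite subr_ge0.
have tp1 : t `^ (p - 1) <= 1.
  by rewrite powR_le1 ?t0//; lra.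
have [br|br] := leP ((Y ^+ m.+1 - X ^+ m.+1) - c * t * X ^+ m.+1) 0.
  apply: (@le_trans _ _ 0); first by rewrite mulr_ge0_le0// powR_ge0.
  by rewrite mulr_ge0 ?powR_ge0// ltW// cutoff_const_gt0.
rewrite /cutoff_const mulrDl.
(* Either the jump [Y - X] is comparable to [Y], and Y^(m+1) <= Y^p suffices, or [X] exceeds [Y / 2]
   and the difference of powers can be linearised at [X]. *)
have [h|h] := leP (Y / 2) (Y - X).
  apply: (@le_trans _ _ ((2 * (Y - X)) `^ p)); last first.
    by rewrite powRM// lerDl mulr_ge0 ?powR_ge0// divr_ge0 ?powR_ge0.
  apply: (@le_trans _ _ (Y ^+ m.+1)).
    apply: (@le_trans _ _ (1 * Y ^+ m.+1)); last by rewrite mul1r.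
    apply: ler_pM => //; [exact: powR_ge0|exact: ltW|].
    have := exprn_ge0 m.+1 X0.
    have : 0 <= c * t * X ^+ m.+1 by rewrite !mulr_ge0 ?exprn_ge0// ltW.
    by lra.
  apply: (@le_trans _ _ (Y `^ p)).
    by rewrite expr_le_powR// Y0.
  by rewrite ge0_ler_powR// ?nnegrE//; lra.
have X0' : 0 < X by lra.
set D := m.+1%:R * 2 ^+ m.+1.-1.
have D0 : 0 <= D by rewrite mulr_ge0// exprn_ge0.
have mvt : Y ^+ m.+1 - X ^+ m.+1 <= D * X ^+ m * (Y - X).
  apply: le_trans (exprB_le m X0 XY) _.
  rewrite ler_wpM2r// /D -!mulrA ler_wpM2l// -exprMn lerXn2r// ?nnegrE//.
    by rewrite mulr_ge0.
  by lra.
clearbody D.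
(* Positivity of the bracket bounds [t * X] by the jump. The factor X^m left by the linearisation
   then turns t^(p-1) into (t X)^(p-1), because p - 1 <= m. *)
have tX : t * X <= D * (Y - X) / c.
  rewrite ler_pdivlMr// -(ler_pM2r (exprn_gt0 m X0')).
  have : 0 < D * X ^+ m * (Y - X) - c * t * X ^+ m.+1 by lra.
  rewrite exprS => ?; nra.
apply: (@le_trans _ _ (t `^ (p - 1) * (D * X ^+ m * (Y - X)))).
  rewrite ler_wpM2l ?powR_ge0//.
  have : 0 <= c * t * X ^+ m.+1 by rewrite !mulr_ge0 ?exprn_ge0// ltW.
  by lra.
apply: (@le_trans _ _ ((t * X) `^ (p - 1) * (D * (Y - X)))).
  rewrite powRM// -!mulrA ler_wpM2l ?powR_ge0//.
  rewrite [leRHS]mulrCA ler_wpM2l// ler_wpM2r//.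
  have [m0|m0] := posnP m.
    have -> : p = 1 by move: pm; rewrite m0; lra.
    by rewrite m0 subrr powRr0 expr0.
  rewrite expr_le_powR//; [by rewrite X0; lra|by lra|].
  by move: pm; rewrite -natr1; lra.
apply: (@le_trans _ _ ((D * (Y - X) / c) `^ (p - 1) * (D * (Y - X)))).
  rewrite ler_wpM2r// ?mulr_ge0// ge0_ler_powR// ?nnegrE; [lra| |].
    by rewrite mulr_ge0.
  by rewrite !mulr_ge0// ?invr_ge0 ltW.
rewrite -[leLHS]add0r lerD//; first by rewrite mulr_ge0 ?powR_ge0.
rewrite powRM ?mulr_ge0//; last by rewrite invr_ge0 ltW.
rewrite mulrAC -powRS ?mulr_ge0//; last by rewrite gt_eqF//; lra.
rewrite (powRV _ (ltW c0)) powRM//.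
by rewrite mulrAC.
Qed.

End pointwise.

Section pointwise_energy.
Context {R : realType}.
Implicit Types (a b c p t x y X Y k : R).

(** By oddness of [Jp] one may take [b <= a], and by homogeneity only t = (a - b) / a matters. A
    wrong sign requires a larger cutoff at the smaller value; there the drop from [a] to [b]
    supplies the good term of [cutoff_ineq] with c = 1. *)
Lemma caccioppoli_ineq p m a b X Y : 1 < p -> p <= m.+1%:R ->
  0 <= a -> 0 <= b -> 0 <= X <= 1 -> 0 <= Y <= 1 ->
  - (cutoff_const p m.+1 1 * maxr a b `^ p * `|X - Y| `^ p) <=
  Jp p (a - b) * (X ^+ m.+1 * a - Y ^+ m.+1 * b).
Proof.
move=> p1 pm.
wlog ba : a b X Y / b <= a.
  move=> H a0 b0 hX hY; have /orP[ba|ab] := le_total b a; first exact: H.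
  have -> : Jp p (a - b) * (X ^+ m.+1 * a - Y ^+ m.+1 * b) =
      Jp p (b - a) * (Y ^+ m.+1 * b - X ^+ m.+1 * a).
    by rewrite -[a - b]opprB JpN; ring.
  by rewrite maxC distrC; exact: H.
move=> a0 b0 /andP[X0 X1] /andP[Y0 Y1]; rewrite (max_idPl ba).
have cC := @cutoff_const_gt0 _ p m.+1 1 ltr01.
have rhs0 : 0 <= cutoff_const p m.+1 1 * a `^ p * `|X - Y| `^ p.
  by rewrite !mulr_ge0 ?powR_ge0// ltW.
have [YX|/ltW XY] := leP Y X.
  apply: (@le_trans _ _ 0); first by rewrite oppr_le0.
  rewrite mulr_ge0// ?Jp_ge0 ?subr_ge0//.
  by apply: ler_pM => //; rewrite ?exprn_ge0// lerXn2r// nnegrE.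
have := a0; rewrite le_eqVlt => /predU1P[a00|ap].
  have b00 : b = 0 by apply/eqP; rewrite eq_le b0 andbT; rewrite a00.
  by move: rhs0; rewrite -a00 b00 !mulr0 subrr mulr0 oppr_le0.
pose t := (a - b) / a.
have t01 : 0 <= t <= 1.
  by rewrite /t divr_ge0 ?subr_ge0//= ler_pdivrMr// mul1r gerBl.
have abE : a - b = a * t by rewrite /t mulrC divfK// gt_eqF.
have bE : b = a * (1 - t) by rewrite mulrBr mulr1 -abE; ring.
have t0 : 0 <= t by case/andP: t01.
rewrite Jp_powR ?subr_ge0// abE powRM//.
have -> : X ^+ m.+1 * a - Y ^+ m.+1 * b =
    a * (- ((Y ^+ m.+1 - X ^+ m.+1) - t * Y ^+ m.+1)) by rewrite bE; ring.
rewrite mulrACA -powRS//; last by rewrite gt_eqF//; lra.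
rewrite !mulrN lerN2 distrC ger0_norm ?subr_ge0// [leRHS]mulrAC [leRHS]mulrC.
rewrite ler_wpM2l ?powR_ge0//.
apply: le_trans _ (cutoff_ineq p1 pm ltr01 t01 X0 XY Y1).
rewrite ler_wpM2l ?powR_ge0// lerD2l lerN2 mul1r ler_wpM2l//.
by rewrite lerXn2r// nnegrE.
Qed.

(** Bernoulli's inequality for a negative exponent: exp z >= 1 + z at z = -q ln (1 - t), together
    with -ln (1 - t) >= t. *)
Lemma powR_log_lower q t : 0 < q -> 0 <= t < 1 -> 1 + q * t <= (1 - t)^-1 `^ q.
Proof.
move=> q0 /andP[t0 t1]; have t10 : 0 < 1 - t by rewrite subr_gt0.
rewrite /powR gt_eqF ?invr_gt0// lnV ?posrE//.
apply: le_trans (expR_ge1Dx _); rewrite lerD2l ler_wpM2l ?(ltW q0)//.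
by rewrite lerNr; apply: le_ln1Dx; rewrite ltrN2.
Qed.

(* Here [Y] is the cutoff at the larger value [a], [X] that at [b]. *)
Lemma log_ineq p m a b X Y : 1 < p -> p <= m.+1%:R ->
  0 < b -> b <= a -> 0 <= X <= 1 -> 0 <= Y <= 1 ->
  (a - b) `^ (p - 1) * (Y ^+ m.+1 / a `^ (p - 1) - X ^+ m.+1 / b `^ (p - 1)) <=
  cutoff_const p m.+1 (p - 1) * `|X - Y| `^ p.
Proof.
move=> p1 pm b0 ba /andP[X0 X1] /andP[Y0 Y1].
have p10 : 0 < p - 1 by lra.
have a0 : 0 < a by exact: lt_le_trans ba.
have ab0 : 0 <= a - b by rewrite subr_ge0.
have cC := @cutoff_const_gt0 _ p m.+1 _ p10.
pose t := (a - b) / a.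
have t0 : 0 <= t by rewrite divr_ge0// ltW.
have t1 : t < 1 by rewrite ltr_pdivrMr// mul1r gtrBl.
have bE : b = a * (1 - t).
  by rewrite mulrBr mulr1 /t mulrC divfK ?gt_eqF//; ring.
have abE : a - b = a * t by rewrite /t mulrC divfK// gt_eqF.
have ap0 : 0 < a `^ (p - 1) by rewrite powR_gt0.
(* The expression is homogeneous of degree 0 in (a, b), so only [t] survives. *)
have -> : (a - b) `^ (p - 1) * (Y ^+ m.+1 / a `^ (p - 1) - X ^+ m.+1 / b `^ (p - 1))
    = t `^ (p - 1) * (Y ^+ m.+1 - X ^+ m.+1 * (1 - t)^-1 `^ (p - 1)).
  have t1p : 0 < (1 - t) `^ (p - 1) by rewrite powR_gt0// subr_gt0.
  have t1' : 0 <= 1 - t by rewrite subr_ge0 ltW.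
  rewrite powRV// abE bE powRM ?(ltW a0)// powRM ?(ltW a0)//.
  by field; rewrite !gt_eqF.
have [YX|/ltW XY] := leP Y X.
  apply: (@le_trans _ _ 0); last by rewrite !mulr_ge0 ?powR_ge0// ltW.
  rewrite mulr_ge0_le0 ?powR_ge0// subr_le0.
  apply: (@le_trans _ _ (X ^+ m.+1 * 1)); first by rewrite mulr1 lerXn2r// nnegrE.
  rewrite ler_wpM2l ?exprn_ge0//.
  have := @powR_log_lower (p - 1) t p10; rewrite t0 t1 => /(_ isT).
  by apply: le_trans; rewrite lerDl mulr_ge0// ltW.
rewrite distrC ger0_norm ?subr_ge0//.
have t01 : 0 <= t <= 1 by rewrite t0 ltW.
(* The constant p - 1 is the first-order coefficient of (1 - t)^(1-p): the growth of the inverse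
   power at the smaller value is the good term. *)
apply: le_trans _ (cutoff_ineq p1 pm p10 t01 X0 XY Y1).
rewrite ler_wpM2l ?powR_ge0//.
have := @powR_log_lower (p - 1) t p10; rewrite t0 t1 => /(_ isT) h.
have := ler_wpM2l (exprn_ge0 m.+1 X0) h.
by lra.
Qed.

(** For a >= 2 b, replacing a - b by a / 2 costs 2^(p-1), and the term with a^(1-p) cancels at most
    the fraction 2^(1-p) of the term with b^(1-p); the denominator is what remains. *)
Definition harnack_const p : R := 2 `^ (p - 1) / (1 - 2^-1 `^ (p - 1)).

Lemma half_powR_lt1 q : 0 < q -> 2^-1 `^ q < 1 :> R.
Proof.
move=> q0; have h : 1 `^ q = 1 :> R by rewrite powR1.
rewrite -[ltRHS]h; apply: gt0_ltr_powR; rewrite ?nnegrE//.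
by rewrite invf_lt1// ltr1n.
Qed.

Lemma harnack_const_gt0 p : 1 < p -> 0 < harnack_const p.
Proof.
move=> p1; rewrite divr_gt0 ?powR_gt0// subr_gt0 half_powR_lt1//; lra.
Qed.

(* Interactions at distance see the whole quotient [a / b], not merely its
   logarithm. *)
Lemma quotient_ineq p m a b Y : 1 < p -> 0 < b -> 2 * b <= a -> 0 <= Y <= 1 ->
  (a / b) `^ (p - 1) <=
  harnack_const p * ((a - b) `^ (p - 1) * (b `^ (p - 1))^-1
    - (a - b) `^ (p - 1) * (Y ^+ m / a `^ (p - 1))).
Proof.
move=> p1 b0 ba /andP[Y0 Y1].
have p10 : 0 < p - 1 by lra.
have a0 : 0 < a by lra.
have h1 : 0 < 1 - 2^-1 `^ (p - 1) :> R by rewrite subr_gt0 half_powR_lt1.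
have bp : 0 < b `^ (p - 1) by rewrite powR_gt0.
have ap : 0 < a `^ (p - 1) by rewrite powR_gt0.
have cp : 0 < (a / 2) `^ (p - 1) by rewrite powR_gt0// divr_gt0.
have Ym : Y ^+ m / a `^ (p - 1) <= 2^-1 `^ (p - 1) / b `^ (p - 1).
  rewrite ler_pdivrMr// mulrAC ler_pdivlMr//.
  apply: (@le_trans _ _ (1 * b `^ (p - 1))).
    by rewrite ler_wpM2r ?(ltW bp)// exprn_ile1.
  rewrite mul1r -powRM ?invr_ge0// ?(ltW a0)//.
  rewrite ge0_ler_powR// ?nnegrE ?(ltW b0)// ?(ltW p10)//.
    by rewrite mulr_ge0// ltW.
  by lra.
have abp : (a / 2) `^ (p - 1) <= (a - b) `^ (p - 1).
  rewrite ge0_ler_powR// ?nnegrE ?(ltW p10)//; lra.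
apply: (@le_trans _ _ (harnack_const p *
    ((a / 2) `^ (p - 1) * ((1 - 2^-1 `^ (p - 1)) / b `^ (p - 1))))).
  rewrite /harnack_const !powRM ?invr_ge0// ?(ltW a0)//; last exact: ltW.
  rewrite !powRV//; last exact: ltW.
  have h2 : 0 < 2 `^ (p - 1) :> R by rewrite powR_gt0.
  have h3 : 0 < 1 - (2 `^ (p - 1))^-1 :> R by rewrite -powRV.
  have h4 : 0 < 2 `^ (p - 1) - 1 :> R.
    have -> : 2 `^ (p - 1) - 1 = 2 `^ (p - 1) * (1 - (2 `^ (p - 1))^-1) :> R.
      by rewrite mulrBr mulr1 divff// gt_eqF.
    by rewrite mulr_gt0.
  apply: le_of_eq; field.
  by rewrite !gt_eqF.
rewrite ler_wpM2l ?(ltW (harnack_const_gt0 _))//.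
rewrite -mulrBr; apply: ler_pM => //; first exact: ltW.
  by rewrite divr_ge0 ?ltW.
by rewrite mulrBl mul1r lerB.
Qed.

End pointwise_energy.

(** * Integrals of functions that need not be measurable or integrable *)

Section inner_integral.
Context d (T : measurableType d) (R : realType).
Variable mu : {measure set T -> \bar R}.
Local Open Scope ereal_scope.
Import HBNNSimple.

(* The integral of a nonnegative function is a supremum over simple functions
   below it, so no measurability is needed here. *)
Lemma ae_le_integral_inner (f g : T -> \bar R) :
  (forall x, 0 <= f x) -> (forall x, 0 <= g x) -> {ae mu, forall x, f x <= g x} ->
  \int[mu]_x f x <= \int[mu]_x g x.
Proof.
move=> f0 g0 [N [mN N0 fgN]].
rewrite !ge0_integralTE//; apply: ge_ereal_sup => _ [h hf <-].
(* Setting the simple function to 0 on the exceptional set keeps its integral and makes it lie below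
   [g] everywhere. *)
pose h' := [the {nnsfun T >-> R} of proj_nnsfun h (measurableC mN)].
have h'E x : h' x = (h x * \1_(~` N) x)%R by [].
have -> : sintegral mu h = sintegral mu h'.
  rewrite -!integralT_nnsfun; apply: ae_eq_integral => //.
  - by apply/measurable_EFinP; exact: measurable_funP.
  - by apply/measurable_EFinP; exact: measurable_funP.
  - exists N; split => // x; apply: contra_notP => xN _.
    by rewrite h'E indicE in_setC memNset// mulr1.
apply: ereal_sup_ubound; exists h' => // x.
rewrite h'E indicE in_setC; case: (boolP (x \in N)) => xN /=.
  by rewrite mulr0.
rewrite mulr1; apply: le_trans (hf x) _.
by apply: contrapT => fg; move: xN; rewrite notin_setE; apply; exact: fgN.
Qed.

Lemma le_integral_inner (f g : T -> \bar R) :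
  (forall x, 0 <= f x) -> (forall x, f x <= g x) ->
  \int[mu]_x f x <= \int[mu]_x g x.
Proof.
move=> f0 fg; apply: ae_le_integral_inner => //; first by move=> x; exact: le_trans (fg x).
exact: aeW.
Qed.

Lemma ae_eq_integral_inner (f g : T -> \bar R) : {ae mu, forall x, f x = g x} ->
  \int[mu]_x f x = \int[mu]_x g x.
Proof.
move=> fg; rewrite integralE [RHS]integralE; congr (_ - _);
  apply/eqP; rewrite eq_le; apply/andP; split; apply: ae_le_integral_inner => //;
  by apply: filterS fg => x fgx; rewrite ?funeposE ?funenegE fgx.
Qed.

(* No integrability of [F] is assumed: a finite bound on its negative part is
   enough to separate the two parts of its integral. *)
Lemma le_integral_of_zero (F P N : T -> R) :
  measurable_fun setT F -> measurable_fun setT P -> measurable_fun setT N ->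
  (forall x, 0 <= P x)%R -> (forall x, 0 <= N x)%R ->
  (forall x, P x <= F x + N x)%R -> \int[mu]_x (F x)%:E = 0 ->
  \int[mu]_x (P x)%:E <= \int[mu]_x (N x)%:E.
Proof.
move=> mF mP mN P0 N0 PFN; rewrite integralE.
set Ip := \int[mu]_x _; set Im := \int[mu]_x _ => II.
have [->|Nfin] := eqVneq (\int[mu]_x (N x)%:E) +oo; first by rewrite leey.
have mF' : measurable_fun setT (fun x => (F x)%:E) by exact/measurable_EFinP.
have mN' : measurable_fun setT (fun x => (N x)%:E) by exact/measurable_EFinP.
have mP' : measurable_fun setT (fun x => (P x)%:E) by exact/measurable_EFinP.
have Im0 : 0 <= Im by exact: integral_ge0.
(* As P >= 0, the negative part of F lies below N. Its integral is thus finite, hence equal to that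
   of the positive part, and both can be added to the two sides of the claim. *)
have ImN : Im <= \int[mu]_x (N x)%:E.
  apply: le_integral_inner => // x; rewrite funenegE ge_max -EFinN !lee_fin N0 andbT.
  by have := P0 x; have := PFN x; lra.
have Imfin : Im \is a fin_num.
  by rewrite ge0_fin_numE//; apply: le_lt_trans ImN _; rewrite ltey.
have IpE : Ip = Im by rewrite -[LHS](subeK Ip Imfin) II add0e.
rewrite -(leeD2lE _ _ Imfin) -[in leRHS]IpE.
rewrite -!ge0_integralD//; last 4 first.
- exact: measurable_funepos.
- by move=> x _; rewrite lee_fin.
- exact: measurable_funeneg.
- by move=> x _; rewrite lee_fin.
apply: le_integral_inner => x; first by rewrite adde_ge0// lee_fin.
rewrite funeposE funenegE -EFinN -!EFin_max -!EFinD lee_fin.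
have := PFN x; rewrite /maxr; case: ifPn; case: ifPn; lra.
Qed.

End inner_integral.

Section measurable_real.
Context d (T : measurableType d) (R : realType).
Implicit Types (f g : T -> R).

Lemma measurable_lt_indic f g : measurable_fun setT f -> measurable_fun setT g ->
  measurable_fun setT (fun x => (f x < g x)%R%:R : R).
Proof.
move=> mf mg; have := measurable_fun_ltr mf mg => mfg.
apply: (eq_measurable_fun (fun x => if (f x < g x)%R then 1 else 0 : R)).
  by move=> x _; case: ifP.
exact: measurable_fun_ifT.
Qed.

Lemma measurable_le_indic f g : measurable_fun setT f -> measurable_fun setT g ->
  measurable_fun setT (fun x => (f x <= g x)%R%:R : R).
Proof.
move=> mf mg; have := measurable_fun_ler mf mg => mfg.
apply: (eq_measurable_fun (fun x => if (f x <= g x)%R then 1 else 0 : R)).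
  by move=> x _; case: ifP.
exact: measurable_fun_ifT.
Qed.

Lemma measurable_fun_powR f p : measurable_fun setT f ->
  measurable_fun setT (fun x => f x `^ p).
Proof. by move=> mf; exact: (measurableT_comp (measurable_powR p)). Qed.

Lemma measurable_fun_norm f : measurable_fun setT f ->
  measurable_fun setT (fun x => `|f x|).
Proof. by move=> mf; exact: (measurableT_comp (@normr_measurable R setT)). Qed.

Lemma measurable_fun_invr f : measurable_fun setT f ->
  measurable_fun setT (fun x => (f x)^-1).
Proof.
(* Inversion becomes a real power of the nonnegative function f^2; at zeros of f both sides are 0 by
   the convention 0^-1 = 0. *)
move=> mf; apply: (eq_measurable_fun (fun x => f x * (f x ^+ 2) `^ (-1))).
  move=> x _; rewrite powR_inv1 ?sqr_ge0//.
  have [->|fx0] := eqVneq (f x) 0; first by rewrite mul0r invr0.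
  by rewrite expr2 invfM mulrA divff// mul1r.
by apply: measurable_funM => //; apply: measurable_fun_powR; exact: measurable_funX.
Qed.

End measurable_real.

Ltac mfun := try assumption; lazymatch goal with
  | |- measurable_fun _ (fun _ => ?c) => exact: measurable_cst
  | |- measurable_fun _ (fun x => x) => exact: measurable_id
  | |- measurable_fun _ (fun x => fst x) => exact: measurable_fst
  | |- measurable_fun _ (fun x => snd x) => exact: measurable_snd
  | |- measurable_fun _ (fun x => (@?f x, @?g x)) =>
    apply: measurable_fun_pair; mfun
  | |- measurable_fun _ (fun x => GRing.mul (@?f x) (@?g x)) =>
    apply: measurable_funM; mfun
  | |- measurable_fun _ (fun x => GRing.add (@?f x) (GRing.opp (@?g x))) =>
    apply: measurable_funB; mfun
  | |- measurable_fun _ (fun x => GRing.add (@?f x) (@?g x)) =>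
    apply: measurable_funD; mfun
  | |- measurable_fun _ (fun x => GRing.opp (@?f x)) =>
    apply: measurable_funN; mfun
  | |- measurable_fun _ (fun x => GRing.inv (@?f x)) =>
    apply: measurable_fun_invr; mfun
  | |- measurable_fun _ (fun x => GRing.exp (@?f x) _) =>
    apply: measurable_funX; mfun
  | |- measurable_fun _ (fun x => powR (@?f x) _) =>
    apply: measurable_fun_powR; mfun
  | |- measurable_fun _ (fun x => Num.norm (@?f x)) =>
    apply: measurable_fun_norm; mfun
  | |- measurable_fun _ (fun x => Order.max (@?f x) (@?g x)) =>
    apply: measurable_maxr; mfun
  | |- measurable_fun _ (fun x => Order.min (@?f x) (@?g x)) =>
    apply: measurable_minr; mfun
  | |- measurable_fun _ (fun x => _ (nat_of_bool (Order.lt (@?f x) (@?g x)))) =>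
    apply: measurable_lt_indic; mfun
  | |- measurable_fun _ (fun x => _ (nat_of_bool (Order.le (@?f x) (@?g x)))) =>
    apply: measurable_le_indic; mfun
  | H : measurable_fun setT ?f |- measurable_fun _ (fun z => ?f (@?g z)) =>
    apply: (measurableT_comp H); mfun
  | _ => idtac
  end.

Ltac nneg := try assumption; lazymatch goal with
  | |- forall _, _ => move=> ?; nneg
  | |- is_true (Order.le _ (GRing.mul _ _)) => apply: mulr_ge0; nneg
  | |- is_true (Order.le _ (GRing.add _ (GRing.opp _))) => idtac
  | |- is_true (Order.le _ (GRing.add _ _)) => apply: addr_ge0; nneg
  | |- is_true (Order.le _ (powR _ _)) => exact: powR_ge0
  | |- is_true (Order.le _ (GRing.inv _)) => rewrite invr_ge0; nneg
  | |- is_true (Order.le _ (GRing.exp _ _)) => apply: exprn_ge0; nneg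
  | |- is_true (Order.le _ (Num.norm _)) => exact: normr_ge0
  | |- is_true (Order.le _ (Order.max GRing.zero _)) => by rewrite le_max lexx
  | _ => first [done | by apply: ltW | idtac]
  end.

Section real_integral.
Context d (T : measurableType d) (R : realType).
Variable mu : {measure set T -> \bar R}.
Implicit Types (f g : T -> R).
Local Open Scope ereal_scope.

Lemma integral_EFinZ (c : R) f : (0 <= c)%R -> measurable_fun setT f ->
  (forall x, 0 <= f x)%R -> \int[mu]_x (c * f x)%:E = c%:E * \int[mu]_x (f x)%:E.
Proof.
move=> c0 mf f0; under eq_integral do rewrite EFinM.
by rewrite ge0_integralZl_EFin//; [move=> x _; rewrite lee_fin|exact/measurable_EFinP].
Qed.

Lemma integral_EFinD f g : measurable_fun setT f -> measurable_fun setT g ->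
  (forall x, 0 <= f x)%R -> (forall x, 0 <= g x)%R ->
  \int[mu]_x (f x + g x)%:E = \int[mu]_x (f x)%:E + \int[mu]_x (g x)%:E.
Proof.
move=> mf mg f0 g0; under eq_integral do rewrite EFinD.
rewrite ge0_integralD//; first [by move=> x _; rewrite lee_fin|exact/measurable_EFinP].
Qed.

Lemma integral_EFin_ge0 f : (forall x, 0 <= f x)%R -> 0 <= \int[mu]_x (f x)%:E.
Proof. by move=> f0; apply: integral_ge0 => x _; rewrite lee_fin. Qed.

Lemma le_integral_EFin f g : (forall x, 0 <= f x)%R -> (forall x, f x <= g x)%R ->
  \int[mu]_x (f x)%:E <= \int[mu]_x (g x)%:E.
Proof. by move=> f0 fg; apply: le_integral_inner => x; rewrite lee_fin. Qed.

Lemma integral_lt_indic f (c : R) : measurable_fun setT f ->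
  \int[mu]_x ((f x < c)%R%:R)%:E = mu [set x | (f x < c)%R].
Proof.
move=> mf; have mA : measurable [set x | (f x < c)%R].
  rewrite -[X in measurable X]setTI.
  by apply: (measurable_fun_ltr mf (measurable_cst c)) => //=; exact: (@measurableT _ bool).
rewrite -(setIT [set x | _]) -integral_indic//.
by apply: eq_integral => x _; rewrite indicE; congr (_%:R%:E); rewrite mem_setE.
Qed.

Lemma EFin_mul_le (c y : R) (x : \bar R) : (0 <= c)%R -> x <= y%:E ->
  c%:E * x <= (c * y)%:E.
Proof. by move=> c0; rewrite EFinM; apply: lee_wpmul2l. Qed.

End real_integral.

Ltac pull_const := rewrite integral_EFinZ; [|by nneg|by mfun|by nneg].
Ltac split_sum := rewrite integral_EFinD; [|by mfun|by mfun|by nneg|by nneg].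

Section tonelli.
Context d (T : measurableType d) (R : realType).
Variable mu : {sigma_finite_measure set T -> \bar R}.
Local Open Scope ereal_scope.
Variable f : T * T -> R.
Hypotheses (mf : measurable_fun setT f) (f0 : forall z, (0 <= f z)%R).

Let mf' : measurable_fun setT (fun z => (f z)%:E).
Proof. exact/measurable_EFinP. Qed.

Lemma tonelli_integral : \int[mu \x mu]_z (f z)%:E = \int[mu]_x \int[mu]_y (f (x, y))%:E.
Proof. by rewrite fubini_tonelli1// => z; rewrite lee_fin. Qed.

Lemma tonelli_swap :
  \int[mu]_x \int[mu]_y (f (y, x))%:E = \int[mu]_x \int[mu]_y (f (x, y))%:E.
Proof.
by rewrite -tonelli_integral fubini_tonelli2// => z; rewrite lee_fin.
Qed.

Lemma measurable_inner_integral :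
  measurable_fun setT (fun x => \int[mu]_y (f (x, y))%:E).
Proof.
by apply: (@measurable_fun_fubini_tonelli_F _ _ _ _ _ mu (fun z => (f z)%:E)) => // z; rewrite lee_fin.
Qed.

End tonelli.

Section symmetric_kernel.
Context d (T : measurableType d) (R : realType).
Variable mu : {sigma_finite_measure set T -> \bar R}.
Local Open Scope ereal_scope.

(** Pointwise estimates produce the loss in both orders of the variables. Symmetry of [J] and
    Tonelli identify the two integrals, so the loss needs to be estimated in one order only, at the
    price of the factor 2. *)
Lemma le_iterated_of_zero (J F P g : T * T -> R) :
  measurable_fun setT J -> measurable_fun setT F -> measurable_fun setT P ->
  measurable_fun setT g -> (forall z, 0 <= J z)%R -> (forall x y, J (x, y) = J (y, x)) ->
  (forall z, 0 <= P z)%R -> (forall z, 0 <= g z)%R ->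
  (forall x y, P (x, y) <= F (x, y) + (g (x, y) + g (y, x)))%R ->
  \int[mu \x mu]_z (F z * J z)%:E = 0 ->
  \int[mu]_x \int[mu]_y (P (x, y) * J (x, y))%:E <=
  2%:E * \int[mu]_x \int[mu]_y (g (x, y) * J (x, y))%:E.
Proof.
move=> mJ mF mP mg J0 Jsym P0 g0 PFg F0.
have mgs : measurable_fun setT (fun z => g (z.2, z.1)) by mfun.
have PJ0 z : (0 <= P z * J z)%R by rewrite mulr_ge0.
have gJ0 z : (0 <= g z * J z)%R by rewrite mulr_ge0.
have gsJ0 z : (0 <= g (z.2, z.1) * J z)%R by rewrite mulr_ge0.
rewrite -(@tonelli_integral _ _ _ mu (fun z => P z * J z)%R)//; last by mfun.
apply: (@le_trans _ _ (\int[mu \x mu]_z ((g z + g (z.2, z.1)) * J z)%:E)).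
  apply: (@le_integral_of_zero _ _ _ _ (fun z => F z * J z)%R) => //.
  - by mfun.
  - by mfun.
  - by mfun.
  - by move=> z; rewrite mulr_ge0// addr_ge0.
  - by case=> x y; rewrite -mulrDl ler_wpM2r.
under eq_integral do rewrite mulrDl.
rewrite integral_EFinD//; [|by mfun|by mfun].
rewrite (@tonelli_integral _ _ _ mu (fun z => g z * J z)%R)//; last by mfun.
rewrite (@tonelli_integral _ _ _ mu (fun z => g (z.2, z.1) * J z)%R)//; last by mfun.
rewrite -(@tonelli_swap _ _ _ mu (fun z => g (z.2, z.1) * J z)%R)//; last by mfun.
rewrite /=; under [X in _ + X <= _]eq_integral do under eq_integral do rewrite Jsym.
by rewrite -[2%R]/(1 + 1)%R EFinD ge0_muleDl ?mul1e.
Qed.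

End symmetric_kernel.

(** * Integrands of the energy estimates *)

Section cutoff.
Context {R : realType}.
Implicit Types (S h s : R).

Definition cutoff S h s : R := maxr 0 (minr 1 ((S + h - s) / h)).

Lemma cutoff01 S h s : 0 <= cutoff S h s <= 1.
Proof. by rewrite /cutoff le_max lexx /= ge_max ler01 ge_min lexx. Qed.

Lemma cutoffX01 S h s k : 0 <= cutoff S h s ^+ k <= 1.
Proof. by have /andP[c0 c1] := cutoff01 S h s; rewrite exprn_ge0//= exprn_ile1. Qed.

Lemma cutoff_eq1 S h s : 0 < h -> s <= S -> cutoff S h s = 1.
Proof.
move=> h0 sS; have : 1 <= (S + h - s) / h by rewrite ler_pdivlMr//; lra.
by move=> H; rewrite /cutoff (min_idPl H); apply/max_idPr.
Qed.

Lemma cutoff_eq0 S h s : 0 < h -> S + h <= s -> cutoff S h s = 0.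
Proof.
move=> h0 sS; rewrite /cutoff; apply/max_idPl; rewrite ge_min; apply/orP; right.
by rewrite pmulr_lle0 ?invr_gt0//; lra.
Qed.

(** The distance is truncated at 1 because its p-th power will be integrated against the kernel over
    the whole space, as in [ns_upper]. *)
Lemma cutoff_lipschitz S h s s' : 0 < h -> h <= 1 ->
  `|cutoff S h s - cutoff S h s'| <= minr 1 `|s - s'| / h.
Proof.
move=> h0 h1.
wlog ss : s s' / s <= s'.
  move=> H; have /orP[ss|ss] := le_total s s'; first exact: H.
  by rewrite distrC [`|s - s'|]distrC; exact: H.
have /andP[c0 c1] := cutoff01 S h s; have /andP[c0' c1'] := cutoff01 S h s'.
rewrite ler_pdivlMr// le_min; apply/andP; split.
  apply: (@le_trans _ _ (1 * 1)); last by rewrite mulr1.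
  by apply: ler_pM => //; [exact: ltW|rewrite ler_norml; lra].
rewrite -ler_pdivlMr// [`|s - s'|]distrC (ger0_norm (_ : 0 <= s' - s)) ?subr_ge0//.
have e : (S + h - s') / h = (S + h - s) / h - (s' - s) / h.
  by rewrite -mulrBl; congr (_ / _); ring.
have e0 : 0 <= (s' - s) / h by rewrite divr_ge0 ?subr_ge0// ltW.
rewrite /cutoff e; move: e0; set q := (s' - s) / h; set z := (S + h - s) / h => q0.
rewrite ler_norml; have [z1|z1] := leP 1 z; have [z2|z2] := leP 1 (z - q);
  rewrite ?(max_idPr (@ler01 R)); try (have [z3|z3] := leP 0 z);
  try (have [z4|z4] := leP 0 (z - q)); lra.
Qed.

End cutoff.

(** Makes v^(1-p) admissible as a Lipschitz function of u. With t = x / y the claim reduces to 1 -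
    t^q <= 1 - t^(m+1) <= (m + 1) (1 - t). *)
Lemma inv_powR_lipschitz {R : realType} (q d x y : R) (m : nat) :
  0 < q -> q <= m.+1%:R -> 0 < d -> d <= x -> d <= y ->
  `|(x `^ q)^-1 - (y `^ q)^-1| <= m.+1%:R * (d `^ q)^-1 * d^-1 * `|x - y|.
Proof.
move=> q0 qm d0.
wlog xy : x y / x <= y.
  move=> H dx dy; have /orP[xy|xy] := le_total x y; first exact: H.
  by rewrite distrC [`|x - y|]distrC; exact: H.
move=> dx dy; have x0 : 0 < x by exact: lt_le_trans dx.
have y0 : 0 < y by exact: lt_le_trans dy.
have dq : 0 < d `^ q by rewrite powR_gt0.
have xq : 0 < x `^ q by rewrite powR_gt0.
have yq : 0 < y `^ q by rewrite powR_gt0.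
have dxq : d `^ q <= x `^ q by rewrite ge0_ler_powR// ?nnegrE// ltW.
have xyq : x `^ q <= y `^ q by rewrite ge0_ler_powR// ?nnegrE// ltW.
rewrite ger0_norm; last by rewrite subr_ge0 lef_pV2.
rewrite distrC (ger0_norm (_ : 0 <= y - x)) ?subr_ge0//.
pose t := x / y.
have t01 : 0 <= t <= 1.
  by rewrite /t divr_ge0 ?(ltW x0) ?(ltW y0)//= ler_pdivrMr// mul1r.
have tq : 1 - t `^ q <= m.+1%:R * (1 - t).
  have h1 := expr_le_powR t01 (ltW q0) qm isT.
  case/andP: t01 => t0 t1; have := exprB_le m t0 t1.
  by rewrite !expr1n mulr1; lra.
have -> : (x `^ q)^-1 - (y `^ q)^-1 = (x `^ q)^-1 * (1 - t `^ q).
  rewrite /t powRM ?invr_ge0 ?(ltW x0) ?(ltW y0)// powRV ?(ltW y0)//; field.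
  by rewrite !gt_eqF.
have -> : m.+1%:R * (d `^ q)^-1 * d^-1 * (y - x) =
   (d `^ q)^-1 * (m.+1%:R * ((y - x) / d)) by ring.
apply: ler_pM; rewrite ?invr_ge0 ?(ltW xq)//.
- rewrite subr_ge0 powR_le1// ltW//.
- by rewrite lef_pV2.
- apply: le_trans tq _; rewrite ler_wpM2l//.
  have -> : 1 - t = (y - x) / y by rewrite /t; field; rewrite gt_eqF.
  by rewrite ler_wpM2l ?subr_ge0// lef_pV2.
Qed.

(** * The logarithmic test function, at a pair of points *)

Section log_pointwise.
Context {R : realType} (T : Type) (p dd : R) (m : nat) (u N : T -> R).
Hypotheses (p1 : 1 < p) (pm : p <= m.+1%:R) (dd0 : 0 < dd).
Hypothesis u0 : forall x, N x < 10 -> 0 <= u x.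

(** This is v^(1-p) where u >= 0. Far away u may be negative; the cutoff vanishes there, and the
    maximum only serves to keep the function Lipschitz on the whole line. *)
Definition log_test (t : R) : R := ((maxr 0 t + dd) `^ (p - 1))^-1.
Definition log_form (x y : T) : R := Jp p (u x - u y) *
  (cutoff 7 1 (N x) ^+ m.+1 * log_test (u x) -
   cutoff 7 1 (N y) ^+ m.+1 * log_test (u y)).
(** Subtracting 2^(p-1) makes the gain vanish unless v y exceeds 2 v x, the range of
    [quotient_ineq]. As [y] is not confined to a ball, the gain controls both the mean and the
    tail. *)
Definition log_gain (x y : T) : R := (N x < 7)%R%:R *
  maxr 0 ((maxr 0 (u y + dd) / (u x + dd)) `^ (p - 1) - 2 `^ (p - 1)).
Definition log_const : R :=
  harnack_const p * (cutoff_const p m.+1 (p - 1) + 2 `^ (p - 1)).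
(** The first term pays for the variation of the cutoff, which vanishes from 8 on; the second pays
    for negative values of u beyond 10, measured relative to [dd] because v >= dd near the
    centre. *)
Definition log_loss (x y : T) : R := (N x < 8)%R%:R *
  (log_const * (minr 1 `|N x - N y| `^ p +
     (10 <= N y)%R%:R * (maxr 0 (- u y) / dd) `^ (p - 1))).

Local Notation eta x := (cutoff 7 1 (N x)).
Local Notation v x := (u x + dd).
Local Notation H := (harnack_const p).

Let H0 : 0 < H. Proof. exact: harnack_const_gt0. Qed.
Let p10 : 0 < p - 1. Proof. by rewrite subr_gt0. Qed.
Let p0 : 0 <= p. Proof. exact: ltW (lt_trans ltr01 p1). Qed.

Lemma log_const_gt0 : 0 < log_const.
Proof.
by rewrite mulr_gt0// addr_gt0 ?powR_gt0// cutoff_const_gt0.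
Qed.

Lemma log_loss_ge0 x y : 0 <= log_loss x y.
Proof.
rewrite mulr_ge0// mulr_ge0// ?(ltW log_const_gt0)// addr_ge0 ?powR_ge0//.
by rewrite mulr_ge0// powR_ge0.
Qed.

Lemma log_gain_ge0 x y : 0 <= log_gain x y.
Proof. by rewrite mulr_ge0// le_max lexx. Qed.

Lemma log_formC x y : log_form x y = log_form y x.
Proof. by rewrite /log_form -[u x - u y]opprB JpN; ring. Qed.

Let eta0 x : 8 <= N x -> eta x = 0.
Proof. by move=> h; rewrite cutoff_eq0//; lra. Qed.

Let eta1 x : N x < 7 -> eta x = 1.
Proof. by move=> h; rewrite cutoff_eq1//; lra. Qed.

Let v0 x : N x < 10 -> 0 < v x.
Proof. by move=> /u0 h; rewrite ltr_wpDl. Qed.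

Let log_testE x : N x < 10 -> log_test (u x) = (v x `^ (p - 1))^-1.
Proof. by move=> /u0 h; rewrite /log_test (max_idPr h). Qed.

Let formE x y : u x <= u y ->
  - log_form x y = (u y - u x) `^ (p - 1) *
    (eta x ^+ m.+1 * log_test (u x) - eta y ^+ m.+1 * log_test (u y)).
Proof.
move=> xy; rewrite /log_form -[u x - u y]opprB JpN Jp_powR ?subr_ge0//; ring.
Qed.

Let gain0 x y : N x < 10 -> v y < 2 * v x -> log_gain x y = 0.
Proof.
move=> Nx vyx; rewrite /log_gain; have vx0 := v0 Nx.
rewrite (max_idPl _) ?mulr0// subr_le0 ge0_ler_powR ?nnegrE ?(ltW p10)//.
  by rewrite divr_ge0 ?le_max ?lexx// ltW.
by rewrite ler_pdivrMr// ge_max (ltW vyx) andbT mulr_ge0// ltW.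
Qed.

Let loss_lb x y : N x < 10 -> N y < 10 -> N x < 8 \/ N y < 8 ->
  log_const * minr 1 `|N x - N y| `^ p <= log_loss x y + log_loss y x.
Proof.
move=> Nx Ny; have c0 := log_const_gt0.
have E a b : N a < 8 -> N b < 10 ->
    log_loss a b = log_const * minr 1 `|N a - N b| `^ p.
  move=> Na Nb; rewrite /log_loss Na mul1r leNgt Nb /= mul0r addr0 //.
case=> h; first by rewrite E// lerDl log_loss_ge0.
by rewrite [log_loss y x]E// distrC lerDr log_loss_ge0.
Qed.

Let inner_ge0 x y : N x < 10 -> N y < 10 ->
  0 <= H * - log_form x y + (log_loss x y + log_loss y x).
Proof.
wlog uxy : x y / u x <= u y.
  move=> W Nx Ny; have /orP[uxy|uxy] := le_total (u x) (u y); first exact: W.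
  by rewrite log_formC [log_loss x y + _]addrC; exact: W.
move=> Nx Ny.
have [Nxy|] := pselect (N x < 8 \/ N y < 8); last first.
  move=> /not_orP[/negP]; rewrite -leNgt => Nx8 /negP; rewrite -leNgt => Ny8.
  rewrite /log_form (eta0 Nx8) (eta0 Ny8) expr0n /= !mul0r subrr mulr0 oppr0 mulr0.
  by rewrite add0r addr_ge0 ?log_loss_ge0.
rewrite formE// !log_testE//.
have := @log_ineq _ p m (v y) (v x) (eta x) (eta y) p1 pm (v0 Nx).
rewrite lerD2r => /(_ uxy (cutoff01 _ _ _) (cutoff01 _ _ _)).
have -> : v y - v x = u y - u x by ring.
have := loss_lb Nx Ny Nxy; rewrite /log_const.
have : `|eta x - eta y| `^ p <= minr 1 `|N x - N y| `^ p.
  have le : `|eta x - eta y| <= minr 1 `|N x - N y|.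
    by have := @cutoff_lipschitz _ 7 1 (N x) (N y) ltr01 (lexx _); rewrite divr1.
  by apply: ge0_ler_powR => //; rewrite nnegrE//; apply: le_trans le.
have cC := @cutoff_const_gt0 _ p m.+1 _ p10.
have tp : 0 <= 2 `^ (p - 1) :> R by exact: powR_ge0.
have mp : 0 <= minr 1 `|N x - N y| `^ p by exact: powR_ge0.
move: cC tp mp.
set E := `|eta x - eta y| `^ p; set M := minr _ _ `^ p.
set G := cutoff_const _ _ _; set W := 2 `^ _; set L := log_loss x y + _.
set Z := (u y - u x) `^ _ * (_ - _) => G0 W0 M0 EM LM.
have -> : (u y - u x) `^ (p - 1) * (eta x ^+ m.+1 * (v x `^ (p - 1))^-1 - eta y ^+ m.+1 * (v y `^ (p - 1))^-1) = - Z.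
  by rewrite /Z; ring.
move=> ZE.
have h1 : H * Z <= H * (G * M).
  by rewrite ler_wpM2l ?(ltW H0)//; apply: le_trans ZE _; rewrite ler_wpM2l// ltW.
have h2 : 0 <= H * W * M by rewrite mulr_ge0// mulr_ge0// (ltW H0).
have e : H * (G + W) * M = H * (G * M) + H * W * M by ring.
by rewrite mulrN; move: LM; rewrite e; lra.
Qed.

Let outer_loss x y : N x < 8 -> 10 <= N y -> log_loss x y =
  log_const * (1 + (maxr 0 (- u y) / dd) `^ (p - 1)).
Proof.
move=> Nx Ny; rewrite /log_loss Nx Ny !mul1r (min_idPl _) ?powR1//.
by rewrite ler0_norm; lra.
Qed.

(** Only [x] is tested. If u x <= u y, the sign is favourable. Otherwise (u x - u y) / v x is at
    most 2 max(1, u_-(y) / dd), since u x <= v x and v x >= dd. *)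
Let outer_ge0 x y : N x < 10 -> 10 <= N y ->
  0 <= H * - log_form x y + log_loss x y.
Proof.
move=> Nx Ny; have ey : eta y = 0 by rewrite eta0//; lra.
have [Nx8|Nx8] := ltP (N x) 8; last first.
  rewrite /log_form (eta0 Nx8) ey expr0n /= !mul0r subrr mulr0 oppr0 mulr0.
  by rewrite add0r log_loss_ge0.
have vx := v0 Nx; have ux := u0 Nx.
have [uxy|uxy] := leP (u x) (u y).
  rewrite addr_ge0 ?log_loss_ge0// mulr_ge0 ?(ltW H0)// formE// ey expr0n /= mul0r.
  rewrite subr0 mulr_ge0 ?powR_ge0// mulr_ge0 ?exprn_ge0 ?invr_ge0 ?powR_ge0//.
  by case/andP: (cutoff01 7 1 (N x)).
rewrite outer_loss// log_formC formE ?(ltW uxy)// ey expr0n /= mul0r sub0r log_testE//.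
have /andP[e0 e1] := cutoff01 7 1 (N x).
have em : eta x ^+ m.+1 <= 1 by rewrite exprn_ile1.
set um := maxr 0 (- u y).
have um0 : 0 <= um by rewrite le_max lexx.
have umy : - u y <= um by rewrite le_max lexx orbT.
have key : (u x - u y) `^ (p - 1) * (eta x ^+ m.+1 * (v x `^ (p - 1))^-1) <=
    2 `^ (p - 1) * (1 + (um / dd) `^ (p - 1)).
  apply: (@le_trans _ _ ((u x - u y) `^ (p - 1) * (1 * (v x `^ (p - 1))^-1))).
    by rewrite ler_wpM2l ?powR_ge0// ler_wpM2r// invr_ge0 powR_ge0.
  rewrite mul1r -powRV ?(ltW vx)// -powRM ?invr_ge0 ?(ltW vx)//; last by lra.
  apply: (@le_trans _ _ ((2 * maxr 1 (um / dd)) `^ (p - 1))).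
    rewrite ge0_ler_powR ?nnegrE ?(ltW p10)//.
    - by rewrite mulr_ge0 ?invr_ge0 ?(ltW vx)//; lra.
    - by rewrite mulr_ge0// le_max ler01.
    rewrite ler_pdivrMr//.
    have h1 : v x <= maxr 1 (um / dd) * v x.
      by rewrite -{1}[v x]mul1r ler_wpM2r ?(ltW vx)// le_max lexx.
    have h2 : um <= maxr 1 (um / dd) * v x.
      apply: (@le_trans _ _ (um / dd * dd)); first by rewrite divfK// gt_eqF.
      apply: ler_pM; rewrite ?(ltW dd0)//; first by rewrite divr_ge0// ltW.
        by rewrite le_max lexx orbT.
      by rewrite lerDr.
    have : u x <= v x by rewrite lerDl ltW.
    by rewrite -mulrA; lra.
  rewrite powRM ?le_max ?ler01// ler_wpM2l ?powR_ge0//.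
  have [h|h] := leP (um / dd) 1; first by rewrite powR1 lerDl powR_ge0.
  by rewrite lerDr.
have := ler_wpM2l (ltW H0) key.
have : 0 <= H * (cutoff_const p m.+1 (p - 1) * (1 + (um / dd) `^ (p - 1))).
  rewrite mulr_ge0 ?(ltW H0)// mulr_ge0//; first by rewrite ltW// cutoff_const_gt0.
  by rewrite addr_ge0// powR_ge0.
set X := 1 + _; have -> : log_const * X =
    H * (cutoff_const p m.+1 (p - 1) * X) + H * (2 `^ (p - 1) * X).
  by rewrite /log_const; ring.
by rewrite mulrN !mulrN; lra.
Qed.

(** The form is nonnegative up to the losses for every pair, so the gain has to be recovered only
    where it is nonzero. There v y >= 2 v x and the form dominates the full quotient by
    [quotient_ineq], with cutoff 0 at [y] when [y] lies beyond 10. *)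
Lemma log_pointwise x y :
  log_gain x y <= H * - log_form x y + (log_loss x y + log_loss y x).
Proof.
have L0 : 0 <= log_loss x y + log_loss y x by rewrite addr_ge0 ?log_loss_ge0.
have base : 0 <= H * - log_form x y + (log_loss x y + log_loss y x).
  have [Nx|Nx] := ltP (N x) 10; have [Ny|Ny] := ltP (N y) 10.
  - exact: inner_ge0.
  - by have := outer_ge0 Nx Ny; have := log_loss_ge0 y x; lra.
  - by rewrite log_formC; have := outer_ge0 Ny Nx; have := log_loss_ge0 x y; lra.
  - rewrite /log_form !eta0; [|lra|lra].
    by rewrite expr0n /= !mul0r subrr mulr0 oppr0 mulr0 add0r.
have [Nx|Nx] := ltP (N x) 7; last first.
  by rewrite /log_gain ltNge Nx mul0r.
have Nx10 : N x < 10 by lra.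
have [vyx|vyx] := ltP (v y) (2 * v x); first by rewrite gain0.
have vx := v0 Nx10; have vy : 0 < v y by lra.
have uxy : u x <= u y by lra.
apply: (@le_trans _ _ (H * - log_form x y)); last by rewrite lerDl.
apply: (@le_trans _ _ ((v y / v x) `^ (p - 1))).
  rewrite /log_gain Nx mul1r (max_idPr (ltW vy)) ge_max powR_ge0 /=.
  by rewrite gerBl powR_ge0.
rewrite formE// (eta1 Nx) expr1n mul1r (log_testE Nx10).
have -> : u y - u x = v y - v x by ring.
have [Ny|Ny] := ltP (N y) 10.
  rewrite log_testE// mulrBr; apply: quotient_ineq => //; exact: cutoff01.
rewrite (@eta0 y); last by lra.
rewrite expr0n /= mul0r subr0.
have := @quotient_ineq _ p m.+1 (v y) (v x) 0 p1 vx vyx.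
by rewrite lexx ler01 expr0n /= mul0r mulr0 subr0 => /(_ isT).
Qed.

End log_pointwise.

(** * Truncations as test functions, at a pair of points *)

Section truncation_pointwise.
Context {R : realType} (T : Type) (p S h k : R) (m : nat) (f N : T -> R).
Hypotheses (p1 : 1 < p) (pm : p <= m.+1%:R) (h0 : 0 < h) (h1 : h <= 1).

Local Notation eta x := (cutoff S h (N x)).
Local Notation w x := (maxr 0 (f x - k)).

Definition trunc_form (x y : T) : R :=
  Jp p (f x - f y) * (eta x ^+ m.+1 * w x - eta y ^+ m.+1 * w y).
Definition trunc_gain (x y : T) : R :=
  (N x < S)%R%:R * ((f y <= k)%R%:R * w x `^ p).
(** The cutoff vanishes from S + h on, while the far term starts at S + 2 h: the gap h separates the
    two points of a far pair, so that term never meets the singularity. *)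
Definition trunc_loss (x y : T) : R :=
  (N x < S + 2 * h)%R%:R *
    (cutoff_const p m.+1 1 / h `^ p * w x `^ p * minr 1 `|N x - N y| `^ p) +
  (N x < S + h)%R%:R * (w x * ((S + 2 * h <= N y)%R%:R * w y `^ (p - 1))).

Let C0 : 0 < cutoff_const p m.+1 1. Proof. exact: cutoff_const_gt0. Qed.
Let p0 : 0 <= p. Proof. exact: ltW (lt_trans ltr01 p1). Qed.
Let w0 x : 0 <= w x. Proof. by rewrite le_max lexx. Qed.

Lemma trunc_gain_ge0 x y : 0 <= trunc_gain x y.
Proof. by rewrite mulr_ge0// mulr_ge0// powR_ge0. Qed.

Let near_ge0 x y :
  0 <= cutoff_const p m.+1 1 / h `^ p * w x `^ p * minr 1 `|N x - N y| `^ p.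
Proof. by rewrite !mulr_ge0 ?powR_ge0 ?invr_ge0 ?powR_ge0 ?(ltW C0). Qed.

Lemma trunc_loss_ge0 x y : 0 <= trunc_loss x y.
Proof. by rewrite addr_ge0 ?(mulr_ge0 _ (near_ge0 _ _))// !mulr_ge0// powR_ge0. Qed.

Lemma trunc_formC x y : trunc_form x y = trunc_form y x.
Proof. by rewrite /trunc_form -[f x - f y]opprB JpN; ring. Qed.

Let w_pos x : k < f x -> w x = f x - k.
Proof. by move=> kf; apply/max_idPr; rewrite subr_ge0 ltW. Qed.

Let w_zero x : f x <= k -> w x = 0.
Proof. by move=> fk; apply/max_idPl; rewrite subr_le0. Qed.

Let gain_le x y : f y <= k -> trunc_gain x y <= trunc_form x y.
Proof.
move=> fyk; rewrite /trunc_form /trunc_gain fyk (w_zero fyk) mulr0 subr0 mul1r.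
have [fxk|kfx] := leP (f x) k.
  by rewrite (w_zero fxk) powR0 ?gt_eqF ?(lt_trans ltr01 p1)// !mulr0.
have /andP[e0 e1] := cutoff01 S h (N x).
have wx := w_pos kfx.
have wfx : w x <= f x - f y by rewrite wx lerB.
have fxy : 0 <= f x - f y by rewrite (le_trans (w0 x)).
have p10 : 0 <= p - 1 by rewrite subr_ge0 ltW.
rewrite Jp_powR//.
apply: (@le_trans _ _ (w x `^ (p - 1) * (eta x ^+ m.+1 * w x))).
  rewrite mulrCA -powRS//; last by rewrite gt_eqF// (lt_trans ltr01 p1).
  apply: ler_wpM2r; first exact: powR_ge0.
  have [NS|NS] := ltP (N x) S; last by rewrite exprn_ge0.
  by rewrite cutoff_eq1 ?expr1n// ltW.
by rewrite ler_wpM2r ?mulr_ge0 ?exprn_ge0//; apply: ge0_ler_powR; rewrite ?nnegrE.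
Qed.

Let form_ge0 x y : f y <= k -> 0 <= trunc_form x y.
Proof. by move=> fy; apply: le_trans (gain_le x fy); exact: trunc_gain_ge0. Qed.

Let gain0 x y : k < f y -> trunc_gain x y = 0.
Proof. by move=> kf; rewrite /trunc_gain leNgt kf mul0r mulr0. Qed.

(** The form has the wrong sign only if f y > f x, and then f y - f x is at most the truncation at
    [y] because f x > k. *)
Let far x y : k < f x -> k < f y -> N x < S + h -> S + 2 * h <= N y ->
  0 <= trunc_form x y + trunc_loss x y.
Proof.
move=> kfx kfy Nx Ny.
have ey : eta y = 0 by rewrite cutoff_eq0//; move: h0; lra.
have /andP[e0 e1] := cutoff01 S h (N x).
rewrite /trunc_form ey expr0n /= mul0r subr0.
apply: (@le_trans _ _ (Jp p (f x - f y) * (eta x ^+ m.+1 * w x) + w x * w y `^ (p - 1)));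
  last first.
  rewrite lerD2l /trunc_loss Nx Ny !mul1r lerDr.
  by rewrite mulr_ge0// near_ge0.
have [fyx|fxy] := leP (f y) (f x).
  apply: addr_ge0; last by rewrite mulr_ge0 ?powR_ge0.
  apply: mulr_ge0; first by apply: Jp_ge0; rewrite subr_ge0.
  by apply: mulr_ge0 => //; exact: exprn_ge0.
rewrite -[f x - f y]opprB JpN mulNr addrC subr_ge0 Jp_powR//; last by rewrite subr_ge0 ltW.
rewrite [leLHS]mulrC; apply: ler_pM; rewrite ?mulr_ge0 ?exprn_ge0 ?powR_ge0//.
  by rewrite ler_piMl// exprn_ile1.
apply: ler_wpowR; rewrite ?subr_ge0 ?(ltW p1) ?(ltW fxy)//.
by rewrite w_pos// lerD2l lerN2 ltW.
Qed.

(** If one of the two values is at most k, the form has the right sign and yields the cross term. If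
    both exceed k, the gain is zero and only nonnegativity up to losses remains: [caccioppoli_ineq]
    for near pairs, [far] for the others. *)
Lemma trunc_pointwise x y :
  trunc_gain x y <= trunc_form x y + (trunc_loss x y + trunc_loss y x).
Proof.
have L0 : 0 <= trunc_loss x y + trunc_loss y x by rewrite addr_ge0 ?trunc_loss_ge0.
have [fyk|kfy] := leP (f y) k.
  by apply: le_trans (gain_le _ fyk) _; rewrite lerDl.
rewrite gain0//; have [fxk|kfx] := leP (f x) k.
  by rewrite addr_ge0// trunc_formC form_ge0.
have [Nxy|] := pselect (N x < S + h \/ N y < S + h); last first.
  move=> /not_orP[/negP]; rewrite -leNgt => Nx /negP; rewrite -leNgt => Ny.
  by rewrite addr_ge0// /trunc_form !cutoff_eq0// expr0n /= !mul0r subrr mulr0.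
have [Nx2|Nx2] := ltP (N x) (S + 2 * h); last first.
  have Ny : N y < S + h by case: Nxy => //; move: h0; lra.
  have := far kfy kfx Ny Nx2; rewrite trunc_formC.
  by have := trunc_loss_ge0 x y; lra.
have [Ny2|Ny2] := ltP (N y) (S + 2 * h); last first.
  have Nx : N x < S + h by case: Nxy => //; move: h0; lra.
  have := far kfx kfy Nx Ny2.
  by have := trunc_loss_ge0 y x; lra.
have := @caccioppoli_ineq _ p m (w x) (w y) (eta x) (eta y) p1 pm (w0 x) (w0 y)
  (cutoff01 _ _ _) (cutoff01 _ _ _).
have -> : w x - w y = f x - f y by rewrite !w_pos//; ring.
rewrite -/(trunc_form x y).
set D := `|eta x - eta y| `^ p.
have DM : D <= minr 1 `|N x - N y| `^ p / h `^ p.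
  rewrite -powRV ?(ltW h0)// -powRM//; last by rewrite invr_ge0 ltW.
  by apply: ge0_ler_powR => //; rewrite ?nnegrE ?cutoff_lipschitz// mulr_ge0// invr_ge0 ltW.
set M := minr _ _ `^ p in DM.
have wm : maxr (w x) (w y) `^ p <= w x `^ p + w y `^ p.
  have /orP[xy|xy] := le_total (w x) (w y).
    by rewrite (max_idPr xy) lerDr powR_ge0.
  by rewrite (max_idPl xy) lerDl powR_ge0.
have lossE : cutoff_const p m.+1 1 * (w x `^ p + w y `^ p) * (M / h `^ p) <=
    trunc_loss x y + trunc_loss y x.
  rewrite /trunc_loss Nx2 Ny2 !mul1r [`|N y - N x|]distrC -/M.
  have e : cutoff_const p m.+1 1 * (w x `^ p + w y `^ p) * (M / h `^ p) =
    cutoff_const p m.+1 1 / h `^ p * w x `^ p * M + cutoff_const p m.+1 1 / h `^ p * w y `^ p * M.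
    by ring.
  have n1 : 0 <= (N x < S + h)%R%:R * (w x * ((S + 2 * h <= N y)%R%:R * w y `^ (p - 1))).
    by rewrite !mulr_ge0// powR_ge0.
  have n2 : 0 <= (N y < S + h)%R%:R * (w y * ((S + 2 * h <= N x)%R%:R * w x `^ (p - 1))).
    by rewrite !mulr_ge0// powR_ge0.
  by rewrite e; lra.
suff : cutoff_const p m.+1 1 * maxr (w x) (w y) `^ p * D <=
  cutoff_const p m.+1 1 * (w x `^ p + w y `^ p) * (M / h `^ p) by lra.
apply: ler_pM; rewrite ?mulr_ge0 ?powR_ge0 ?(ltW C0)//.
by rewrite ler_wpM2l ?(ltW C0).
Qed.

End truncation_pointwise.

(** * De Giorgi iteration *)

Section nonlocal_space.
Context {R : realType}.
Variables (p Lam kap : R) (Q nn : nat).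

(* [N] is the distance to the centre in units of the radius [r], [V] is [r ^ n]
   and [J] the kernel divided by [G_{B_r}(1)]. The last field replaces the
   fractional Sobolev inequality. *)
Record nonlocal_space d (T : measurableType d)
    (mu : {sigma_finite_measure set T -> \bar R}) (V : R) (N : T -> R)
    (J : T * T -> R) : Prop := NonlocalSpace {
  ns_V : 0 < V;
  ns_mN : measurable_fun setT N;
  ns_mJ : measurable_fun setT J;
  ns_J0 : forall z, 0 <= J z;
  ns_sym : forall x y, J (x, y) = J (y, x);
  ns_ball1 : ((V / Lam)%:E <= mu [set x | (N x < 1)%R])%E;
  ns_ball10 : (mu [set x | (N x < 10)%R] <= (Lam * V)%:E)%E;
  ns_lower : forall x y, N x < 10 -> N y < 10 -> (Lam * V)^-1 <= J (x, y);
  ns_upper : forall x, N x < 10 ->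
    (\int[mu]_y (minr 1 `|N x - N y| `^ p * J (x, y))%:E <= Lam%:E)%E;
  ns_comparable : forall x x' y h, N x < 7 -> N x' < 7 -> 0 < h -> h <= 1 ->
    N x + h <= N y -> J (x, y) <= Lam / h ^+ Q * J (x', y);
  ns_small_set : forall (f : T -> R) k x S h a, measurable_fun setT f ->
    N x < S -> 0 < h -> h <= 1 -> S + h <= 10 -> 0 < a -> a <= h ^+ nn / Lam ->
    (\int[mu]_y ((N y < S + h)%R%:R * (k < f y)%R%:R)%:E <= (a * V)%:E)%E ->
    ((a `^ kap * Lam)^-1%:E <=
      \int[mu]_y ((N y < S + h)%R%:R * (f y <= k)%R%:R * J (x, y))%:E)%E
}.

End nonlocal_space.

Section de_giorgi.
Context {R : realType}.
Variables (p Lam kap : R) (Q nn m : nat).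
Hypotheses (p1 : 1 < p) (pm : p <= m.+1%:R) (Lam0 : 0 < Lam) (kap0 : 0 < kap).

Let p0 : 0 <= p. Proof. exact: ltW (lt_trans ltr01 p1). Qed.
Let pn0 : p != 0. Proof. by rewrite gt_eqF// (lt_trans ltr01 p1). Qed.
Let p10 : 0 < p - 1. Proof. by rewrite subr_gt0. Qed.

Section step.
Context d (T : measurableType d) (mu : {sigma_finite_measure set T -> \bar R})
  (V : R) (N : T -> R) (J : T * T -> R) (f : T -> R).
Hypotheses (sp : nonlocal_space p Lam kap Q nn mu V N J) (mf : measurable_fun setT f).

Local Notation w k x := (maxr 0 (f x - k)).
Local Notation energy S k := (\int[mu]_x ((N x < S)%R%:R * w k x `^ p)%:E)%E.

Definition weak_trunc : Prop := forall S h k, 1 <= S -> 0 < h -> h <= 1 -> S + h <= 9 ->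
  (\int[mu \x mu]_z (trunc_form p S h k m f N z.1 z.2 * J z)%:E = 0)%E.

Let w0 k x : 0 <= w k x. Proof. by rewrite le_max lexx. Qed.

(** The cross term alone controls the energy: points above the level see enough kernel mass of the
    set below it. The factor a^kap, small with the superlevel set, plays the part of the Sobolev
    gain in the classical iteration. *)
Lemma caccioppoli (S h k a th y y1 : R) : weak_trunc ->
  1 <= S -> 0 < h -> S + 2 * h <= 7 -> h <= 2^-1 -> 0 < a -> a <= (2 * h) ^+ nn / Lam ->
  (\int[mu]_x ((N x < S + 2 * h)%R%:R * (k < f x)%R%:R)%:E <= (a * V)%:E)%E ->
  0 <= th -> (forall x, N x < S + h ->
    (\int[mu]_y ((S + 2 * h <= N y)%R%:R * w k y `^ (p - 1) * J (x, y))%:E <= th%:E)%E) ->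
  (energy (S + 2 * h)%R k <= y%:E)%E ->
  (\int[mu]_x ((N x < S + 2 * h)%R%:R * w k x)%:E <= y1%:E)%E ->
  (energy S k <= (a `^ kap * Lam *
     (2 * (cutoff_const p m.+1 1 / h `^ p * Lam * y + th * y1)))%:E)%E.
Proof.
move=> wk S1 h0 Sh h12 a0 ah hmu th0 tail hy hy1.
have mN := ns_mN sp; have mJ := ns_mJ sp; have J0 := ns_J0 sp.
have h1 : h <= 1 by move: h12; lra.
have C0 : 0 <= cutoff_const p m.+1 1 / h `^ p.
  by rewrite divr_ge0 ?powR_ge0// ltW// cutoff_const_gt0.
have ap0 : 0 < a `^ kap by rewrite powR_gt0.
have mw : measurable_fun setT (fun x => w k x) by mfun.
have mF : measurable_fun setT (fun z : T * T => trunc_form p S h k m f N z.1 z.2).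
  by rewrite /trunc_form /Jp /cutoff; mfun.
have mG : measurable_fun setT (fun z : T * T => trunc_gain p S k f N z.1 z.2).
  by rewrite /trunc_gain; mfun.
have mL : measurable_fun setT (fun z : T * T => trunc_loss p S h k m f N z.1 z.2).
  by rewrite /trunc_loss; mfun.
have Sh9 : S + h <= 9 by move: Sh h0; lra.
have main := @le_iterated_of_zero _ _ _ mu J _ _ _ mJ mF mG mL J0 (ns_sym sp).
have {main} := main (fun z => trunc_gain_ge0 p S k f N z.1 z.2)
  (fun z => trunc_loss_ge0 p S h k m f N z.1 z.2)
  (fun x y => trunc_pointwise S k f N p1 pm h0 h1 x y)
  (wk _ _ _ S1 h0 h1 Sh9).
move=> /= main.
have aL0 : 0 < a `^ kap * Lam by rewrite mulr_gt0.
(* [ns_small_set] is used with the enlarged gap 2 h, which is at most 1 because h <= 1/2. *)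
have gain_lb x : (((a `^ kap * Lam)^-1 * ((N x < S)%R%:R * w k x `^ p))%:E%E
   <= (\int[mu]_y (trunc_gain p S k f N x y * J (x, y))%:E)%E)%E.
  have [NS|NS] := ltP (N x) S; last first.
    rewrite !mul0r mulr0; apply: integral_EFin_ge0 => y'.
    by rewrite mulr_ge0// trunc_gain_ge0.
  have fk := ns_small_set sp mf NS.
  have {}fk := fk k (2 * h) a _ _ _ a0 ah hmu.
  have h2 : 0 < 2 * h by rewrite mulr_gt0.
  have h21 : 2 * h <= 1 by move: h12; lra.
  have S10 : S + 2 * h <= 10 by move: Sh; lra.
  have {}fk := fk h2 h21 S10.
  apply: (@le_trans _ _ (\int[mu]_y (w k x `^ p * ((N y < S + 2 * h)%R%:R * (f y <= k)%R%:R * J (x, y)))%:E)%E).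
    rewrite integral_EFinZ ?powR_ge0//; [|by mfun|by move=> y'; rewrite !mulr_ge0].
    rewrite mul1r mulrC EFinM; apply: lee_pmul; rewrite ?lee_fin ?powR_ge0//.
    by rewrite invr_ge0 ltW.
  apply: le_integral_EFin => y'; first by rewrite !mulr_ge0 ?powR_ge0.
  rewrite /trunc_gain NS mul1r mulrA ler_wpM2r//.
  rewrite [(f y' <= k)%R%:R * _]mulrC ler_wpM2l ?powR_ge0//.
  by rewrite ler_piMl// lern1 leq_b1.
have loss_ub x : (\int[mu]_y (trunc_loss p S h k m f N x y * J (x, y))%:E <=
   (cutoff_const p m.+1 1 / h `^ p * Lam * ((N x < S + 2 * h)%R%:R * w k x `^ p) +
    th * ((N x < S + 2 * h)%R%:R * w k x))%:E)%E.
  have [NS|NS] := ltrP (N x) (S + 2 * h); last first.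
    have NSh : (N x < S + h)%R = false by apply/negbTE; rewrite -leNgt; move: NS h0; lra.
    have NS2 : (N x < S + 2 * h)%R = false by rewrite ltNge NS.
    rewrite /= !mul0r !mulr0 addr0 integral0_eq// => y' _.
    by rewrite /trunc_loss NSh NS2 !mul0r addr0 mul0r.
  have NS10 : N x < 10 by move: NS Sh; lra.
  apply: (@le_trans _ _ (\int[mu]_y (
     cutoff_const p m.+1 1 / h `^ p * w k x `^ p * (minr 1 `|N x - N y| `^ p * J (x, y)) +
     (N x < S + h)%R%:R * w k x * ((S + 2 * h <= N y)%R%:R * w k y `^ (p - 1) * J (x, y)))%:E)%E).
    apply: le_integral_EFin => y'; first by rewrite mulr_ge0 ?trunc_loss_ge0.
    by rewrite /trunc_loss NS mul1r mulrDl !mulrA.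
  split_sum.
  pull_const.
  pull_const.
  rewrite EFinD mul1r; apply: leeD.
    by rewrite [X in (_ <= X%:E)%E]mulrAC; apply: EFin_mul_le; [nneg|exact: (ns_upper sp)].
  have [NS1|NS1] := ltP (N x) (S + h); last first.
    by rewrite !mul0r mul0e lee_fin !mulr_ge0.
  by rewrite !mul1r [th * _]mulrC; apply: EFin_mul_le; [nneg|exact: tail].
have mE S' : measurable_fun setT (fun x => (N x < S')%R%:R * w k x `^ p) by mfun.
have mE1 S' : measurable_fun setT (fun x => (N x < S')%R%:R * w k x) by mfun.
have E0 S' x : 0 <= (N x < S')%R%:R * w k x `^ p by rewrite mulr_ge0 ?powR_ge0.
have E10 S' x : 0 <= (N x < S')%R%:R * w k x by rewrite mulr_ge0.
rewrite EFinM -lee_pdivrMl// -integral_EFinZ ?invr_ge0 ?(ltW aL0)//.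
apply: (@le_trans _ _ (\int[mu]_x \int[mu]_y (trunc_gain p S k f N x y * J (x, y))%:E)%E).
  apply: le_integral_inner => x; first by rewrite lee_fin mulr_ge0// invr_ge0 ltW.
  exact: gain_lb.
apply: le_trans main _.
rewrite EFinM lee_pmul2l// ?lte_fin//.
apply: (@le_trans _ _ (\int[mu]_x (cutoff_const p m.+1 1 / h `^ p * Lam * ((N x < S + 2 * h)%R%:R * w k x `^ p) +
    th * ((N x < S + 2 * h)%R%:R * w k x))%:E)%E).
  apply: le_integral_inner => x; last exact: loss_ub.
  by apply: integral_EFin_ge0 => y'; rewrite mulr_ge0// trunc_loss_ge0.
have CL0 : 0 <= cutoff_const p m.+1 1 / h `^ p * Lam by rewrite mulr_ge0// ltW.
rewrite integral_EFinD; [|exact: measurable_funM|exact: measurable_funM| |]; first last.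
- by move=> x; rewrite mulr_ge0.
- by move=> x; rewrite mulr_ge0.
rewrite !integral_EFinZ// EFinD.
by apply: leeD; apply: EFin_mul_le; nneg.
Qed.

End step.
End de_giorgi.

Ltac posi := try assumption; lazymatch goal with
  | |- is_true (Order.lt _ (GRing.mul _ _)) => apply: mulr_gt0; posi
  | |- is_true (Order.lt _ (GRing.add _ (GRing.opp _))) => idtac
  | |- is_true (Order.lt _ (GRing.add _ _)) => apply: addr_gt0; posi
  | |- is_true (Order.lt _ (powR _ _)) => apply: powR_gt0; posi
  | |- is_true (Order.lt _ (GRing.inv _)) => rewrite invr_gt0; posi
  | |- is_true (Order.lt _ (GRing.exp _ _)) => apply: exprn_gt0; posi
  | _ => first [done | idtac]
  end.

Section de_giorgi_iteration.
Context {R : realType}.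
Variables (p Lam kap th : R) (Q nn m D : nat).
Hypotheses (p1 : 1 < p) (pm : p <= m.+1%:R) (Lam0 : 0 < Lam) (kap0 : 0 < kap).
Hypotheses (th0 : 0 < th) (Dnn : (nn <= D)%N) (DA : (m.+1 + Q)%:R <= D%:R * kap).

Let p0 : 0 < p. Proof. exact: lt_trans ltr01 p1. Qed.
Let p10 : 0 < p - 1. Proof. by rewrite subr_gt0. Qed.

Let C1 := 2 * (cutoff_const p m.+1 1 * Lam + th).
(** [B] is chosen so that one step multiplies the energy by at most (2^D 2^p)^-1, the factor by
    which the admissible energy shrinks when radius gap and height are halved. [e0] also meets the
    measure threshold of [ns_small_set]; the 2^p in [dg_const] pays for Chebyshev at half the
    height. *)
Let B := (2 ^+ D * 2 `^ p * (Lam * C1 * 4 ^+ (m.+1 + Q)))^-1.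
Let e0 := minr (B `^ kap^-1) (2 ^+ nn * Lam)^-1.
Definition dg_const : R := e0 / 2 `^ p.

Let C1gt0 : 0 < C1.
Proof. by rewrite mulr_gt0// addr_gt0// mulr_gt0// cutoff_const_gt0. Qed.

Let Bgt0 : 0 < B.
Proof. by rewrite /B; posi. Qed.

Let e0gt0 : 0 < e0.
Proof.
by rewrite /e0 lt_min (powR_gt0 _ Bgt0) /= invr_gt0 mulr_gt0// exprn_gt0.
Qed.

Lemma dg_const_gt0 : 0 < dg_const.
Proof. by rewrite divr_gt0// powR_gt0. Qed.

Let e0kap : e0 `^ kap <= B.
Proof.
have <- : (B `^ kap^-1) `^ kap = B.
  by rewrite -powRrM mulVf ?gt_eqF// powRr1// ltW.
apply: ler_wpowR; rewrite ?powR_ge0 ?(ltW kap0) ?(ltW e0gt0)//.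
by rewrite ge_min lexx.
Qed.

Let quarter_powR (z t : R) : 0 < z -> z <= 1 -> 0 <= t -> t <= m.+1%:R ->
  (4 / z) `^ t <= (4 / z) ^+ m.+1.
Proof.
move=> z0 z1 t0 tm; rewrite -powR_mulrn ?divr_ge0 ?(ltW z0)//.
by apply: ler_powR => //; rewrite ler_pdivlMr//; lra.
Qed.

Let arith (z q y : R) : 0 < z -> z <= 1 -> 0 < q -> 0 <= y ->
  (e0 * z ^+ D) `^ kap * Lam * (2 * (cutoff_const p m.+1 1 / (z / 4) `^ p * Lam * y +
    th * (4 / z) ^+ Q * (q / z) `^ (p - 1) * (((q / 2) `^ (p - 1))^-1 * y))) <=
  (2 ^+ D * 2 `^ p)^-1 * y.
Proof.
move=> z0 z1 q0 y0.
have C0 := @cutoff_const_gt0 _ p m.+1 1 ltr01.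
have w0 : 0 < 4 / z by rewrite divr_gt0.
have w1 : 1 <= 4 / z by rewrite ler_pdivlMr//; lra.
have E1 : ((z / 4) `^ p)^-1 <= (4 / z) ^+ m.+1.
  rewrite -powRV ?divr_ge0 ?(ltW z0)// invf_div.
  by apply: quarter_powR => //; exact: ltW.
have E2 : (q / z) `^ (p - 1) / (q / 2) `^ (p - 1) <= (4 / z) ^+ m.+1.
  rewrite -powRV ?divr_ge0 ?(ltW q0)// -powRM ?invr_ge0 ?divr_ge0 ?(ltW q0) ?(ltW z0)//.
  have -> : q / z * (q / 2)^-1 = 2 / z by field; rewrite !gt_eqF.
  apply: (@le_trans _ _ ((4 / z) `^ (p - 1))); last first.
    apply: quarter_powR => //; first exact: ltW.
    by apply: le_trans pm; rewrite gerBl.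
  apply: ler_wpowR; rewrite ?divr_ge0 ?(ltW z0) ?(ltW p10)//.
  by rewrite ler_wpM2r ?invr_ge0 ?(ltW z0)// ler_nat.
(* [DA] enters here: the small measure supplies z^(D kap), enough to absorb the powers of 4 / z lost
   to the slope of the cutoff and to the tail. *)
have E3 : (e0 * z ^+ D) `^ kap <= B * z ^+ (m.+1 + Q).
  rewrite powRM ?(ltW e0gt0) ?exprn_ge0 ?(ltW z0)//.
  apply: ler_pM; rewrite ?powR_ge0//.
  rewrite -(powR_mulrn D (ltW z0)) -powRrM -(powR_mulrn (m.+1 + Q) (ltW z0)).
  by apply: ger_powR => //; rewrite z0.
set W := 4 / z in w0 w1 E1 E2 *.
have zW : z ^+ (m.+1 + Q) * W ^+ (m.+1 + Q) = 4 ^+ (m.+1 + Q).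
  by rewrite -exprMn /W mulrC divfK// gt_eqF.
have WQ : 1 <= W ^+ Q by rewrite exprn_ege1.
have WM0 : 0 < W ^+ m.+1 by rewrite exprn_gt0.
have br : cutoff_const p m.+1 1 / (z / 4) `^ p * Lam * y +
    th * W ^+ Q * (q / z) `^ (p - 1) * (((q / 2) `^ (p - 1))^-1 * y) <=
    (cutoff_const p m.+1 1 * Lam + th) * (W ^+ (m.+1 + Q) * y).
  rewrite [leRHS]mulrDl; apply: lerD.
    have -> : cutoff_const p m.+1 1 / (z / 4) `^ p * Lam * y =
      cutoff_const p m.+1 1 * Lam * (((z / 4) `^ p)^-1 * y) by ring.
    rewrite ler_wpM2l ?mulr_ge0 ?(ltW C0) ?(ltW Lam0)// ler_wpM2r//.
    by apply: le_trans E1 _; rewrite exprD ler_pMr.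
  have -> : th * W ^+ Q * (q / z) `^ (p - 1) * (((q / 2) `^ (p - 1))^-1 * y) =
    th * ((W ^+ Q * ((q / z) `^ (p - 1) / (q / 2) `^ (p - 1))) * y) by ring.
  rewrite ler_wpM2l ?(ltW th0)// ler_wpM2r// exprD mulrC ler_wpM2r//.
  by rewrite exprn_ge0// ltW.
apply: (@le_trans _ _ (B * z ^+ (m.+1 + Q) * Lam * (2 * ((cutoff_const p m.+1 1 * Lam + th) * (W ^+ (m.+1 + Q) * y))))).
  apply: ler_pM; rewrite ?mulr_ge0 ?powR_ge0 ?(ltW Lam0)//.
  - by rewrite addr_ge0// ?mulr_ge0 ?invr_ge0 ?powR_ge0 ?exprn_ge0 ?(ltW w0) ?(ltW C0) ?(ltW Lam0) ?(ltW th0).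
  - by rewrite ler_wpM2r ?(ltW Lam0).
  - by rewrite ler_wpM2l.
have -> : B * z ^+ (m.+1 + Q) * Lam * (2 * ((cutoff_const p m.+1 1 * Lam + th) * (W ^+ (m.+1 + Q) * y))) =
   B * (Lam * C1 * (z ^+ (m.+1 + Q) * W ^+ (m.+1 + Q))) * y by rewrite /C1; ring.
rewrite zW ler_wpM2r// /B.
have P0 : 0 < Lam * C1 * 4 ^+ (m.+1 + Q) by posi.
set P := Lam * C1 * _ in P0 *.
have D0 : 0 < 2 ^+ D * 2 `^ p :> R by posi.
by rewrite invfM -mulrA mulVf ?mulr1// gt_eqF.
Qed.

Section one_step.
Context d (T : measurableType d) (mu : {sigma_finite_measure set T -> \bar R})
  (V : R) (N : T -> R) (J : T * T -> R) (f : T -> R).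
Hypotheses (sp : nonlocal_space p Lam kap Q nn mu V N J) (mf : measurable_fun setT f).
Hypothesis weakf : weak_trunc p m mu N J f.

Local Notation w k x := (maxr 0 (f x - k)).
Local Notation energy S k := (\int[mu]_x ((N x < S)%R%:R * w k x `^ p)%:E)%E.

(** The smallness condition reproduces itself with gap and height halved, so the iteration is a
    plain induction. The Caccioppoli step runs from rho + z / 2 with h = z / 4, for which S + 2 h is
    the old radius. *)
Lemma dg_step rho z q k : 1 <= rho -> 0 < z -> z <= 1 -> rho + z <= 7 -> 0 < q ->
  (forall x, N x < rho + z / 2 + z / 4 ->
    (\int[mu]_y ((rho + z <= N y)%R%:R * w (k + q / 2)%R y `^ (p - 1) * J (x, y))%:E <=
     (th * (4 / z) ^+ Q * (q / z) `^ (p - 1))%:E)%E) ->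
  (energy (rho + z)%R k <= (dg_const * z ^+ D * q `^ p * V)%:E)%E ->
  (energy (rho + z / 2)%R (k + q / 2)%R <=
    (dg_const * (z / 2) ^+ D * (q / 2) `^ p * V)%:E)%E.
Proof.
move=> rho1 z0 z1 rz q0 tail hE.
have mN := ns_mN sp; have mJ := ns_mJ sp; have V0 := ns_V sp.
have c0 := dg_const_gt0.
have q20 : 0 < q / 2 by rewrite divr_gt0.
have z2E : rho + z / 2 + 2 * (z / 4) = rho + z by field.
set y := dg_const * z ^+ D * q `^ p * V in hE.
have y0 : 0 <= y by rewrite /y; nneg.
have mw : measurable_fun setT (fun x => w k x) by mfun.
have mE : measurable_fun setT (fun x => (N x < rho + z)%R%:R * w k x `^ p) by mfun.
have E0 x : 0 <= (N x < rho + z)%R%:R * w k x `^ p by nneg.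
have scaled (g : T -> R) c : 0 <= c -> (forall x, 0 <= g x) ->
    (forall x, g x <= c * ((N x < rho + z)%R%:R * w k x `^ p)) ->
    (\int[mu]_x (g x)%:E <= (c * y)%:E)%E.
  move=> cge g0 gle; apply: (@le_trans _ _ (\int[mu]_x (c * ((N x < rho + z)%R%:R * w k x `^ p))%:E)%E).
    exact: le_integral_EFin.
  by rewrite integral_EFinZ//; exact: EFin_mul_le.
have wle x : w (k + q / 2) x <= w k x.
  by rewrite ge_max !le_max lexx /=; apply/orP; right; rewrite lerB// lerDl ltW.
have wbig x : k + q / 2 < f x -> q / 2 <= w k x.
  by move=> h; rewrite le_max; apply/orP; right; move: h; lra.
have q2p : 0 < (q / 2) `^ p by rewrite powR_gt0.
have q2p1 : 0 < (q / 2) `^ (p - 1) by rewrite powR_gt0.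
(* Where f exceeds the new level, the old truncation is at least q / 2; this bounds both the
   superlevel set and the first power of the truncation by the old energy. *)
have hcheb : (\int[mu]_x ((N x < rho + z)%R%:R * (k + q / 2 < f x)%R%:R)%:E <=
    (((q / 2) `^ p)^-1 * y)%:E)%E.
  apply: scaled => [|x|x]; [by nneg|by nneg|].
  rewrite mulrCA ler_wpM2l//; have [h|h] := ltrP (k + q / 2) (f x); last by nneg.
  rewrite [leRHS]mulrC ler_pdivlMr// mul1r; apply: ler_wpowR; rewrite ?(ltW p0) ?(ltW q20)//.
  exact: wbig.
have hL1 : (\int[mu]_x ((N x < rho + z)%R%:R * w (k + q / 2)%R x)%:E <=
    (((q / 2) `^ (p - 1))^-1 * y)%:E)%E.
  apply: scaled => [|x|x]; [by nneg|by nneg|].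
  rewrite mulrCA ler_wpM2l//; have [h|h] := ltrP (k + q / 2) (f x); last first.
    by rewrite (max_idPl _) ?subr_le0//; nneg.
  rewrite [leRHS]mulrC ler_pdivlMr// (@powRS _ (w k x)) ?gt_eqF//; last by rewrite le_max lexx.
  rewrite mulrC; apply: ler_pM => //; [by nneg|by nneg|].
  apply: ler_wpowR; rewrite ?(ltW p10) ?(ltW q20)//.
  exact: wbig.
have hE2 : (energy (rho + z)%R (k + q / 2)%R <= y%:E)%E.
  apply: le_trans hE; apply: le_integral_EFin => x; first by nneg.
  rewrite ler_wpM2l//; apply: ler_wpowR; rewrite ?(ltW p0)//; nneg.
have aE : ((q / 2) `^ p)^-1 * y = e0 * z ^+ D * V.
  rewrite /y /dg_const powRM ?(ltW q0)// powRV//.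
  have : 0 < q `^ p by rewrite powR_gt0.
  have : 0 < 2 `^ p :> R by rewrite powR_gt0.
  by move=> a1 a2; field; rewrite !gt_eqF.
have a0 : 0 < e0 * z ^+ D by rewrite mulr_gt0// exprn_gt0.
have ah : e0 * z ^+ D <= (2 * (z / 4)) ^+ nn / Lam.
  have -> : (2 * (z / 4)) ^+ nn / Lam = (2 ^+ nn * Lam)^-1 * z ^+ nn.
    have -> : 2 * (z / 4) = z / 2 by field.
    by rewrite exprMn exprVn invfM; ring.
  apply: ler_pM; rewrite ?(ltW e0gt0) ?exprn_ge0 ?(ltW z0)//.
    by rewrite ge_min lexx orbT.
  by apply: ler_wiXn2l => //; exact: ltW.
have := @caccioppoli _ p Lam kap Q nn m p1 pm Lam0 _ _ mu V N J f sp mf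
  (rho + z / 2) (z / 4) (k + q / 2) (e0 * z ^+ D)
  (th * (4 / z) ^+ Q * (q / z) `^ (p - 1)) y (((q / 2) `^ (p - 1))^-1 * y) weakf.
rewrite z2E -aE => /(_ _ _ _ _ _ _ hcheb).
have g1 : 1 <= rho + z / 2 by move: rho1 z0; lra.
have g2 : 0 < z / 4 by rewrite divr_gt0.
have g3 : z / 4 <= 2^-1 by move: z1; lra.
have g4 : 0 <= th * (4 / z) ^+ Q * (q / z) `^ (p - 1).
  by rewrite !mulr_ge0 ?powR_ge0 ?exprn_ge0 ?divr_ge0 ?(ltW z0) ?(ltW th0).
move=> /(_ g1 g2 rz g3 a0 ah g4 tail hE2 hL1) /le_trans; apply.
rewrite lee_fin; apply: le_trans (arith z0 z1 q0 y0) _.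
rewrite /y !exprMn !exprVn powRM ?(ltW q0)// powRV// invfM.
by apply: le_of_eq; ring.
Qed.

(** Radii rho + H 2^-i and levels k0 + K (1 - 2^-i): every energy in this sequence dominates the one
    at the limit radius and level, and they tend to 0. *)
Lemma de_giorgi rho H K k0 : 1 <= rho -> 0 < H -> H <= 1 -> rho + H <= 7 -> 0 < K ->
  (forall S h x, rho <= S -> 0 < h -> h <= 1 -> S + 2 * h <= rho + H -> N x < S + h ->
    (\int[mu]_y ((S + 2 * h <= N y)%R%:R * w k0 y `^ (p - 1) * J (x, y))%:E <=
     (th / h ^+ Q * K `^ (p - 1))%:E)%E) ->
  (energy (rho + H)%R k0 <= (dg_const * H ^+ D * K `^ p * V)%:E)%E ->
  {ae mu, forall x, N x < rho -> f x <= k0 + K}.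
Proof.
move=> rho1 H0 H1 rH K0 tail hE.
have mN := ns_mN sp; have mJ := ns_mJ sp; have V0 := ns_V sp; have J0 := ns_J0 sp.
have c0 := dg_const_gt0.
have half i : 0 < (2^-1 : R) ^+ i <= 1.
  by rewrite exprn_gt0//= exprn_ile1// invf_le1// ler1n.
have stepi i : (energy (rho + H * 2^-1 ^+ i)%R (k0 + K * (1 - 2^-1 ^+ i))%R <=
    (dg_const * (H * 2^-1 ^+ i) ^+ D * (K * 2^-1 ^+ i) `^ p * V)%:E)%E.
  elim: i => [|i IH]; first by rewrite expr0 !mulr1 subrr mulr0 addr0.
  have /andP[h0 h1] := half i.
  have := @dg_step rho (H * 2^-1 ^+ i) (K * 2^-1 ^+ i) (k0 + K * (1 - 2^-1 ^+ i)) rho1.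
  have -> : k0 + K * (1 - 2^-1 ^+ i) + K * 2^-1 ^+ i / 2 = k0 + K * (1 - 2^-1 ^+ i.+1).
    by rewrite exprS; field.
  have -> : H * 2^-1 ^+ i / 2 = H * 2^-1 ^+ i.+1 by rewrite exprS; ring.
  have -> : K * 2^-1 ^+ i / 2 = K * 2^-1 ^+ i.+1 by rewrite exprS; ring.
  have z0 : 0 < H * 2^-1 ^+ i by rewrite mulr_gt0.
  have zH : H * 2^-1 ^+ i <= H by rewrite ler_piMr// ltW.
  apply => //; [lra|lra|by rewrite mulr_gt0|].
  move=> x Nx; set z := H * 2^-1 ^+ i in z0 zH Nx *.
  have zE : H * 2^-1 ^+ i.+1 = z / 2 by rewrite exprS /z; ring.
  have SE : rho + z / 2 + 2 * (z / 4) = rho + z by field.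
  have Nx' : N x < rho + z / 2 + z / 4 by rewrite -zE.
  have := tail (rho + z / 2) (z / 4) x; rewrite SE => tl.
  have t1 : rho <= rho + z / 2 by rewrite lerDl divr_ge0// ltW.
  have t2 : 0 < z / 4 by rewrite divr_gt0.
  have t3 : z / 4 <= 1 by move: zH H1 z0; lra.
  have t4 : rho + z <= rho + H by rewrite lerD2l.
  have {}tl := tl t1 t2 t3 t4 Nx'.
  apply: (le_trans (le_trans _ tl)).
  - apply: le_integral_EFin => y; first by nneg.
    rewrite ler_wpM2r// ler_wpM2l//; apply: ler_wpowR; rewrite ?(ltW p10)//; [nneg|].
    rewrite ge_max !le_max lexx /=; apply/orP; right.
    rewrite lerD2l lerN2 lerDl mulr_ge0 ?(ltW K0)// subr_ge0.
    by case/andP: (half i.+1).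
  (* The ratio of height to gap is K / H at every step, hence at least K: one tail bound in terms of
     K serves all steps. *)
  - rewrite lee_fin -exprVn invf_div.
    apply: ler_wpM2l; first by rewrite mulr_ge0 ?exprn_ge0 ?divr_ge0 ?(ltW z0) ?(ltW th0).
    apply: ler_wpowR; rewrite ?(ltW p10) ?(ltW K0)//.
    by rewrite ler_pdivlMr// ler_wpM2l ?(ltW K0)// /z ler_piMl// ltW.
have lim0 : (energy rho (k0 + K)%R = 0)%E.
  apply/eqP; rewrite eq_le integral_EFin_ge0 ?andbT; last by nneg.
  apply/lee_addgt0Pr => e epos; rewrite add0e.
  have : (dg_const * H ^+ D * K `^ p * V) * 2^-1 ^+ i @[i --> \oo] --> 0.
    rewrite -[X in _ --> X](mulr0 (dg_const * H ^+ D * K `^ p * V)).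
    apply: cvgM; [exact: cvg_cst|apply: cvg_expr].
    by rewrite ger0_norm// invf_lt1// ltr1n.
  move=> /cvgrPdist_lt/(_ e epos)[i _ /(_ i (leqnn i))].
  rewrite sub0r normrN; set P := _ * V; set Pi := P * _ => Pie.
  have Pi_le : dg_const * (H * 2^-1 ^+ i) ^+ D * (K * 2^-1 ^+ i) `^ p * V <= Pi.
    have /andP[h0 h1] := half i.
    have -> : Pi = dg_const * (H ^+ D) * (K `^ p * 2^-1 ^+ i) * V by rewrite /Pi /P; ring.
    rewrite ler_wpM2r ?(ltW V0)//.
    apply: ler_pM; [by nneg|by nneg| |].
      rewrite ler_wpM2l ?(ltW c0)// lerXn2r ?nnegrE ?mulr_ge0 ?(ltW H0) ?(ltW h0)//.
      by rewrite ler_piMr// ltW.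
    rewrite powRM ?(ltW K0) ?(ltW h0)// ler_wpM2l ?powR_ge0//.
    by apply: ge1r_powR; rewrite ?half// ltW.
  apply: (le_trans (le_trans _ (stepi i))); last first.
    rewrite lee_fin; apply: le_trans Pi_le _; apply: ltW.
    by apply: le_lt_trans Pie; rewrite ler_norm.
  have /andP[h0 h1] := half i.
  apply: le_integral_EFin => x; first by nneg.
  apply: ler_pM; [by nneg|by nneg| |].
    rewrite ler_nat; have [h|h] := ltrP (N x) rho => //.
    by rewrite (lt_le_trans h)// lerDl mulr_ge0 ?(ltW H0) ?(ltW h0).
  apply: ler_wpowR; rewrite ?(ltW p0)//; [nneg|].
  rewrite ge_max !le_max lexx /=; apply/orP; right.
  rewrite lerD2l lerN2 lerD2l ler_piMr ?(ltW K0)// gerBl ltW//.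
have mE : measurable_fun setT (fun x => ((N x < rho)%R%:R * w (k0 + K) x `^ p)%:E).
  by apply/measurable_EFinP; mfun.
have : ae_eq mu setT (fun x => ((N x < rho)%R%:R * w (k0 + K) x `^ p)%:E) (cst 0%E).
  apply/ae_eq_integral_abs => //; rewrite -[RHS]lim0; apply: eq_integral => x _.
  by rewrite gee0_abs// lee_fin; nneg.
apply: filterS => x + Nx => /(_ Logic.I); rewrite Nx mul1r => -[] /powR_eq0_eq0 h.
have : f x - (k0 + K) <= maxr 0 (f x - (k0 + K)) by rewrite le_max lexx orbT.
by rewrite h subr_le0.
Qed.

End one_step.
End de_giorgi_iteration.

(** * The A_2 condition and the mean value *)

Lemma max0_lipschitz {R : realDomainType} (a b : R) :
  `|maxr 0 a - maxr 0 b| <= `|a - b|.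
Proof.
wlog ab : a b / a <= b.
  move=> H; have /orP[ab|ab] := le_total a b; first exact: H.
  by rewrite distrC [`|a - b|]distrC; exact: H.
rewrite distrC [`|a - b|]distrC [leRHS]ger0_norm ?subr_ge0//.
have [a0|a0] := leP 0 a; have [b0|b0] := leP 0 b; rewrite ler_norml; lra.
Qed.

Section harnack_core.
Context {R : realType}.
Variables (p Lam kap : R) (Q nn m : nat).
Hypotheses (p1 : 1 < p) (pm : p <= m.+1%:R) (Lam0 : 0 < Lam) (kap0 : 0 < kap).
Hypothesis (mQ : (m.+1 <= Q)%N).

Let p0 : 0 < p. Proof. exact: lt_trans ltr01 p1. Qed.
Let p10 : 0 < p - 1. Proof. by rewrite subr_gt0. Qed.

(** One factor 2 comes from the two orders of the variables and one from the two parts of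
    [log_loss]; one [Lam] bounds each part, the other the measure of the ball. The extra Lam^2 in
    [tail_bound] comes from the lower bound for the mass of v^(1-p). *)
Definition log_bound : R := 4 * log_const p m * Lam ^+ 2.
Definition a2_bound : R := Lam * log_bound + 2 `^ (p - 1) * Lam ^+ 2.
Definition tail_bound : R := (Lam * log_bound + 2 `^ (p - 1) * Lam ^+ 2) * Lam ^+ 2.

Let lc0 : 0 < log_const p m. Proof. exact: log_const_gt0. Qed.
Let lb0 : 0 < log_bound. Proof. by rewrite /log_bound; posi. Qed.
Lemma tail_bound_gt0 : 0 < tail_bound. Proof. by rewrite /tail_bound; posi. Qed.
Lemma a2_bound_gt0 : 0 < a2_bound. Proof. by rewrite /a2_bound; posi. Qed.

(** All tests needed later, v^(1-p) and the truncations from above and from below, are a cutoff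
    times a Lipschitz function of u, so admissibility is established once for this class. *)
Definition weak_form d (T : measurableType d)
    (mu : {sigma_finite_measure set T -> \bar R}) (N : T -> R) (J : T * T -> R)
    (u : T -> R) : Prop :=
  forall S h (Phi : R -> R) l, 1 <= S -> 0 < h -> h <= 1 -> S + h <= 9 ->
  measurable_fun setT Phi -> (forall a b, `|Phi a - Phi b| <= l * `|a - b|) ->
  (\int[mu \x mu]_z (Jp p (u z.1 - u z.2) *
     (cutoff S h (N z.1) ^+ m.+1 * Phi (u z.1) -
      cutoff S h (N z.2) ^+ m.+1 * Phi (u z.2)) * J z)%:E = 0)%E.

Section positive_solution.
Context d (T : measurableType d) (mu : {sigma_finite_measure set T -> \bar R})
  (V : R) (N : T -> R) (J : T * T -> R) (u : T -> R) (dd : R).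
Hypotheses (sp : nonlocal_space p Lam kap Q nn mu V N J) (mU : measurable_fun setT u).
Hypotheses (u0 : forall x, N x < 10 -> 0 <= u x) (dd0 : 0 < dd).
Hypothesis (weak : weak_form mu N J u).
Hypothesis (neg_tail : forall x, N x < 9 ->
  (\int[mu]_y ((10 <= N y)%R%:R * maxr 0 (- u y) `^ (p - 1) * J (x, y))%:E <=
   (Lam * dd `^ (p - 1))%:E)%E).

Let mN := ns_mN sp.
Let mJ := ns_mJ sp.
Let J0 := ns_J0 sp.
Let V0 := ns_V sp.
Let ddp : 0 < dd `^ (p - 1). Proof. exact: powR_gt0. Qed.

Local Notation v x := (u x + dd).
Local Notation gain x y := (log_gain p dd u N x y).

Let dv x : N x < 10 -> dd <= v x.
Proof. by move=> /u0 h; rewrite lerDr. Qed.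

Let v_gt0 x : N x < 10 -> 0 < v x.
Proof. by move=> /dv; exact: lt_le_trans. Qed.

Let ball_le S : S <= 10 ->
  (\int[mu]_x ((N x < S)%R%:R)%:E <= (Lam * V)%:E)%E.
Proof.
move=> S10; apply: le_trans (ns_ball10 sp).
rewrite -integral_lt_indic//; apply: le_integral_EFin => x //.
by rewrite ler_nat; have [h|h] := ltrP (N x) S => //; rewrite (lt_le_trans h).
Qed.

Lemma log_integral :
  (\int[mu]_x \int[mu]_y (gain x y * J (x, y))%:E <= (log_bound * V)%:E)%E.
Proof.
have mF : measurable_fun setT (fun z : T * T =>
    harnack_const p * - log_form p dd m u N z.1 z.2).
  by rewrite /log_form /log_test /Jp /cutoff; mfun.
have mG : measurable_fun setT (fun z : T * T => gain z.1 z.2).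
  by rewrite /log_gain; mfun.
have mL : measurable_fun setT (fun z : T * T => log_loss p dd m u N z.1 z.2).
  by rewrite /log_loss; mfun.
have F0 : (\int[mu \x mu]_z (harnack_const p * - log_form p dd m u N z.1 z.2 * J z)%:E = 0)%E.
  (* Sign and constant go into the test function, so that the tested equation has exactly the
     integrand of [log_pointwise]. *)
  pose Phi (t : R) := - harnack_const p * log_test p dd t.
  have H0 := @harnack_const_gt0 _ p p1.
  have mPhi : measurable_fun setT Phi.
    rewrite /Phi /log_test; mfun.
    change (measurable_fun setT (fun x : R => maxr (cst 0 x) (id x))).
    by apply: measurable_maxr.
  have := @weak 7 1 Phi
    (harnack_const p * (m.+1%:R * (dd `^ (p - 1))^-1 * dd^-1)).
  rewrite ler1n ltr01 lexx => /(_ isT isT isT _ mPhi _).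
  have s9 : 7 + 1 <= 9 :> R by lra.
  move=> /(_ s9) <-; last first.
    move=> a b; rewrite /Phi -mulrBr normrM normrN (gtr0_norm H0) -[leRHS]mulrA.
    apply: ler_wpM2l; first exact: ltW.
    have pm1 : p - 1 <= m.+1%:R by apply: le_trans pm; rewrite gerBl.
    have ha : dd <= maxr 0 a + dd by rewrite lerDr le_max lexx.
    have hb : dd <= maxr 0 b + dd by rewrite lerDr le_max lexx.
    apply: le_trans (inv_powR_lipschitz p10 pm1 dd0 ha hb) _.
    apply: ler_wpM2l; first by nneg.
    by rewrite opprD addrACA subrr addr0 max0_lipschitz.
  apply: eq_integral => z _; congr (_%:E); congr (_ * _).
  by rewrite /log_form /Phi; ring.
have main := @le_iterated_of_zero _ _ _ mu J _ _ _ mJ mF mG mL J0 (ns_sym sp)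
  (fun z => log_gain_ge0 p dd u N z.1 z.2)
  (fun z => log_loss_ge0 dd m u N p1 z.1 z.2)
  (fun x y => log_pointwise p1 pm dd0 u0 x y) F0.
apply: le_trans main _.
have -> : log_bound * V = 2 * (2 * log_const p m * Lam * (Lam * V)).
  by rewrite /log_bound; ring.
rewrite EFinM; apply: lee_pmul; rewrite ?lee_fin//.
  by apply: integral_ge0 => x _; apply: integral_EFin_ge0 => y; rewrite mulr_ge0 ?log_loss_ge0.
have le8 : 8 <= 10 :> R by lra.
apply: (@le_trans _ _ (\int[mu]_x (2 * log_const p m * Lam * (N x < 8)%R%:R)%:E)%E).
  apply: le_integral_inner => x.
    by apply: integral_EFin_ge0 => y; rewrite mulr_ge0 ?log_loss_ge0.
  have [N8|N8] := ltrP (N x) 8; last first.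
    by rewrite mulr0 integral0_eq// => y _; rewrite /log_loss ltNge N8 /= mul0r mul0r.
  have N9 : N x < 9 by lra.
  have N10 : N x < 10 by lra.
  rewrite (_ : (fun y => (log_loss p dd m u N x y * J (x, y))%:E) =
    (fun y => (log_const p m * (minr 1 `|N x - N y| `^ p * J (x, y)) +
     log_const p m / dd `^ (p - 1) *
       ((10 <= N y)%R%:R * maxr 0 (- u y) `^ (p - 1) * J (x, y)))%:E)); last first.
    apply/funext => y; congr (_%:E); rewrite /log_loss N8 mul1r powRM ?invr_ge0 ?(ltW dd0)//.
      by rewrite powRV ?(ltW dd0)//; ring.
    by nneg.
  split_sum.
  pull_const.
  pull_const.
  have -> : 2 * log_const p m * Lam * 1 = log_const p m * Lam +
     log_const p m / dd `^ (p - 1) * (Lam * dd `^ (p - 1)).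
    by field; rewrite gt_eqF.
  rewrite EFinD; apply: leeD; apply: EFin_mul_le; [nneg|exact: (ns_upper sp)|nneg|].
  exact: neg_tail.
pull_const.
by apply: EFin_mul_le; [nneg|exact: ball_le].
Qed.

Local Notation mass := (\int[mu]_x ((N x < 7)%R%:R * v x `^ (p - 1))%:E)%E.
Local Notation inv_mass := (\int[mu]_x ((N x < 7)%R%:R * (v x `^ (p - 1))^-1)%:E)%E.
Local Notation inter x := (\int[mu]_y (gain x y * J (x, y))%:E)%E.

Let quotient_gain x y : N x < 7 ->
  (v x `^ (p - 1))^-1 * maxr 0 (v y) `^ (p - 1) <= gain x y + 2 `^ (p - 1).
Proof.
move=> Nx; have vx : 0 < v x by apply: v_gt0; lra.
rewrite /log_gain Nx mul1r mulrC -powRV ?(ltW vx)// -powRM; [|by nneg|by rewrite invr_ge0 ltW].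
by rewrite -lerBlDr le_max lexx orbT.
Qed.

Let gain0 x y : 0 <= gain x y. Proof. exact: log_gain_ge0. Qed.

(** [I] does not depend on the base point, so integrating in [x] produces the product with the mass
    of v^(1-p). Taking for [I] the mass of v^(p-1) gives the A_2 condition, taking a tail gives the
    tail bound. *)
Let weighted (I : \bar R) (al be : R) : (0 <= I)%E -> 0 <= al -> 0 <= be ->
  (forall x, N x < 7 -> ((v x `^ (p - 1))^-1%:E * I <= al%:E * inter x + be%:E)%E) ->
  (inv_mass * I <= (al * (log_bound * V) + be * (Lam * V))%:E)%E.
Proof.
move=> I0 al0 be0 HI.
have mG : measurable_fun setT (fun z : T * T => gain z.1 z.2 * J z).
  by rewrite /log_gain; mfun.
have minter : measurable_fun setT (fun x => inter x).
  apply: (@measurable_inner_integral _ _ _ mu _ mG) => z.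
  by rewrite mulr_ge0 ?log_gain_ge0.
rewrite -ge0_integralZr//; first last.
- by move=> x _; rewrite lee_fin; nneg.
- by apply/measurable_EFinP; mfun.
apply: (@le_trans _ _ (\int[mu]_x (al%:E * inter x + (be * (N x < 7)%R%:R)%:E))%E).
  apply: le_integral_inner => x.
    by rewrite mule_ge0// lee_fin; nneg.
  have [Nx|Nx] := ltrP (N x) 7; last first.
    rewrite mul0r mul0e mulr0 adde0 mule_ge0 ?lee_fin//.
    by apply: integral_EFin_ge0 => y; rewrite mulr_ge0.
  by rewrite mul1r mulr1; exact: HI.
rewrite ge0_integralD//; first last.
- by apply/measurable_EFinP; mfun.
- by move=> x _; rewrite lee_fin; nneg.
- by apply: emeasurable_funM => //; exact: measurable_cst.
- move=> x _; rewrite mule_ge0 ?lee_fin//.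
  by apply: integral_EFin_ge0 => y; rewrite mulr_ge0.
rewrite ge0_integralZl//; last first.
  by move=> x _; apply: integral_EFin_ge0 => y; rewrite mulr_ge0.
rewrite integral_EFinZ; [|by []|by mfun|by nneg].
rewrite EFinD; apply: leeD; rewrite [leRHS]EFinM; apply: lee_pmul; rewrite ?lee_fin//.
- apply: integral_ge0 => x _; apply: integral_EFin_ge0 => y; rewrite mulr_ge0//.
- exact: log_integral.
- exact: integral_EFin_ge0.
- by apply: ball_le; lra.
Qed.

(** On the ball [ns_lower] gives 1 <= Lam V J, so the quotient v(y) / v(x) may be integrated without
    the kernel. *)
Lemma a2_estimate : (inv_mass * mass <= (a2_bound * V ^+ 2)%:E)%E.
Proof.
have -> : a2_bound * V ^+ 2 = Lam * V * (log_bound * V) + 2 `^ (p - 1) * (Lam * V) * (Lam * V).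
  by rewrite /a2_bound; ring.
apply: weighted; [by apply: integral_EFin_ge0; nneg|by nneg|by nneg|].
move=> x Nx; have vx : 0 < v x by apply: v_gt0; lra.
have mgx : measurable_fun setT (fun y => gain x y) by rewrite /log_gain; mfun.
rewrite -integral_EFinZ; [|by nneg|by mfun|by nneg].
apply: (@le_trans _ _ (\int[mu]_y (Lam * V * (gain x y * J (x, y)) +
    2 `^ (p - 1) * (N y < 7)%R%:R)%:E)%E).
  apply: le_integral_EFin => y; first by nneg.
  have gJ : 0 <= Lam * V * (gain x y * J (x, y)).
    by apply: mulr_ge0; [nneg|rewrite mulr_ge0].
  have [Ny|Ny] := ltrP (N y) 7; last by rewrite mul0r !mulr0 addr0.
  have vy : 0 < v y by apply: v_gt0; lra.
  rewrite mul1r mulr1; have := quotient_gain y Nx; rewrite (max_idPr (ltW vy)).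
  move=> /le_trans; apply; rewrite lerD2r mulrCA ler_peMr//.
  have N10 : N x < 10 by lra.
  have Ny10 : N y < 10 by lra.
  have := ns_lower sp N10 Ny10.
  by rewrite -div1r ler_pdivrMr 1?mulrC//; posi.
rewrite integral_EFinD; [|by mfun|by mfun| |by nneg]; last first.
  by move=> y; apply: mulr_ge0; [nneg|rewrite mulr_ge0].
rewrite integral_EFinZ; [|by nneg|by mfun|by move=> y; rewrite mulr_ge0].
pull_const.
by apply: leeD => //; apply: EFin_mul_le; [nneg|apply: ball_le; lra].
Qed.

(** [ns_comparable] replaces the base point [x] by any x' of the ball, where the gain is available.
    The part of the quotient below 2^(p-1) is left at [x]; as the points are at least h apart,
    [ns_upper] controls it at the cost of h^-p. *)
Lemma upper_tail_weighted S h x : 0 < h -> h <= 1 -> S + 2 * h <= 7 -> N x < S + h ->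
  (inv_mass * \int[mu]_y ((S + 2 * h <= N y)%R%:R * maxr 0 (v y) `^ (p - 1) * J (x, y))%:E
   <= ((Lam * log_bound + 2 `^ (p - 1) * Lam ^+ 2) / h ^+ Q * V)%:E)%E.
Proof.
move=> h0 h1 Sh Nx.
have hQ0 : 0 < h ^+ Q by rewrite exprn_gt0.
have hp0 : 0 < h `^ p by rewrite powR_gt0.
have Nx7 : N x < 7 by lra.
have Nx10 : N x < 10 by lra.
have hpQ : (h `^ p)^-1 <= (h ^+ Q)^-1.
  rewrite lef_pV2// -powR_mulrn ?(ltW h0)//; apply: ger_powR; first by rewrite h0.
  by apply: le_trans pm _; rewrite ler_nat.
have -> : (Lam * log_bound + 2 `^ (p - 1) * Lam ^+ 2) / h ^+ Q * V =
  Lam / h ^+ Q * (log_bound * V) + 2 `^ (p - 1) / h ^+ Q * Lam * (Lam * V) by ring.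
apply: weighted; [by apply: integral_EFin_ge0; nneg|by nneg|by nneg|].
move=> x' Nx'; have vx : 0 < v x' by apply: v_gt0; lra.
have mgx : measurable_fun setT (fun y => gain x' y) by rewrite /log_gain; mfun.
rewrite -integral_EFinZ; [|by nneg|by mfun|by nneg].
apply: (@le_trans _ _ (\int[mu]_y (Lam / h ^+ Q * (gain x' y * J (x', y)) +
    2 `^ (p - 1) / h ^+ Q * (minr 1 `|N x - N y| `^ p * J (x, y)))%:E)%E).
  apply: le_integral_EFin => y; first by nneg.
  have a1 : 0 <= Lam / h ^+ Q * (gain x' y * J (x', y)).
    by apply: mulr_ge0; [nneg|rewrite mulr_ge0].
  have a2 : 0 <= 2 `^ (p - 1) / h ^+ Q * (minr 1 `|N x - N y| `^ p * J (x, y)) by nneg.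
  have [Ny|Ny] := lerP (S + 2 * h) (N y); last by rewrite !mul0r mulr0 addr_ge0.
  rewrite mul1r mulrA; apply: (@le_trans _ _ ((gain x' y + 2 `^ (p - 1)) * J (x, y))).
    by rewrite ler_wpM2r// quotient_gain.
  rewrite mulrDl; apply: lerD.
    rewrite mulrCA ler_wpM2l//; apply: (ns_comparable sp) => //; lra.
  have -> : 2 `^ (p - 1) / h ^+ Q * (minr 1 `|N x - N y| `^ p * J (x, y)) =
    2 `^ (p - 1) * J (x, y) * (minr 1 `|N x - N y| `^ p / h ^+ Q) by ring.
  rewrite ler_peMr//; first by nneg.
  apply: (@le_trans _ _ (h `^ p / h `^ p)); first by rewrite divff// gt_eqF.
  apply: ler_pM; [by nneg|by nneg| |by []].
  have hle : h <= minr 1 `|N x - N y| by rewrite le_min h1 /= ler0_norm; lra.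
  by apply: ler_wpowR; rewrite ?(ltW p0) ?(ltW h0)//; apply: le_trans hle; exact: ltW.
rewrite integral_EFinD; [|by mfun|by mfun| |by nneg]; last first.
  by move=> y; apply: mulr_ge0; [nneg|rewrite mulr_ge0].
rewrite integral_EFinZ; [|by nneg|by mfun|by move=> y; rewrite mulr_ge0].
pull_const.
by apply: leeD => //; apply: EFin_mul_le; [nneg|exact: (ns_upper sp)].
Qed.

Lemma upper_tail S h x M : 0 < M -> mass = M%:E ->
  0 < h -> h <= 1 -> S + 2 * h <= 7 -> N x < S + h ->
  (\int[mu]_y ((S + 2 * h <= N y)%R%:R * maxr 0 (v y) `^ (p - 1) * J (x, y))%:E
   <= (tail_bound / h ^+ Q * (M / V))%:E)%E.
Proof.
move=> M0 massM h0 h1 Sh Nx; have := upper_tail_weighted h0 h1 Sh Nx.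
set I := (X in (_ * X <= _)%E) => H.
have I0 : (0 <= I)%E by apply: integral_EFin_ge0; nneg.
(* Cauchy-Schwarz, in the form [1 / z >= 2 / K - z / K ^ 2]. *)
have CS : ((V ^+ 2 / (Lam ^+ 2 * M))%:E <= inv_mass)%E.
  (* [V / Lam] is the lower bound for the measure of the unit ball; with this K the two terms are 2
     and 1 times V^2 / (Lam^2 M). *)
  pose K := Lam * M / V.
  have K0 : 0 < K by rewrite /K; posi.
  have : ((2 / K * (V / Lam))%:E <= inv_mass + ((K ^+ 2)^-1 * M)%:E)%E.
    rewrite EFinM (EFinM _ M) -massM -integral_EFinZ; [|by nneg|by mfun|by nneg].
    rewrite -integral_EFinD; [|by mfun|by mfun|by nneg|by nneg].
    apply: (@le_trans _ _ (\int[mu]_x (2 / K * (N x < 1)%R%:R)%:E)%E).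
      pull_const.
      apply: lee_pmul; rewrite ?lee_fin//; [by nneg|by nneg|].
      by rewrite integral_lt_indic//; exact: (ns_ball1 sp).
    apply: le_integral_EFin => y; first by nneg.
    have [N1|N1] := ltrP (N y) 1; last by rewrite mulr0; nneg.
    have -> : (N y < 7) = true by lra.
    have vy : 0 < v y `^ (p - 1) by rewrite powR_gt0// v_gt0//; lra.
    rewrite !mul1r mulr1; set z := v y `^ (p - 1) in vy *.
    rewrite -subr_ge0 (_ : _ - _ = z * (z^-1 - K^-1) ^+ 2).
      by rewrite mulr_ge0 ?sqr_ge0// ltW.
    by field; rewrite !gt_eqF.
  have -> : V ^+ 2 / (Lam ^+ 2 * M) = 2 / K * (V / Lam) - (K ^+ 2)^-1 * M.
    by rewrite /K; field; rewrite !gt_eqF.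
  by rewrite EFinB leeBlDr.
have : ((V ^+ 2 / (Lam ^+ 2 * M))%:E * I <=
    ((Lam * log_bound + 2 `^ (p - 1) * Lam ^+ 2) / h ^+ Q * V)%:E)%E.
  apply: le_trans H; apply: lee_pmul; [by rewrite lee_fin; nneg|exact: I0|exact: CS|exact: lexx].
have c0 : 0 < V ^+ 2 / (Lam ^+ 2 * M) by posi.
rewrite -lee_pdivlMl// -EFinM => /le_trans; apply; rewrite lee_fin /tail_bound.
have hQ0 : 0 < h ^+ Q by rewrite exprn_gt0.
apply: le_of_eq; field.
by rewrite !gt_eqF.
Qed.

End positive_solution.
End harnack_core.

(** * Comparison of the solution with its mean *)

Section harnack_bounds.
Context {R : realType}.
Variables (p Lam kap : R) (Q nn m D : nat).
Hypotheses (p1 : 1 < p) (pm : p <= m.+1%:R) (Lam0 : 0 < Lam) (kap0 : 0 < kap).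
Hypotheses (mQ : (m.+1 <= Q)%N) (Dnn : (nn <= D)%N).
Hypothesis (DA : (m.+1 + Q)%:R <= D%:R * kap).

Let p0 : 0 < p. Proof. exact: lt_trans ltr01 p1. Qed.
Let p10 : 0 < p - 1. Proof. by rewrite subr_gt0. Qed.
Let pn0 : p != 0. Proof. by rewrite gt_eqF. Qed.

(** The bounded part of the truncation and the negative part of u contribute 2^(p-1) Lam l^(p-1)
    each; the last factor passes from l to the height l / 2. *)
Definition inf_tail : R := 2 `^ p * Lam * 2 `^ (p - 1).

Let inf_tail0 : 0 < inf_tail. Proof. by rewrite /inf_tail; posi. Qed.
Let sup_tail0 : 0 < tail_bound p Lam m. Proof. exact: tail_bound_gt0. Qed.

Section bounds.
Context d (T : measurableType d) (mu : {sigma_finite_measure set T -> \bar R})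
  (V : R) (N : T -> R) (J : T * T -> R) (u : T -> R) (dd : R).
Hypotheses (sp : nonlocal_space p Lam kap Q nn mu V N J) (mU : measurable_fun setT u).
Hypotheses (u0 : forall x, N x < 10 -> 0 <= u x) (dd0 : 0 < dd).
Hypothesis (weak : weak_form p m mu N J u).
Hypothesis (neg_tail : forall x, N x < 9 ->
  (\int[mu]_y ((10 <= N y)%R%:R * maxr 0 (- u y) `^ (p - 1) * J (x, y))%:E <=
   (Lam * dd `^ (p - 1))%:E)%E).
Hypothesis (fin : (\int[mu]_x ((N x < 9)%R%:R * (u x + dd) `^ p)%:E < +oo)%E).

Let mN := ns_mN sp.
Let mJ := ns_mJ sp.
Let J0 := ns_J0 sp.
Let V0 := ns_V sp.

Local Notation v x := (u x + dd).
Local Notation mass := (\int[mu]_x ((N x < 7)%R%:R * v x `^ (p - 1))%:E)%E.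
Local Notation inv_mass := (\int[mu]_x ((N x < 7)%R%:R * (v x `^ (p - 1))^-1)%:E)%E.

Let dv x : N x < 10 -> dd <= v x.
Proof. by move=> /u0 h; rewrite lerDr. Qed.

Let v_gt0 x : N x < 10 -> 0 < v x.
Proof. by move=> /dv; exact: lt_le_trans. Qed.

Lemma weak_trunc_sup : weak_trunc p m mu N J (fun x => v x).
Proof.
move=> S h k S1 h0 h1 S9.
have := @weak S h (fun t => maxr 0 (t + dd - k)) 1 S1 h0 h1 S9.
have mPhi : measurable_fun setT (fun t : R => maxr 0 (t + dd - k)) by mfun.
move=> /(_ mPhi) <-; last first.
  move=> a b; rewrite mul1r; apply: le_trans (max0_lipschitz _ _) _.
  by have -> : a + dd - k - (b + dd - k) = a - b by ring.
apply: eq_integral => z _; congr (_%:E); congr (_ * _); rewrite /trunc_form.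
by congr (Jp _ _ * _); ring.
Qed.

Lemma weak_trunc_inf : weak_trunc p m mu N J (fun x => - v x).
Proof.
move=> S h k S1 h0 h1 S9.
have := @weak S h (fun t => - maxr 0 (- (t + dd) - k)) 1 S1 h0 h1 S9.
have mPhi : measurable_fun setT (fun t : R => - maxr 0 (- (t + dd) - k)) by mfun.
move=> /(_ mPhi) <-; last first.
  move=> a b; rewrite mul1r -opprD normrN; apply: le_trans (max0_lipschitz _ _) _.
  have -> : - (a + dd) - k - (- (b + dd) - k) = b - a by ring.
  by rewrite distrC.
apply: eq_integral => z _; congr (_%:E); congr (_ * _); rewrite /trunc_form.
by rewrite (_ : - v z.1 - - v z.2 = - (u z.1 - u z.2)); [rewrite JpN|]; ring.
Qed.

(** De Giorgi for -v from level -l with height l / 2. Where v < l one has (l - v)^p <= l^p (l /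
    v)^(p-1), so the A_2 condition bounds the initial energy: smallness of l relative to the mean
    replaces a measure density lemma. *)
Lemma lower_bound M l : 0 < M -> mass = M%:E -> 0 < l -> dd <= l ->
  a2_bound p Lam m * l `^ (p - 1) * V <= dg_const p Lam kap inf_tail Q nn m D / 2 `^ p * M ->
  {ae mu, forall x, N x < 1 -> l / 2 <= v x}.
Proof.
move=> M0 massM l0 dl hl.
have mf : measurable_fun setT (fun x => - v x) by mfun.
have l20 : 0 < l / 2 by posi.
have le7 : 1 + 1 <= 7 :> R by lra.
have dg := @de_giorgi _ p Lam kap inf_tail Q nn m D p1 pm Lam0 kap0 inf_tail0 Dnn DA
  _ _ _ _ _ _ _ sp mf weak_trunc_inf 1 1 (l / 2) (- l) (lexx _) ltr01 (lexx _) le7 l20.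
suff : {ae mu, forall x, N x < 1 -> - v x <= - l + l / 2}.
  by apply: filterS => x h /h; lra.
apply: dg.
  move=> S h x S1 h0 h1 Sh Nx.
  have hQ0 : 0 < h ^+ Q by rewrite exprn_gt0.
  have hp0 : 0 < h `^ p by rewrite powR_gt0.
  have lp0 : 0 < l `^ (p - 1) by rewrite powR_gt0.
  have hpQ : (h `^ p)^-1 <= (h ^+ Q)^-1.
    rewrite lef_pV2// -powR_mulrn ?(ltW h0)//; apply: ger_powR; first by rewrite h0.
    by apply: le_trans pm _; rewrite ler_nat.
  have h1Q : 1 <= (h ^+ Q)^-1 by rewrite -invr1 lef_pV2 ?posrE// exprn_ile1// ltW.
  apply: (@le_trans _ _ (\int[mu]_y (
      2 `^ (p - 1) * l `^ (p - 1) / h `^ p * (minr 1 `|N x - N y| `^ p * J (x, y)) +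
      2 `^ (p - 1) * ((10 <= N y)%R%:R * maxr 0 (- u y) `^ (p - 1) * J (x, y)))%:E)%E).
    apply: le_integral_EFin => y; first by nneg.
    have a1 : 0 <= 2 `^ (p - 1) * l `^ (p - 1) / h `^ p * (minr 1 `|N x - N y| `^ p * J (x, y)) by nneg.
    have a2 : 0 <= 2 `^ (p - 1) * ((10 <= N y)%R%:R * maxr 0 (- u y) `^ (p - 1) * J (x, y)) by nneg.
    have [Ny|Ny] := lerP (S + 2 * h) (N y); last by rewrite !mul0r addr_ge0.
    have hle : h <= minr 1 `|N x - N y| by rewrite le_min h1 /= ler0_norm; lra.
    have one : 1 <= minr 1 `|N x - N y| `^ p / h `^ p.
      rewrite ler_pdivlMr// mul1r.
      by apply: ler_wpowR; rewrite ?(ltW p0) ?(ltW h0)//; apply: le_trans hle; exact: ltW.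
    (* Within 10 the truncation is at most l since v >= 0; beyond, only the negative part of u adds
       to it, and dd <= l lets its tail be measured by l. *)
    have wle : maxr 0 (- v y - - l) <= l + (10 <= N y)%R%:R * maxr 0 (- u y).
      rewrite ge_max addr_ge0 ?(ltW l0)//=; last by nneg.
      have [Ny10|Ny10] := lerP 10 (N y).
        by rewrite mul1r; have : - u y <= maxr 0 (- u y) by [rewrite le_max lexx orbT]; move: dd0; lra.
      by rewrite mul0r; have := u0 Ny10; move: dd0; lra.
    rewrite mul1r; apply: (@le_trans _ _ (2 `^ (p - 1) * (l `^ (p - 1) +
        (10 <= N y)%R%:R * maxr 0 (- u y) `^ (p - 1)) * J (x, y))).
      rewrite ler_wpM2r//; apply: (@le_trans _ _ ((l + (10 <= N y)%R%:R * maxr 0 (- u y)) `^ (p - 1))).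
        by apply: ler_wpowR wle; [exact: ltW|nneg].
      apply: le_trans (powRD_le (ltW p10) (ltW l0) _) _; first by nneg.
      rewrite ler_wpM2l ?powR_ge0// lerD2l powRM; [|by nneg|by nneg].
      rewrite ler_wpM2r ?powR_ge0//; case: (10 <= N y); first by rewrite powR1.
      by rewrite powR0// gt_eqF.
    rewrite mulrDr mulrDl -[X in _ + X]mulrA; apply: lerD => //.
    have -> : 2 `^ (p - 1) * l `^ (p - 1) / h `^ p * (minr 1 `|N x - N y| `^ p * J (x, y)) =
      2 `^ (p - 1) * l `^ (p - 1) * J (x, y) * (minr 1 `|N x - N y| `^ p / h `^ p) by ring.
    by apply: ler_peMr => //; nneg.
  split_sum.
  pull_const.
  pull_const.
  have Nx10 : N x < 10 by lra.
  have Nx9 : N x < 9 by lra.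
  apply: (@le_trans _ _ ((2 `^ (p - 1) * l `^ (p - 1) / h `^ p * Lam)%:E +
     (2 `^ (p - 1) * (Lam * dd `^ (p - 1)))%:E)%E).
    by apply: leeD; apply: EFin_mul_le; [nneg|exact: (ns_upper sp)|nneg|exact: neg_tail].
  rewrite -EFinD lee_fin /inf_tail.
  have tE : 2 `^ p = 2 * 2 `^ (p - 1) :> R by rewrite (@powRS _ 2 p)// mulrC.
  have -> : 2 `^ p * Lam * 2 `^ (p - 1) / h ^+ Q * (l / 2) `^ (p - 1) =
     2 `^ (p - 1) * Lam * l `^ (p - 1) * (h ^+ Q)^-1 + 2 `^ (p - 1) * Lam * l `^ (p - 1) * (h ^+ Q)^-1.
    rewrite powRM ?(ltW l0)// powRV// tE; have : 0 < 2 `^ (p - 1) :> R by rewrite powR_gt0.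
    by move=> h2; field; rewrite !gt_eqF.
  apply: lerD.
    have -> : 2 `^ (p - 1) * l `^ (p - 1) / h `^ p * Lam = 2 `^ (p - 1) * Lam * l `^ (p - 1) * (h `^ p)^-1 by ring.
    by apply: ler_wpM2l => //; nneg.
  rewrite mulrA -[leRHS]mulrA; apply: ler_wpM2l; first by nneg.
  apply: (@le_trans _ _ (l `^ (p - 1))); last by apply: ler_peMr => //; exact: ltW.
  by apply: ler_wpowR; rewrite ?(ltW p10) ?(ltW dd0) ?(ltW l0).
have lp0 : 0 < l `^ p by rewrite powR_gt0.
apply: (@le_trans _ _ (\int[mu]_x (l `^ p * l `^ (p - 1) * ((N x < 7)%R%:R * (v x `^ (p - 1))^-1))%:E)%E).
  apply: le_integral_EFin => x; first by nneg.
  have [Nx|Nx] := ltrP (N x) (1 + 1); last by rewrite mul0r; nneg.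
  have -> : (N x < 7) = true by lra.
  have vx : 0 < v x by apply: v_gt0; lra.
  rewrite !mul1r; have [vl|vl] := lerP l (v x).
    by rewrite (max_idPl _) ?powR0//; [nneg|lra].
  have -> : maxr 0 (- v x - - l) = l - v x by rewrite (max_idPr _); lra.
  have vp : 0 < v x `^ (p - 1) by rewrite powR_gt0.
  rewrite -mulrA; apply: (@le_trans _ _ (l `^ p)).
    by apply: ler_wpowR; rewrite ?(ltW p0) ?(ltW l0)//; lra.
  apply: ler_peMr; first exact: ltW.
  rewrite ler_pdivlMr// mul1r.
  by apply: ler_wpowR; rewrite ?(ltW p10) ?(ltW l0) ?(ltW vx) ?(ltW vl).
pull_const.
have im : (inv_mass <= (a2_bound p Lam m * V ^+ 2 / M)%:E)%E.
  have := a2_estimate p1 pm Lam0 sp mU u0 dd0 weak neg_tail; rewrite massM.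
  rewrite -lee_pdivlMr// -?EFinM//.
apply: le_trans (EFin_mul_le _ im) _; first by nneg.
rewrite lee_fin expr1n mulr1 powRM ?(ltW l0)// powRV//.
have -> : l `^ p * l `^ (p - 1) * (a2_bound p Lam m * V ^+ 2 / M) =
  (a2_bound p Lam m * l `^ (p - 1) * V) * (l `^ p * V / M) by ring.
apply: (@le_trans _ _ ((dg_const p Lam kap inf_tail Q nn m D / 2 `^ p * M) * (l `^ p * V / M))).
  by apply: ler_wpM2r => //; nneg.
apply: le_of_eq.
have : 0 < 2 `^ p :> R by rewrite powR_gt0.
by move=> h2; field; rewrite !gt_eqF.
Qed.

Local Notation dgc := (dg_const p Lam kap (tail_bound p Lam m) Q nn m D).

Let dgc0 : 0 < dgc. Proof. exact: dg_const_gt0. Qed.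

Lemma upper_bound M rho H K : 0 < M -> mass = M%:E ->
  1 <= rho -> 0 < H -> H <= 1 -> rho + H <= 7 -> 0 < K -> M / V <= K `^ (p - 1) ->
  (\int[mu]_x ((N x < rho + H)%R%:R * v x `^ p)%:E <= (dgc * H ^+ D * K `^ p * V)%:E)%E ->
  {ae mu, forall x, N x < rho -> v x <= K}.
Proof.
move=> M0 massM rho1 H0 H1 rH K0 MK hE.
have mf : measurable_fun setT (fun x => v x) by mfun.
have dg := @de_giorgi _ p Lam kap (tail_bound p Lam m) Q nn m D p1 pm Lam0 kap0
  sup_tail0 Dnn DA _ _ _ _ _ _ _ sp mf weak_trunc_sup rho H K 0 rho1 H0 H1 rH K0.
suff : {ae mu, forall x, N x < rho -> v x <= 0 + K}.
  by apply: filterS => x + Nx => /(_ Nx); rewrite add0r.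
apply: dg => [S h x rS h0 h1 Sh Nx|].
  have S7 : S + 2 * h <= 7 by apply: le_trans rH.
  under eq_integral do rewrite subr0.
  apply: le_trans (upper_tail p1 pm Lam0 mQ sp mU u0 dd0 weak neg_tail M0 massM h0 h1 S7 Nx) _.
  rewrite lee_fin; apply: ler_wpM2l => //.
  have hQ0 : 0 <= h ^+ Q by rewrite exprn_ge0// ltW.
  by rewrite divr_ge0// ltW.
apply: le_trans hE; apply: le_integral_EFin => x; first by nneg.
rewrite subr0; have [Nx|Nx] := ltrP (N x) (rho + H); last by rewrite !mul0r.
have vx : 0 < v x by apply: v_gt0; lra.
by rewrite (max_idPr (ltW vx)).
Qed.

(** Purely qualitative: S depends on the L^p norm of v. It only gives the interpolation a finite
    starting value, whose contribution later tends to 0. *)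
Lemma upper_bound_finite M : 0 < M -> mass = M%:E ->
  exists2 S, 0 < S & {ae mu, forall x, N x < 2 -> v x <= S}.
Proof.
move=> M0 massM; pose E := fine (\int[mu]_x ((N x < 9)%R%:R * v x `^ p)%:E)%E.
have E0 : 0 <= E by rewrite fine_ge0// integral_EFin_ge0//; nneg.
pose K1 := (M / V) `^ (p - 1)^-1; pose K2 := (E / (dgc * V)) `^ p^-1.
have K10 : 0 < K1 by rewrite powR_gt0// divr_gt0.
have K20 : 0 <= K2 by exact: powR_ge0.
have K12 : 0 < K1 + K2 by rewrite ltr_pwDl.
exists (K1 + K2) => //.
have le7 : 2 + 1 <= 7 :> R by lra.
have le2 : 1 <= 2 :> R by lra.
apply: (upper_bound M0 massM le2 ltr01 (lexx _) le7 K12).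
  have <- : K1 `^ (p - 1) = M / V.
    by rewrite /K1 -powRrM mulVf ?powRr1 ?gt_eqF// divr_ge0 ?ltW.
  by apply: ler_wpowR; rewrite ?(ltW p10) ?(ltW K10) ?(ltW K12)// lerDl.
apply: (@le_trans _ _ (\int[mu]_x ((N x < 9)%R%:R * v x `^ p)%:E)%E).
  apply: le_integral_EFin => x; first by nneg.
  rewrite ler_wpM2r ?powR_ge0// ler_nat; have [Nx|Nx] := ltrP (N x) (2 + 1) => //.
  by have -> : (N x < 9) = true by lra.
rewrite -[leLHS]fineK; last first.
  by rewrite ge0_fin_numE// integral_EFin_ge0//; nneg.
rewrite lee_fin -/E expr1n mulr1.
apply: (@le_trans _ _ (dgc * K2 `^ p * V)).
  have -> : K2 `^ p = E / (dgc * V).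
    rewrite /K2 -powRrM mulVf// powRr1// divr_ge0// mulr_ge0 ?(ltW dgc0) ?(ltW V0)//.
  apply: le_of_eq; field.
  by rewrite !gt_eqF.
apply: ler_wpM2r; first exact: ltW.
apply: ler_wpM2l; first exact: ltW.
by apply: ler_wpowR; rewrite ?(ltW p0) ?(ltW K12)// lerDr ltW.
Qed.

Variable G : nat.
Hypothesis DG : D%:R <= G%:R * (p - 1).

(** With 2^G lost per step, eps 2^G = 1/2 makes the accumulated error a geometric sum, and
    [sup_const] is its fixed point. [A] is large enough for A^(p-1) to compensate [eps] and the
    smallness of the De Giorgi constant. *)
Let eps : R := (2 ^+ G.+1)^-1.
Let A : R := 1 + (dgc * eps)^-1 `^ (p - 1)^-1.
Definition sup_const : R := 2 ^+ G.+1 * A.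

Let eps0 : 0 < eps. Proof. by rewrite invr_gt0 exprn_gt0. Qed.
Let A0 : 0 < A. Proof. by rewrite ltr_pwDl// powR_ge0. Qed.

Let A1 : (dgc * eps)^-1 <= A `^ (p - 1).
Proof.
have e0 : 0 <= (dgc * eps)^-1 by rewrite invr_ge0 mulr_ge0 ?(ltW dgc0) ?(ltW eps0).
have {1}<- : ((dgc * eps)^-1 `^ (p - 1)^-1) `^ (p - 1) = (dgc * eps)^-1.
  by rewrite -powRrM mulVf ?powRr1// gt_eqF.
apply: ler_wpowR; rewrite ?(ltW p10) ?powR_ge0 ?(ltW A0)//.
by rewrite /A lerDr.
Qed.

(** Interpolation: v <= S turns the L^p energy into S times the (p-1)-mass. Splitting K^p as K^(p-1)
    K, the first factor pays for the mean and for the gap 2^-(i+1) through [DG], the second is at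
    least eps S. *)
Lemma upper_bound_improve M k S i : 0 < M -> mass = M%:E -> 0 < k ->
  k `^ (p - 1) = M / V -> 0 < S ->
  {ae mu, forall x, N x < 2 - 2^-1 ^+ i.+1 -> v x <= S} ->
  {ae mu, forall x, N x < 2 - 2^-1 ^+ i -> v x <= eps * S + A * 2 ^+ (G * i.+1) * k}.
Proof.
move=> M0 massM k0 kE S0 vS; set K := eps * S + _.
have A2 : 0 < A * 2 ^+ (G * i.+1) by rewrite mulr_gt0// exprn_gt0.
have A2k : 0 < A * 2 ^+ (G * i.+1) * k by rewrite mulr_gt0.
have eS : 0 < eps * S by rewrite mulr_gt0.
have K0 : 0 < K by rewrite addr_gt0.
have /andP[h0 h1] : 0 < (2^-1 : R) ^+ i <= 1.
  by rewrite exprn_gt0//= exprn_ile1// invf_le1// ler1n.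
have hE : (2^-1 : R) ^+ i.+1 = 2^-1 ^+ i / 2 by rewrite exprS mulrC.
have H0 : 0 < (2^-1 : R) ^+ i.+1 by rewrite exprn_gt0.
have RE : 2 - 2^-1 ^+ i + 2^-1 ^+ i.+1 = 2 - 2^-1 ^+ i.+1 :> R by rewrite hE; field.
have R1 : 1 <= 2 - 2^-1 ^+ i :> R by lra.
have H1 : (2^-1 : R) ^+ i.+1 <= 1 by rewrite hE; lra.
have R7 : 2 - 2^-1 ^+ i + 2^-1 ^+ i.+1 <= 7 :> R by rewrite RE; lra.
have AK : A * 2 ^+ (G * i.+1) * k <= K by rewrite lerDr ltW.
have A21 : 1 <= A * 2 ^+ (G * i.+1).
  have a1 : 1 <= A by rewrite lerDl powR_ge0.
  have a2 : 1 <= 2 ^+ (G * i.+1) :> R by rewrite exprn_ege1// ler1n.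
  exact: mulr_ege1.
apply: (upper_bound M0 massM R1 H0 H1 R7 K0).
  rewrite -kE; apply: ler_wpowR; rewrite ?(ltW p10) ?(ltW k0) ?(ltW K0)//.
  by apply: le_trans AK; apply: ler_peMl => //; exact: ltW.
rewrite RE; apply: (@le_trans _ _ (\int[mu]_x (S * ((N x < 7)%R%:R * v x `^ (p - 1)))%:E)%E).
  apply: ae_le_integral_inner.
  - by move=> x; rewrite lee_fin; nneg.
  - by move=> x; rewrite lee_fin; nneg.
  apply: filterS vS => x vS; rewrite lee_fin.
  have [Nx|Nx] := ltrP (N x) (2 - 2^-1 ^+ i.+1); last by rewrite mul0r; nneg.
  have -> : (N x < 7) = true by lra.
  have vx : 0 < v x by apply: v_gt0; lra.
  rewrite !mul1r (@powRS _ (v x)) ?(ltW vx)// mulrC ler_wpM2r ?powR_ge0//.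
  exact: vS.
rewrite integral_EFinZ; [|exact: ltW|by mfun|by nneg].
rewrite massM -EFinM lee_fin.
have -> : S * M = S * k `^ (p - 1) * V by rewrite kE; field; rewrite gt_eqF.
apply: ler_wpM2r; first exact: ltW.
rewrite (@powRS _ K) ?(ltW K0)//.
have HD : (2^-1 : R) ^+ i.+1 ^+ D = (2 ^+ (D * i.+1))^-1 by rewrite -exprM mulnC exprVn.
have P1 : (A * 2 ^+ (G * i.+1) * k) `^ (p - 1) <= K `^ (p - 1).
  by apply: ler_wpowR; rewrite ?(ltW p10) ?(ltW A2k) ?(ltW K0).
have P2 : 2 ^+ (D * i.+1) <= (2 ^+ (G * i.+1)) `^ (p - 1) :> R.
  rewrite -(@powR_mulrn _ 2 (D * i.+1))// -(@powR_mulrn _ 2 (G * i.+1))// -powRrM.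
  by apply: ler_powR; rewrite ?ler1n// !natrM mulrAC ler_wpM2r.
have P3 : (dgc * eps)^-1 * 2 ^+ (D * i.+1) * k `^ (p - 1) <= K `^ (p - 1).
  apply: le_trans P1; rewrite powRM ?(ltW k0) ?(ltW A2)// ler_wpM2r ?powR_ge0//.
  rewrite powRM ?(ltW A0) ?exprn_ge0//; apply: ler_pM => //.
  by rewrite invr_ge0 mulr_ge0 ?(ltW dgc0) ?(ltW eps0).
rewrite HD; have D0 : 0 < 2 ^+ (D * i.+1) :> R by rewrite exprn_gt0.
have -> : S * k `^ (p - 1) = dgc * (2 ^+ (D * i.+1))^-1 *
   ((dgc * eps)^-1 * 2 ^+ (D * i.+1) * k `^ (p - 1) * (eps * S)).
  by field; rewrite !gt_eqF.
apply: ler_wpM2l; first by rewrite mulr_ge0 ?invr_ge0 ?(ltW dgc0) ?(ltW D0).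
apply: ler_pM => //; [|exact: ltW|by rewrite lerDl ltW].
by nneg.
Qed.

(** For each n, start inside radius 2 at 2 - 2^-n and apply the improvement n times, ending at
    radius 1. The starting bound survives with weight eps^n only, and n is arbitrary. *)
Lemma upper_bound_mean M k : 0 < M -> mass = M%:E -> 0 < k -> k `^ (p - 1) = M / V ->
  {ae mu, forall x, N x < 1 -> v x <= sup_const * k}.
Proof.
move=> M0 massM k0 kE; have [S S0 vS] := upper_bound_finite M0 massM.
have sc0 : 0 < sup_const by rewrite mulr_gt0// exprn_gt0.
have step n i : (i <= n)%N -> {ae mu, forall x, N x < 2 - 2^-1 ^+ (n - i) ->
    v x <= eps ^+ i * S + sup_const * 2 ^+ (G * (n - i)) * k}.
  elim: i => [_|i IH ni].
    apply: filterS vS => x vS Nx; rewrite expr0 mul1r.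
    apply: (@le_trans _ _ S); last by rewrite lerDl mulr_ge0 ?(ltW k0)// mulr_ge0 ?exprn_ge0 ?(ltW sc0).
    by apply: vS; apply: lt_le_trans Nx _; rewrite gerBl exprn_ge0.
  have e : (n - i = (n - i.+1).+1)%N by rewrite -subSn// subSS.
  have := IH (ltnW ni); rewrite e => /(upper_bound_improve M0 massM k0 kE).
  have S'0 : 0 < eps ^+ i * S + sup_const * 2 ^+ (G * (n - i.+1).+1) * k.
    rewrite addr_gt0//; first by rewrite mulr_gt0// exprn_gt0.
    by rewrite !mulr_gt0// exprn_gt0.
  move=> /(_ S'0); apply: filterS => x + Nx => /(_ Nx) /le_trans; apply.
  set j := (n - i.+1)%N; rewrite mulrDr mulrA -exprS -addrA lerD2l.
  rewrite /sup_const mulnS exprD; apply: le_of_eq.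
  rewrite /eps !exprS; field.
  by rewrite gt_eqF// exprn_gt0.
have all_n n : {ae mu, forall x, N x < 1 -> v x <= eps ^+ n * S + sup_const * k}.
  have := step n n (leqnn n); rewrite subnn muln0 !expr0 mulr1.
  by apply: filterS => x + Nx; apply; lra.
have : {ae mu, forall x n, N x < 1 -> v x <= eps ^+ n * S + sup_const * k}.
  exact: ae_foralln.
apply: filterS => x H Nx; apply/ler_addgt0Pr => e e0.
have : eps ^+ n * S @[n --> \oo] --> 0.
  rewrite -[X in _ --> X](mul0r S); apply: cvgM; last exact: cvg_cst.
  apply: cvg_expr; rewrite gtr0_norm// /eps invf_lt1 ?exprn_gt0//.
  by rewrite exprn_egt1// ltr1n.
move=> /cvgrPdist_lt/(_ e e0)[n _ /(_ n (leqnn n))]; rewrite sub0r normrN => He.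
apply: le_trans (H n Nx) _; rewrite addrC lerD2l ltW//.
by apply: le_lt_trans He; rewrite ler_norm.
Qed.

End bounds.

(** The constants are chosen before the space, the kernel and the solution: this order of
    quantifiers is what makes the final constant depend on the structural data alone. *)
Lemma harnack_mean : exists c1 c2, [/\ 0 < c1, 0 < c2 &
  forall d (T : measurableType d) (mu : {sigma_finite_measure set T -> \bar R})
    (V : R) (N : T -> R) (J : T * T -> R) (u : T -> R) (dd : R),
  nonlocal_space p Lam kap Q nn mu V N J -> measurable_fun setT u ->
  (forall x, N x < 10 -> 0 <= u x) -> 0 < dd ->
  weak_form p m mu N J u ->
  (forall x, N x < 9 ->
    (\int[mu]_y ((10 <= N y)%R%:R * maxr 0 (- u y) `^ (p - 1) * J (x, y))%:E <=
     (Lam * dd `^ (p - 1))%:E)%E) ->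
  (\int[mu]_x ((N x < 9)%R%:R * (u x + dd) `^ p)%:E < +oo)%E ->
  exists2 k, 0 < k & {ae mu, forall x, N x < 1 -> c1 * k <= u x + dd <= c2 * k}].
Proof.
pose G := (Num.truncn (D%:R / (p - 1))).+1.
have DG : D%:R <= G%:R * (p - 1).
  by rewrite -ler_pdivrMr// ltW// truncnS_gt.
have dgi0 : 0 < dg_const p Lam kap inf_tail Q nn m D by exact: dg_const_gt0.
have a20 : 0 < a2_bound p Lam m by exact: a2_bound_gt0.
(* The largest ratio of l to the mean for which the smallness assumption of [lower_bound] holds; it
   holds with equality. *)
pose del := (dg_const p Lam kap inf_tail Q nn m D / (2 `^ p * a2_bound p Lam m)) `^ (p - 1)^-1.
have del0 : 0 < del by rewrite powR_gt0// divr_gt0// mulr_gt0// powR_gt0.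
have dgc0 : 0 < dg_const p Lam kap (tail_bound p Lam m) Q nn m D by exact: dg_const_gt0.
exists (del / 2), (sup_const G); split; first by rewrite divr_gt0.
  by rewrite mulr_gt0 ?exprn_gt0// ltr_pwDl// powR_ge0.
move=> d T mu V N J u dd sp mU u0 dd0 weak neg_tail fin.
have mN := ns_mN sp; have V0 := ns_V sp.
have v0 x : N x < 10 -> dd <= u x + dd by move=> /u0 h; rewrite lerDr.
pose M := fine (\int[mu]_x ((N x < 7)%R%:R * (u x + dd) `^ (p - 1))%:E)%E.
have massM : (\int[mu]_x ((N x < 7)%R%:R * (u x + dd) `^ (p - 1))%:E = M%:E)%E.
  apply/esym/fineK; rewrite ge0_fin_numE; last by apply: integral_EFin_ge0; nneg.
  apply: (@le_lt_trans _ _ (\int[mu]_x ((N x < 7)%R%:R + (N x < 9)%R%:R * (u x + dd) `^ p)%:E)%E).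
    apply: le_integral_EFin => x; first by nneg.
    have [Nx|Nx] := ltrP (N x) 7; last by rewrite mul0r; nneg.
    have -> : (N x < 9) = true by lra.
    have vx : 0 < u x + dd by apply: lt_le_trans (v0 x _) => //; lra.
    rewrite !mul1r; have [v1|v1] := lerP (u x + dd) 1.
      rewrite -[leLHS]addr0; apply: lerD; last exact: powR_ge0.
      by apply: powR_le1; rewrite ?(ltW vx) ?(ltW p10).
    apply: (@le_trans _ _ ((u x + dd) `^ p)); last by rewrite lerDr.
    by apply: ler_powR; [exact: ltW|rewrite gerBl].
  split_sum.
  rewrite lte_add_pinfty//.
  rewrite integral_lt_indic//; apply: (@le_lt_trans _ _ (mu [set x | N x < 10])).
    have mset c : measurable [set x | N x < c].
      rewrite -[X in measurable X]setTI.
      by apply: (measurable_fun_ltr mN (measurable_cst c)) => //=; exact: (@measurableT _ bool).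
    by apply: le_measure; rewrite ?inE//; move=> x /=; lra.
  by apply: le_lt_trans (ns_ball10 sp) _; rewrite ltry.
have M0 : 0 < M.
  rewrite -lte_fin -massM.
  apply: (@lt_le_trans _ _ ((dd `^ (p - 1))%:E * (V / Lam)%:E)%E).
    by rewrite -EFinM lte_fin mulr_gt0 ?powR_gt0 ?divr_gt0.
  apply: (@le_trans _ _ (\int[mu]_x (dd `^ (p - 1) * (N x < 1)%R%:R)%:E)%E).
    pull_const.
    apply: lee_pmul; [by rewrite lee_fin; nneg|by rewrite lee_fin; nneg|exact: lexx|].
    by rewrite integral_lt_indic//; exact: (ns_ball1 sp).
  apply: le_integral_EFin => x; first by nneg.
  have [Nx|Nx] := ltrP (N x) 1; last by rewrite mulr0; nneg.
  have -> : (N x < 7) = true by lra.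
  have vx : dd <= u x + dd by apply: v0; lra.
  by rewrite mul1r mulr1; apply: ler_wpowR; rewrite ?(ltW p10) ?(ltW dd0).
pose k := (M / V) `^ (p - 1)^-1.
have k0 : 0 < k by rewrite powR_gt0// divr_gt0.
have kE : k `^ (p - 1) = M / V.
  by rewrite /k -powRrM mulVf ?powRr1 ?gt_eqF// divr_ge0 ?ltW.
have dk0 : 0 < del * k by rewrite mulr_gt0.
exists k => //.
have up := upper_bound_mean sp mU u0 dd0 weak neg_tail fin DG M0 massM k0 kE.
have low : {ae mu, forall x, N x < 1 -> del * k / 2 <= u x + dd}.
  (* If the shift already exceeds [del * k], the lower bound follows from v >= dd. *)
  have [ddk|ddk] := lerP dd (del * k); last first.
    apply: aeW => x Nx; have : dd <= u x + dd by apply: v0; lra.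
    by move: ddk dk0; lra.
  apply: (lower_bound sp mU u0 dd0 weak neg_tail M0 massM dk0 ddk).
  rewrite powRM ?(ltW del0) ?(ltW k0)// kE.
  have -> : del `^ (p - 1) = dg_const p Lam kap inf_tail Q nn m D / (2 `^ p * a2_bound p Lam m).
    rewrite /del -powRrM mulVf ?powRr1 ?gt_eqF// divr_ge0 ?(ltW dgi0)// mulr_ge0 ?powR_ge0//.
    exact: ltW.
  have h2 : 0 < 2 `^ p :> R by rewrite powR_gt0.
  apply: le_of_eq; field.
  by rewrite !gt_eqF.
apply: filterS2 up low => x up low Nx; rewrite up// andbT.
by have := low Nx; lra.
Qed.

End harnack_bounds.

(** * Rescaled kernels on Euclidean space *)

Section euclidean_norm.
Context {R : realType} (n : nat).
Implicit Types (x y z : 'rV[R]_n).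

Let sqs x := \sum_(i < n) x ord0 i ^+ 2.

Let sqs_ge0 x : 0 <= sqs x.
Proof. by apply: sumr_ge0 => i _; exact: sqr_ge0. Qed.

Lemma enorm_ge0 x : 0 <= enorm x. Proof. exact: sqrtr_ge0. Qed.

Lemma enorm_sqr x : enorm x ^+ 2 = \sum_(i < n) x ord0 i ^+ 2.
Proof. by rewrite /enorm sqr_sqrtr// sqs_ge0. Qed.

Lemma enorm0 : enorm (0 : 'rV[R]_n) = 0.
Proof. by rewrite /enorm big1 ?sqrtr0// => i _; rewrite mxE expr0n. Qed.

Lemma enorm_coord x i : `|x ord0 i| <= enorm x.
Proof.
rewrite -(@ler_pXn2r _ 2)// ?nnegrE ?enorm_ge0//.
rewrite enorm_sqr real_normK ?num_real// (bigD1 i)//= lerDl.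
by apply: sumr_ge0 => j _; exact: sqr_ge0.
Qed.

Lemma enorm_eq0 x : (enorm x == 0) = (x == 0).
Proof.
apply/eqP/eqP => [x0|->]; last exact: enorm0.
apply/rowP => i; rewrite mxE; apply/eqP; rewrite -normr_le0.
by apply: le_trans (enorm_coord x i) _; rewrite x0.
Qed.

Lemma enormN x : enorm (- x) = enorm x.
Proof. by rewrite /enorm; congr Num.sqrt; apply: eq_bigr => i _; rewrite mxE sqrrN. Qed.

Lemma enormBC x y : enorm (x - y) = enorm (y - x).
Proof. by rewrite -enormN opprB. Qed.

Lemma enorm_le_max x (M : R) : (forall i, `|x ord0 i| <= M) -> 0 <= M -> enorm x <= n%:R * M.
Proof.
move=> xM M0; rewrite -(@ler_pXn2r _ 2)// ?nnegrE ?enorm_ge0 ?mulr_ge0//.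
rewrite enorm_sqr; apply: (@le_trans _ _ (\sum_(i < n) M ^+ 2)).
  by apply: ler_sum => i _; rewrite -real_normK ?num_real// lerXn2r// nnegrE.
rewrite sumr_const card_ord -[leLHS]mulr_natl exprMn ler_wpM2r ?sqr_ge0//.
by rewrite -natrX ler_nat; case: n => // n'; rewrite expnS expn1 leq_pmulr.
Qed.

Lemma enorm_triangle x y : enorm (x + y) <= enorm x + enorm y.
Proof.
have [x0|x0] := eqVneq (enorm x) 0.
  by move/eqP: x0; rewrite enorm_eq0 => /eqP ->; rewrite add0r enorm0 add0r.
have [y0|y0] := eqVneq (enorm y) 0.
  by move/eqP: y0; rewrite enorm_eq0 => /eqP ->; rewrite addr0 enorm0 addr0.
have px : 0 < enorm x by rewrite lt_def x0 enorm_ge0.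
have py : 0 < enorm y by rewrite lt_def y0 enorm_ge0.
rewrite -(@ler_pXn2r _ 2)// ?nnegrE ?enorm_ge0 ?addr_ge0 ?enorm_ge0//.
set a := enorm x in px *; set b := enorm y in py *.
(* Weighting each coordinate by the ratio of the norms reduces the inequality to one coordinate,
   where the difference is a square over [a * b]. *)
have -> : (a + b) ^+ 2 = \sum_(i < n) ((1 + b / a) * x ord0 i ^+ 2 + (1 + a / b) * y ord0 i ^+ 2).
  rewrite big_split/= -!mulr_sumr -!enorm_sqr -/a -/b; field.
  by rewrite !gt_eqF.
rewrite enorm_sqr; apply: ler_sum => i _; rewrite mxE -subr_ge0.
set s := x ord0 i; set t := y ord0 i.
have -> : (1 + b / a) * s ^+ 2 + (1 + a / b) * t ^+ 2 - (s + t) ^+ 2 = (b * s - a * t) ^+ 2 / (a * b).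
  by field; rewrite !gt_eqF.
by rewrite divr_ge0 ?sqr_ge0// mulr_ge0// ltW.
Qed.

Lemma enorm_triangle3 x y z : enorm (x - z) <= enorm (x - y) + enorm (y - z).
Proof. by apply: le_trans (enorm_triangle _ _); rewrite addrA subrK. Qed.

Lemma measurable_enorm d (T : measurableType d) (f g : T -> 'rV[R]_n) :
  measurable_fun setT f -> measurable_fun setT g ->
  measurable_fun setT (fun t => enorm (f t - g t)).
Proof.
move=> mf mg; apply: (@measurableT_comp _ _ _ _ _ _ (@Num.sqrt R)).
  apply: (eq_measurable_fun (fun x : R => (maxr 0 x) `^ 2^-1)).
    move=> x _; rewrite powR12_sqrt ?le_max ?lexx//.
    by have [x0|x0] := leP 0 x => //; rewrite sqrtr0 ler0_sqrtr// ltW.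
  by mfun; apply: measurable_maxr.
apply: (eq_measurable_fun (fun t => \sum_(i < n) (f t ord0 i - g t ord0 i) ^+ 2)).
  by move=> t _; apply: eq_bigr => i _; rewrite !mxE.
apply: measurable_sum => i; apply: measurable_funX; apply: measurable_funB.
  exact: (measurableT_comp (measurable_coord_rV i) mf).
exact: (measurableT_comp (measurable_coord_rV i) mg).
Qed.

Let box (c : 'rV[R]_n) (rho : R) := [set x : 'rV[R]_n | forall i, `|x ord0 i - c ord0 i| < rho].

Let box_measure (c : 'rV[R]_n) (rho : R) : 0 <= rho ->
  lebesgue_rV n (box c rho) = ((2 * rho) ^+ n)%:E.
Proof.
move=> r0.
have -> : (box c rho) =
    [set x | forall i, `]c ord0 i - rho, c ord0 i + rho[%classic (x ord0 i)].
  apply/seteqP; split=> x H i; have := H i; rewrite /= in_itv /= ltr_distl//.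
rewrite (@lebesgue_rV_box R n (fun i => `]c ord0 i - rho, c ord0 i + rho[%classic)) => [|i];
  last exact: measurable_itv.
rewrite (eq_bigr (fun=> (2 * rho)%:E)).
  by rewrite prodEFin prodr_const card_ord.
move=> i _; rewrite lebesgue_measure_itv /= lte_fin.
case: ifPn => h; first by rewrite -EFinB; congr (_%:E); ring.
have -> : rho = 0 by apply/eqP; rewrite eq_le r0 andbT; move: h; rewrite -leNgt; lra.
by rewrite mulr0.
Qed.

Lemma measurable_eball (c : 'rV[R]_n) (rho : R) : measurable (eball c rho).
Proof.
rewrite -[X in measurable X]setTI.
have m1 : measurable_fun setT (fun x : 'rV[R]_n => enorm (x - c)).
  by apply: measurable_enorm => //; exact: measurable_cst.
by apply: (measurable_fun_ltr m1 (measurable_cst rho)) => //=; exact: (@measurableT _ bool).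
Qed.

Let measurable_box (c : 'rV[R]_n) (rho : R) :
  measurable (box c rho).
Proof.
have -> : (box c rho) =
    \big[setI/setT]_(i < n) [set x : 'rV[R]_n | `|x ord0 i - c ord0 i| < rho].
  rewrite -bigcap_seq; apply/seteqP; split => [x Bx i _|x Bx i]; first exact: Bx.
  exact: (Bx i (mem_index_enum i)).
apply: bigsetI_measurable => i _; rewrite -[X in measurable X]setTI.
have mi : measurable_fun setT (fun x : 'rV[R]_n => `|x ord0 i - c ord0 i|).
  by have mc := @measurable_coord_rV R n i; mfun.
by apply: (measurable_fun_ltr mi (measurable_cst rho)) => //=; exact: (@measurableT _ bool).
Qed.

Lemma eball_measure_le (c : 'rV[R]_n) (rho : R) : 0 <= rho ->
  (lebesgue_rV n (eball c rho) <= ((2 * rho) ^+ n)%:E)%E.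
Proof.
move=> r0; rewrite -(box_measure c r0).
apply: le_measure; [apply/mem_set; exact: measurable_eball|apply/mem_set; exact: measurable_box|].
move=> x /= xc i; apply: le_lt_trans xc; have := enorm_coord (x - c) i.
by rewrite !mxE.
Qed.

Lemma eball_measure_ge (c : 'rV[R]_n) (rho : R) : (0 < n)%N -> 0 < rho ->
  (((rho / n%:R) ^+ n)%:E <= lebesgue_rV n (eball c rho))%E.
Proof.
move=> n0 r0; have n0' : 0 < n%:R :> R by rewrite ltr0n.
have s0 : 0 <= rho / (2 * n%:R) by rewrite divr_ge0 ?mulr_ge0 ?(ltW r0).
have -> : rho / n%:R = 2 * (rho / (2 * n%:R)) by field; rewrite gt_eqF.
rewrite -(box_measure c s0).
apply: le_measure; [apply/mem_set; exact: measurable_box|apply/mem_set; exact: measurable_eball|].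
move=> x /= xc; rewrite /eball /=.
apply: (@le_lt_trans _ _ (n%:R * (rho / (2 * n%:R)))).
  by apply: enorm_le_max => // i; rewrite !mxE; exact: ltW (xc i).
have -> : n%:R * (rho / (2 * n%:R)) = rho / 2 by field; rewrite gt_eqF.
lra.
Qed.

End euclidean_norm.

(** * Integrability of the majorant of the rescaled kernel *)

Section radial_integral.
Context {R : realType} (n : nat).
Local Notation mu := (@lebesgue_rV R n).
Variable gam : R.
Hypothesis gam0 : 0 < gam.

(* The diagonal is a null set; giving it the value [r] keeps [dist] positive. *)
Definition dist (r : R) (x y : 'rV[R]_n) : R :=
  if enorm (x - y) == 0 then r else enorm (x - y).

(** Better than q^-n by the power [gam] at both ends, hence integrable near 0 and at infinity. *)
Definition profile (q : R) : R := (q ^+ n)^-1 * minr q q^-1 `^ gam.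

Lemma dist_gt0 r x y : 0 < r -> 0 < dist r x y.
Proof. by rewrite /dist => r0; case: eqP => // /eqP e; rewrite lt_def e enorm_ge0. Qed.

Lemma enorm_le_dist r x y : 0 < r -> enorm (x - y) <= dist r x y.
Proof. by rewrite /dist => r0; case: eqP => [->|//]; exact: ltW. Qed.

Lemma distC r x y : dist r x y = dist r y x.
Proof. by rewrite /dist enormBC. Qed.

Lemma measurable_dist r : measurable_fun setT (fun z : 'rV[R]_n * 'rV[R]_n => dist r z.1 z.2).
Proof.
have me : measurable_fun setT (fun z : 'rV[R]_n * 'rV[R]_n => enorm (z.1 - z.2)).
  by apply: measurable_enorm; [exact: measurable_fst|exact: measurable_snd].
apply: (eq_measurable_fun (fun z : 'rV[R]_n * 'rV[R]_n =>
    r + (0 < enorm (z.1 - z.2))%R%:R * (enorm (z.1 - z.2) - r))).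
  move=> z _; rewrite /dist lt_def enorm_ge0 andbT; case: eqP => [->|_] /=.
    by rewrite mul0r addr0.
  by rewrite mul1r addrC subrK.
mfun; exact: (measurable_lt_indic (measurable_cst 0) me).
Qed.

Lemma measurable_dist2 r x : measurable_fun setT (fun y => dist r x y).
Proof. exact: (measurableT_comp (measurable_dist r) (pair1_measurable x)). Qed.

Lemma dyadic (w : R) : 1 <= w -> exists k : nat, 2 ^+ k <= w < 2 ^+ k.+1.
Proof.
move=> w1; have ex : exists k : nat, w < 2 ^+ k.
  exists (Num.truncn w).+1; apply: lt_trans (truncnS_gt w) _.
  by rewrite -natrX ltr_nat ltn_expl.
have [[|k] wk kmin] := ex_minnP ex; first by move: wk; rewrite expr0; lra.
exists k; rewrite wk andbT leNgt; apply/negP => /kmin.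
by rewrite ltnn.
Qed.

Let rho : R := (2 `^ gam)^-1.

Let rho0 : 0 < rho. Proof. by rewrite invr_gt0 powR_gt0. Qed.

Let rho1 : rho < 1.
Proof.
rewrite invf_lt1 ?powR_gt0//.
apply: (@le_lt_trans _ _ (1 `^ gam)); first by rewrite powR1.
by apply: gt0_ltr_powR; rewrite ?nnegrE ?ltr1n.
Qed.

Let rhoX k : ((2 ^+ k)^-1) `^ gam = rho ^+ k.
Proof.
rewrite powRV ?exprn_ge0// -(@powR_mulrn _ 2 k)// powRAC powR_mulrn ?powR_ge0//.
by rewrite exprVn.
Qed.

Let A k : R := ((2 ^+ k) ^+ n)^-1 * rho ^+ k.
Let B k : R := (2 ^+ k.+1) ^+ n * rho ^+ k.
(** The first term majorises [profile] at distances between 2^k r and 2^(k+1) r, the second between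
    2^-(k+1) r and 2^-k r. Balls replace annuli: their measure times the height is already of order
    rho^k. *)
Let shell (r : R) (x : 'rV[R]_n) k (y : 'rV[R]_n) : R :=
  A k * (enorm (y - x) < 2 ^+ k.+1 * r)%R%:R +
  B k * (enorm (y - x) < 2 * (2 ^+ k)^-1 * r)%R%:R.

Let A0 k : 0 <= A k. Proof. by rewrite /A; nneg. Qed.
Let B0 k : 0 <= B k. Proof. by rewrite /B; nneg. Qed.
Let shell0 r x k y : 0 <= shell r x k y. Proof. by rewrite /shell; nneg. Qed.

Let shell_ub r x y : 0 < r -> exists k, profile (dist r x y / r) <= shell r x k y.
Proof.
move=> r0; have d0 := dist_gt0 x y r0; have ed := enorm_le_dist x y r0.
set q := dist r x y / r; have q0 : 0 < q by rewrite divr_gt0.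
have dq : dist r x y = q * r by rewrite /q divfK ?gt_eqF.
rewrite dq enormBC in ed.
have [q1|q1] := lerP 1 q.
  have [k /andP[kq qk]] := dyadic q1; exists k.
  have k0 : 0 < 2 ^+ k :> R by rewrite exprn_gt0.
  have e1 : enorm (y - x) < 2 ^+ k.+1 * r.
    by apply: le_lt_trans ed _; rewrite ltr_pM2r.
  rewrite /shell e1 mulr1; apply: (@le_trans _ _ (A k)); last by rewrite lerDl; nneg.
  rewrite /profile /A -rhoX; apply: ler_pM; [by nneg|by nneg| |].
    by rewrite lef_pV2 ?posrE ?exprn_gt0// lerXn2r// ?nnegrE ltW.
  apply: ler_wpowR; rewrite ?(ltW gam0)// ?le_min ?invr_ge0 ?(ltW q0) ?(ltW k0)//.
  by rewrite ge_min lef_pV2 ?posrE// kq orbT.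
have w1 : 1 <= q^-1 by rewrite invf_ge1// ltW.
have [k /andP[kq qk]] := dyadic w1; exists k.
have k0 : 0 < 2 ^+ k :> R by rewrite exprn_gt0.
have qk' : q <= (2 ^+ k)^-1 by rewrite -[q]invrK lef_pV2 ?posrE ?invr_gt0.
have e1 : enorm (y - x) < 2 * (2 ^+ k)^-1 * r.
  apply: le_lt_trans ed _; rewrite ltr_pM2r//; apply: le_lt_trans qk' _.
  by rewrite ltr_pMl ?invr_gt0// ltr1n.
rewrite /shell e1 mulr1; apply: (@le_trans _ _ (B k)); last by rewrite lerDr; nneg.
rewrite /profile /B -rhoX; apply: ler_pM; [by nneg|by nneg| |].
  by rewrite -exprVn lerXn2r// ?nnegrE ?invr_ge0 ?(ltW q0) ?exprn_ge0// ltW.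
apply: ler_wpowR; rewrite ?(ltW gam0)// ?le_min ?invr_ge0 ?(ltW q0) ?(ltW k0)//.
by rewrite ge_min qk'.
Qed.

Let mshell r x k : measurable_fun setT (fun y => shell r x k y).
Proof.
have me : measurable_fun setT (fun y : 'rV[R]_n => enorm (y - x)).
  by apply: measurable_enorm => //; exact: measurable_cst.
rewrite /shell; apply: measurable_funD; apply: measurable_funM => //;
  exact: (measurable_lt_indic me (measurable_cst _)).
Qed.

Let shell_integral r x k : 0 < r ->
  (\int[mu]_y (shell r x k y)%:E <= ((4 ^+ n + 8 ^+ n) * r ^+ n * rho ^+ k)%:E)%E.
Proof.
move=> r0; have k0 : 0 < 2 ^+ k :> R by rewrite exprn_gt0.
have me : measurable_fun setT (fun y : 'rV[R]_n => enorm (y - x)).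
  by apply: measurable_enorm => //; exact: measurable_cst.
have ms c : measurable_fun setT (fun y : 'rV[R]_n => (enorm (y - x) < c)%R%:R : R).
  exact: (measurable_lt_indic me (measurable_cst _)).
rewrite /shell integral_EFinD; [|exact: measurable_funM|exact: measurable_funM|by nneg|by nneg].
rewrite integral_EFinZ; [|by nneg|exact: ms|by nneg].
rewrite integral_EFinZ; [|by nneg|exact: ms|by nneg].
rewrite !integral_lt_indic//.
have r1 : 0 <= 2 ^+ k.+1 * r by nneg.
have r2 : 0 <= 2 * (2 ^+ k)^-1 * r by nneg.
apply: (@le_trans _ _ ((A k)%:E * ((2 * (2 ^+ k.+1 * r)) ^+ n)%:E +
    (B k)%:E * ((2 * (2 * (2 ^+ k)^-1 * r)) ^+ n)%:E)%E).
  by apply: leeD; apply: lee_pmul; rewrite ?lee_fin//; exact: eball_measure_le.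
rewrite -!EFinM -EFinD lee_fin /A /B; apply: le_of_eq.
have -> : 2 * (2 ^+ k.+1 * r) = 4 * 2 ^+ k * r by rewrite exprS; ring.
have -> : 2 * (2 * (2 ^+ k)^-1 * r) = 4 / 2 ^+ k * r by ring.
have -> : 8 ^+ n = 2 ^+ n * 4 ^+ n :> R by rewrite -exprMn; congr (_ ^+ _); ring.
have e : ((2 ^+ k)^-1) ^+ n = ((2 ^+ k) ^+ n)^-1 :> R by rewrite exprVn.
rewrite exprS !exprMn e.
have : (2 ^+ k) ^+ n != 0 :> R by rewrite gt_eqF// exprn_gt0.
move: ((2 ^+ k) ^+ n) (r ^+ n) (rho ^+ k) (4 ^+ n : R) (2 ^+ n : R).
by move=> a b c a4 a2 a0; field.
Qed.

Definition radial_bound : R := (4 ^+ n + 8 ^+ n) / (1 - rho).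

Lemma radial_bound_gt0 : 0 < radial_bound.
Proof.
by apply: divr_gt0; [rewrite addr_gt0 ?exprn_gt0|rewrite subr_gt0].
Qed.

(** Instead of polar coordinates, a sum over dyadic scales: one shell dominates at each point, and
    the integrals of the shells form a geometric series. *)
Lemma radial_integral x r : 0 < r ->
  (\int[mu]_y (profile (dist r x y / r))%:E <= (radial_bound * r ^+ n)%:E)%E.
Proof.
move=> r0.
apply: (@le_trans _ _ (\int[mu]_y (\sum_(0 <= k <oo) (shell r x k y)%:E))%E).
  apply: le_integral_inner => y.
    by rewrite lee_fin /profile; have d0 := dist_gt0 x y r0; nneg.
  have [k hk] := shell_ub x y r0.
  apply: (@le_trans _ _ (\sum_(0 <= i < k.+1) (shell r x i y)%:E)%E).
    rewrite big_nat_recr//=; apply: (@le_trans _ _ (shell r x k y)%:E); first by rewrite lee_fin.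
    by rewrite leeDr// sume_ge0// => i _; rewrite lee_fin.
  by apply: nneseries_lim_ge => i _ _; rewrite lee_fin.
rewrite integral_nneseries//; first last.
- by move=> k y _; rewrite lee_fin.
- by move=> k; apply/measurable_EFinP; exact: mshell.
apply: lime_le.
  by apply: is_cvg_nneseries => k _ _; apply: integral_EFin_ge0.
near=> K.
apply: (@le_trans _ _ (\sum_(0 <= k < K) ((4 ^+ n + 8 ^+ n) * r ^+ n * rho ^+ k)%:E)%E).
  by apply: lee_sum => k _; exact: shell_integral.
rewrite sumEFin lee_fin -mulr_sumr /radial_bound.
have -> : (4 ^+ n + 8 ^+ n) / (1 - rho) * r ^+ n =
  (4 ^+ n + 8 ^+ n) * r ^+ n * (1 - rho)^-1 by ring.
apply: ler_wpM2l; first by nneg.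
rewrite -[leRHS]mul1r ler_pdivlMr ?subr_gt0// big_mkord mulrC.
have -> : (1 - rho) * \sum_(i < K) rho ^+ i = 1 - rho ^+ K.
  by rewrite -[1 - rho ^+ K]opprB subrX1; ring.
by rewrite gerBl exprn_ge0// ltW.
Unshelve. all: by end_near. Qed.

End radial_integral.

(** * The normalised two-phase kernel as a [nonlocal_space] *)

Section model_kernel.
Context {R : realType} (n : nat).
Local Notation Rn := 'rV[R]_n.
Local Notation mu := (@lebesgue_rV R n).
Variables (p sg tu nu L bet : R) (m : nat).
Hypotheses (n0 : (0 < n)%N) (sg0 : 0 < sg) (sgtu : sg < tu) (tup : tu < p).
Hypotheses (tusg : tu - sg <= 1) (pm : p <= m.+1%:R).
Hypotheses (nu0 : 0 < nu) (L1 : 1 <= L) (bet0 : 0 <= bet).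

Definition model (r : R) (b : Rn -> Rn -> R) (x y : Rn) : R :=
  (dist r x y `^ (n%:R + sg))^-1 + b x y * (dist r x y `^ (n%:R + tu))^-1.

Local Notation gam := (minr sg (p - tu)).
(** 22 bounds, in units of r, the total displacement from a pair in B_r to a pair in B_10r (11 for
    each point), and 20 the distance of two points of B_10r. *)
Definition low_const : R := nu / (20 * (1 + 22 * bet)).
Local Notation upper_term := (L * (2 + 21 * bet) * radial_bound n gam).
Local Notation comparison_term :=
  (L / nu * (1 + 14 * bet) * 15 ^+ (n + m.+1)).
Local Notation low_term :=
  (2 * n%:R ^+ n * (2 * n%:R ^+ n) `^ (sg / n%:R) / low_const).
Definition space_const : R :=
  2 * n%:R ^+ n + 20 ^+ n + 20 `^ (n%:R + sg) / low_const +
  upper_term + comparison_term + low_term + L * 10 ^+ (n + m.+1).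

Let nR0 : 0 < n%:R :> R. Proof. by rewrite ltr0n. Qed.
Let L0 : 0 < L. Proof. exact: lt_le_trans ltr01 L1. Qed.
Let tu0 : 0 < tu. Proof. exact: lt_trans sgtu. Qed.
Let p0 : 0 < p. Proof. exact: lt_trans tup. Qed.
Let low0 : 0 < low_const.
Proof.
by rewrite divr_gt0// mulr_gt0// ltr_pwDl// mulr_ge0.
Qed.
Let gam0 : 0 < gam. Proof. by rewrite lt_min sg0 subr_gt0. Qed.
Let rad0 : 0 < radial_bound n gam.
Proof. exact: radial_bound_gt0. Qed.

Let s1 : 0 < 2 * n%:R ^+ n :> R. Proof. by posi. Qed.
Let s2 : 0 < 20 ^+ n :> R. Proof. by posi. Qed.
Let s3 : 0 < 20 `^ (n%:R + sg) / low_const. Proof. by rewrite divr_gt0 ?powR_gt0. Qed.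
Let s4 : 0 < upper_term.
Proof. by rewrite mulr_gt0// mulr_gt0// ltr_pwDl// mulr_ge0. Qed.
Let s5 : 0 < comparison_term.
Proof.
by rewrite mulr_gt0 ?exprn_gt0// mulr_gt0 ?divr_gt0// ltr_pwDl// mulr_ge0.
Qed.
Let s6 : 0 < low_term.
Proof. by rewrite divr_gt0// mulr_gt0// powR_gt0. Qed.
Let s7 : 0 < L * 10 ^+ (n + m.+1). Proof. by rewrite mulr_gt0// exprn_gt0. Qed.

Let Lam := space_const.

Lemma space_const_gt0 : 0 < space_const.
Proof. by rewrite /space_const !addr_gt0. Qed.

Ltac part := move: s1 s2 s3 s4 s5 s6 s7; rewrite /Lam /space_const; lra.
Let le1 : 2 * n%:R ^+ n <= Lam.
Proof. by part. Qed.
Let le2 : 20 ^+ n <= Lam.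
Proof. by part. Qed.
Let le3 : 20 `^ (n%:R + sg) / low_const <= Lam.
Proof. by part. Qed.
Let le4 : upper_term <= Lam.
Proof. by part. Qed.
Let le5 : comparison_term <= Lam.
Proof. by part. Qed.
Let le6 : low_term <= Lam.
Proof. by part. Qed.
Lemma space_const_ge_tail : L * 10 ^+ (n + m.+1) <= space_const.
Proof. by part. Qed.

Section ball.
Variables (b : Rn -> Rn -> R) (x0 : Rn) (r G : R).
Hypotheses (b0 : forall x y, 0 <= b x y).
Hypothesis holder : forall x1 y1 x2 y2,
  `|b x1 y1 - b x2 y2| <= bet * (enorm (x1 - x2) + enorm (y1 - y2)) `^ (tu - sg).
Hypotheses (r0 : 0 < r) (G0 : 0 < G).
Hypothesis G_ub : forall x y, enorm (x - x0) < r -> enorm (y - x0) < r ->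
  (r `^ sg)^-1 + b x y * (r `^ tu)^-1 <= G.
Hypothesis G_lub : forall c, (forall x y, enorm (x - x0) < r -> enorm (y - x0) < r ->
  (r `^ sg)^-1 + b x y * (r `^ tu)^-1 <= c) -> G <= c.

Implicit Types (x y : Rn) (c h : R).

Local Notation N x := (enorm (x - x0) / r).
Local Notation V := (r ^+ n).
Local Notation q x y := (dist r x y / r).

(** [A] and [B] are the weights of the two phases at unit distance after normalisation. Their sum is
    at most 1 on B_r, and [A] is constant because a = 1. *)
Let A : R := (r `^ sg)^-1 / G.
Let B (x y : Rn) : R := b x y * (r `^ tu)^-1 / G.

Local Notation phase Q c := (A * (Q `^ sg)^-1 + c * (Q `^ tu)^-1).

Let A0 : 0 < A. Proof. by rewrite divr_gt0 ?invr_gt0 ?powR_gt0. Qed.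
Let B0 x y : 0 <= B x y.
Proof. by rewrite /B !mulr_ge0 ?invr_ge0 ?powR_ge0 ?(ltW G0). Qed.
Let V0 : 0 < V. Proof. by rewrite exprn_gt0. Qed.
Let q0 x y : 0 < q x y. Proof. by rewrite divr_gt0// dist_gt0. Qed.

Let AB1 x y : enorm (x - x0) < r -> enorm (y - x0) < r -> A + B x y <= 1.
Proof. by move=> xr yr; rewrite /A /B -mulrDl ler_pdivrMr// mul1r G_ub. Qed.

Let center_in : enorm (x0 - x0) < r. Proof. by rewrite subrr enorm0. Qed.

Let A1 : A <= 1. Proof. by have := AB1 center_in center_in; have := B0 x0 x0; lra. Qed.
Let Bc1 : B x0 x0 <= 1. Proof. by have := AB1 center_in center_in; have := A0; lra. Qed.

(** The exponent tu - sg is exact: r^(tu - sg) r^(-tu) = r^(-sg), so the oscillation of the second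
    weight at scale r is a multiple of the first weight, uniformly in r. *)
Let holderB x1 y1 x2 y2 c : 1 <= c ->
  enorm (x1 - x2) + enorm (y1 - y2) <= c * r -> B x1 y1 <= B x2 y2 + bet * A * c `^ (tu - sg).
Proof.
move=> c1 hc; have := holder x1 y1 x2 y2; rewrite ler_norml => /andP[_ h].
have ts0 : 0 <= tu - sg by rewrite subr_ge0 ltW.
have h1 : (enorm (x1 - x2) + enorm (y1 - y2)) `^ (tu - sg) <= (c * r) `^ (tu - sg).
  have cr0 : 0 <= c * r by apply: mulr_ge0; [lra|exact: ltW].
  have e0 : 0 <= enorm (x1 - x2) + enorm (y1 - y2) by rewrite addr_ge0 ?enorm_ge0.
  by apply: ge0_ler_powR; rewrite ?nnegrE.
have rt : 0 < r `^ tu by rewrite powR_gt0.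
have rs : 0 < r `^ sg by rewrite powR_gt0.
have e : (c * r) `^ (tu - sg) = c `^ (tu - sg) * (r `^ tu / r `^ sg).
  rewrite powRM ?(ltW r0)//; last by lra.
  by rewrite (@powRB _ r) // (gt_eqF r0) implybT.
have h2 : b x1 y1 <= b x2 y2 + bet * (c `^ (tu - sg) * (r `^ tu / r `^ sg)).
  by rewrite -e; have := ler_wpM2l bet0 h1; lra.
have rtG : 0 <= (r `^ tu)^-1 / G by rewrite divr_ge0 ?invr_ge0 ?(ltW rt) ?(ltW G0).
have h3 := ler_wpM2r rtG h2.
have -> : B x1 y1 = b x1 y1 * ((r `^ tu)^-1 / G) by rewrite /B mulrA.
apply: le_trans h3 _; rewrite /B /A; apply: le_of_eq; field.
by rewrite !gt_eqF.
Qed.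

Let pow1 c : 1 <= c -> c `^ (tu - sg) <= c.
Proof. by move=> c1; apply: ler1_powR. Qed.

(** [G] is the least upper bound of the sum over pairs in B_r, and [holderB] carries each such pair
    to (x, y) at a cost proportional to [A]. *)
Let AB_low x y : N x < 10 -> N y < 10 -> (1 + 22 * bet)^-1 <= A + B x y.
Proof.
rewrite !ltr_pdivrMr// => Nx Ny.
have b22 : 0 < 1 + 22 * bet by rewrite ltr_pwDl// mulr_ge0.
have AB : 0 <= A + B x y by rewrite addr_ge0 ?(ltW A0).
rewrite -[leLHS]div1r ler_pdivrMr//.
suff : G <= G * ((A + B x y) * (1 + 22 * bet)) by rewrite ler_pMr.
apply: G_lub => x1 y1 x1r y1r.
have t1 := enorm_triangle3 x1 x0 x; have t2 := enorm_triangle3 y1 x0 y.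
rewrite [enorm (x0 - x)]enormBC in t1; rewrite [enorm (x0 - y)]enormBC in t2.
have c22 : 1 <= 22 :> R by lra.
have hc : enorm (x1 - x) + enorm (y1 - y) <= 22 * r by lra.
have := holderB c22 hc; have := ler_wpM2l (mulr_ge0 bet0 (ltW A0)) (pow1 c22).
have e : (r `^ sg)^-1 + b x1 y1 * (r `^ tu)^-1 = G * (A + B x1 y1).
  rewrite /A /B; have rt : 0 < r `^ tu by rewrite powR_gt0.
  have rs : 0 < r `^ sg by rewrite powR_gt0.
  by field; rewrite !gt_eqF.
move=> h1 h2; rewrite e ler_wpM2l ?(ltW G0)//.
have e2 : (A + B x y) * (1 + 22 * bet) =
  A + B x y + bet * A * 22 + 22 * (bet * B x y) by ring.
by have := mulr_ge0 bet0 (B0 x y); rewrite e2; lra.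
Qed.

Let modelE x y : model r b x y / G =
  V^-1 * ((q x y ^+ n)^-1 * phase (q x y) (B x y)).
Proof.
have d0 := dist_gt0 x y r0; have qq := q0 x y.
have dE : dist r x y = q x y * r by rewrite divfK// gt_eqF.
rewrite /model /A /B; move: dE qq; set Q := q x y => dE qq; rewrite {}dE.
have pE e : (Q * r) `^ (n%:R + e) = Q ^+ n * r ^+ n * (Q `^ e * r `^ e).
  clearbody Q; rewrite powRD; last by rewrite mulf_neq0 ?implybT ?gt_eqF.
  have Qr0 : 0 <= Q * r by rewrite mulr_ge0 ?(ltW qq) ?(ltW r0).
  rewrite (powR_mulrn n Qr0) exprMn; congr (_ * _).
  by rewrite powRM ?(ltW qq) ?(ltW r0).
rewrite !pE; have a1 : 0 < Q ^+ n by rewrite exprn_gt0.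
have a2 : 0 < r ^+ n by rewrite exprn_gt0.
have a3 e : 0 < Q `^ e by rewrite powR_gt0.
have a4 e : 0 < r `^ e by rewrite powR_gt0.
move: (a3 sg) (a3 tu) (a4 sg) (a4 tu); move: (Q `^ sg) (Q `^ tu) (r `^ sg) (r `^ tu) => c1 c2 c3 c4.
move: a1 a2; move: (Q ^+ n) (r ^+ n) => c5 c6 *.
by field; rewrite !gt_eqF.
Qed.

Let N_dist x y : `|N x - N y| <= q x y.
Proof.
rewrite -mulrBl normrM (gtr0_norm (_ : 0 < r^-1)) ?invr_gt0// ler_wpM2r ?invr_ge0 ?(ltW r0)//.
apply: (@le_trans _ _ (enorm (x - y))); last exact: enorm_le_dist.
have t1 := enorm_triangle3 x y x0; have t2 := enorm_triangle3 y x x0.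
by rewrite [enorm (y - x)]enormBC in t2; rewrite ler_norml; lra.
Qed.

Let q_lt20 x y : N x < 10 -> N y < 10 -> q x y <= 20.
Proof.
rewrite !ltr_pdivrMr// ler_pdivrMr// => Nx Ny; rewrite /dist; case: ifP => _; first by move: r0; lra.
have := enorm_triangle3 x x0 y; rewrite [enorm (x0 - y)]enormBC; lra.
Qed.

Let model_low x y : N x < 10 -> N y < 10 ->
  low_const / V * (q x y `^ (n%:R + sg))^-1 <= nu * (model r b x y / G).
Proof.
move=> Nx Ny; have qq := q0 x y; have q20 := q_lt20 Nx Ny; have AB := AB_low Nx Ny.
rewrite modelE; set Q := q x y in qq q20 *.
have b22 : 0 < 1 + 22 * bet by rewrite ltr_pwDl// mulr_ge0.
have Qs : 0 < Q `^ sg by rewrite powR_gt0.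
have Qt : Q `^ tu <= Q `^ sg * 20.
  have -> : tu = sg + (tu - sg) by ring.
  rewrite powRD; last by rewrite (gt_eqF qq) implybT.
  rewrite ler_wpM2l ?(ltW Qs)//.
  apply: (@le_trans _ _ (20 `^ (tu - sg))); last by apply: pow1; lra.
  by apply: ler_wpowR; rewrite ?subr_ge0 ?(ltW sgtu) ?(ltW qq).
have Qt0 : 0 < Q `^ tu by rewrite powR_gt0.
have k1 : (Q `^ sg)^-1 / 20 <= (Q `^ tu)^-1 by rewrite -invfM lef_pV2 ?posrE// mulr_gt0.
have k2 : (A + B x y) * ((Q `^ sg)^-1 / 20) <= phase Q (B x y).
  rewrite mulrDl lerD// ?ler_wpM2l ?(ltW A0)//.
  by rewrite ler_pdivrMr// ler_peMr ?invr_ge0 ?(ltW Qs)//; lra.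
have k3 : (1 + 22 * bet)^-1 * ((Q `^ sg)^-1 / 20) <= phase Q (B x y).
  by apply: le_trans k2; rewrite ler_wpM2r// divr_ge0// invr_ge0 ltW.
have Qn : 0 < Q ^+ n by rewrite exprn_gt0.
have -> : low_const / V * (Q `^ (n%:R + sg))^-1 =
    nu * (V^-1 * ((Q ^+ n)^-1 * ((1 + 22 * bet)^-1 * ((Q `^ sg)^-1 / 20)))).
  rewrite powRD; last by rewrite (gt_eqF qq) implybT.
  rewrite powR_mulrn ?(ltW qq)// /low_const; field.
  by rewrite !gt_eqF.
apply: ler_wpM2l; first exact: ltW.
apply: ler_wpM2l; first by rewrite invr_ge0 ltW.
by apply: ler_wpM2l => //; rewrite invr_ge0 ltW.
Qed.

(** Close to x the truncated distance contributes q^p against q^-tu, which leaves the power p - tu.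
    Far away the weight [B] may grow like q^(tu - sg), which turns q^-tu into q^-sg. Both powers are
    at least [gam]. *)
Let model_up x y : N x < 10 ->
  minr 1 `|N x - N y| `^ p * (model r b x y / G) <=
  (2 + 21 * bet) / V * profile n gam (q x y).
Proof.
move=> Nx; have qq := q0 x y; rewrite modelE.
have hB c : 1 <= c -> 20 + q x y <= c -> B x y <= 1 + bet * c `^ (tu - sg).
  move=> c1 hc; have : enorm (x - x0) + enorm (y - x0) <= c * r.
    have := enorm_triangle3 y x x0; have := enorm_le_dist x y r0; rewrite [enorm (y - x)]enormBC.
    rewrite ltr_pdivrMr// in Nx.
    have : (20 + q x y) * r <= c * r by rewrite ler_wpM2r// ltW.
    by rewrite mulrDl divfK ?gt_eqF//; lra.
  move=> /(holderB c1) /le_trans; apply.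
  apply: lerD => //; apply: ler_wpM2r; first exact: powR_ge0.
  by rewrite ler_piMr.
have Nq := N_dist x y.
set Q := q x y in qq hB Nq *.
have Qs : 0 < Q `^ sg by rewrite powR_gt0.
have Qt : 0 < Q `^ tu by rewrite powR_gt0.
have Qn : 0 < Q ^+ n by rewrite exprn_gt0.
set M := minr 1 _; have M0 : 0 <= M by rewrite le_min ler01 normr_ge0.
set g := gam.
have gle : g <= sg /\ g <= p - tu by rewrite !ge_min !lexx orbT.
suff key : M `^ p * phase Q (B x y) <= (2 + 21 * bet) * minr Q Q^-1 `^ g.
  have -> : M `^ p * (V^-1 * ((Q ^+ n)^-1 * phase Q (B x y))) =
    V^-1 * (Q ^+ n)^-1 * (M `^ p * phase Q (B x y)) by ring.
  have -> : (2 + 21 * bet) / V * profile n g Q = V^-1 * (Q ^+ n)^-1 * ((2 + 21 * bet) * minr Q Q^-1 `^ g).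
    by rewrite /profile; ring.
  by apply: ler_wpM2l => //; rewrite mulr_ge0// invr_ge0 ltW.
have c21 : 1 <= 21 :> R by lra.
have Mp : 0 <= M `^ p by exact: powR_ge0.
have [Q1|Q1] := leP Q 1.
  have Qi1 : 1 <= Q^-1 by rewrite -div1r ler_pdivlMr// mul1r.
  have -> : minr Q Q^-1 = Q by apply/min_idPl; exact: le_trans Q1 Qi1.
  have hb : B x y <= 1 + 21 * bet.
    have h20 : 20 + Q <= 21 by lra.
    apply: le_trans (hB _ c21 h20) _; rewrite lerD2l mulrC ler_wpM2r// pow1//.
  have Qst : (Q `^ sg)^-1 <= (Q `^ tu)^-1.
    by rewrite lef_pV2 ?posrE//; apply: ger_powR; [rewrite qq|exact: ltW].
  have MQ : M `^ p <= Q `^ p.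
    apply: ler_wpowR; rewrite ?(ltW p0) ?(ltW qq)//.
    by rewrite ge_min Nq orbT.
  apply: (@le_trans _ _ (Q `^ p * ((2 + 21 * bet) * (Q `^ tu)^-1))).
    apply: ler_pM => //; first by rewrite addr_ge0// mulr_ge0 ?invr_ge0 ?(ltW A0) ?(ltW Qs) ?(ltW Qt).
    have h1 : A * (Q `^ sg)^-1 <= 1 * (Q `^ tu)^-1.
      by apply: ler_pM; rewrite ?invr_ge0 ?(ltW A0) ?(ltW Qs).
    have h2 : B x y * (Q `^ tu)^-1 <= (1 + 21 * bet) * (Q `^ tu)^-1.
      by rewrite ler_wpM2r// invr_ge0 ltW.
    by lra.
  rewrite mulrCA ler_wpM2l//; first by rewrite addr_ge0// mulr_ge0.
  rewrite -powRB; last by rewrite (gt_eqF qq) implybT.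
  by apply: ger_powR; [rewrite qq|case: gle].
have Qi1 : Q^-1 <= 1 by rewrite -[leLHS]div1r ler_pdivrMr// mul1r ltW.
have -> : minr Q Q^-1 = Q^-1 by apply/min_idPr; exact: le_trans Qi1 (ltW Q1).
have hb : B x y <= 1 + 21 * bet * Q `^ (tu - sg).
  have cQ : 1 <= 21 * Q by lra.
  have h20 : 20 + Q <= 21 * Q by lra.
  apply: le_trans (hB _ cQ h20) _; rewrite lerD2l powRM ?(ltW qq)//.
  rewrite mulrA ler_wpM2r ?powR_ge0// mulrC ler_wpM2r// pow1//.
have M1 : M `^ p <= 1 by apply: powR_le1; [rewrite M0 ge_min lexx|exact: ltW].
apply: (@le_trans _ _ (1 * ((2 + 21 * bet) * (Q `^ sg)^-1))).
  apply: ler_pM => //; first by rewrite addr_ge0// mulr_ge0 ?invr_ge0 ?(ltW A0) ?(ltW Qs) ?(ltW Qt).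
  have h1 : A * (Q `^ sg)^-1 <= 1 * (Q `^ sg)^-1 by rewrite ler_wpM2r// invr_ge0 ltW.
  have h2 : B x y * (Q `^ tu)^-1 <= (1 + 21 * bet * Q `^ (tu - sg)) * (Q `^ tu)^-1.
    by rewrite ler_wpM2r// invr_ge0 ltW.
  have h3 : (Q `^ tu)^-1 <= (Q `^ sg)^-1.
    by rewrite lef_pV2 ?posrE//; apply: ler_powR; exact: ltW.
  have h4 : Q `^ (tu - sg) * (Q `^ tu)^-1 = (Q `^ sg)^-1.
    rewrite powRB; last by rewrite (gt_eqF qq) implybT.
    by field; rewrite !gt_eqF.
  by move: h2; rewrite mulrDl mul1r -[X in _ <= _ + X]mulrA h4; lra.
rewrite mul1r ler_wpM2l//; first by rewrite addr_ge0// mulr_ge0.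
rewrite powRV ?(ltW qq)// lef_pV2 ?posrE ?powR_gt0//.
by apply: ler_powR; [exact: ltW|case: gle].
Qed.

(** Moving the base point changes [B] by at most 14 bet A, and since y is at least h r away from x,
    the distance grows by a factor of at most 15 / h. One more 1 / h comes from q^-tu <= q^-sg / h,
    whence the exponent n + m + 2. *)
Let model_comparable x x' y h : N x < 7 -> N x' < 7 -> 0 < h -> h <= 1 ->
  N x + h <= N y ->
  model r b x y / G <= (1 + 14 * bet) * 15 ^+ (n + m.+1) / h ^+ (n + m.+2) * (model r b x' y / G).
Proof.
move=> Nx Nx' h0 h1 Ny; rewrite [leLHS]modelE [X in _ <= _ * X]modelE.
have hq : h <= q x y by apply: le_trans (N_dist x y); rewrite ler0_norm; lra.
have hB : B x y <= B x' y + 14 * bet * A.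
  have c14 : 1 <= 14 :> R by lra.
  have hc : enorm (x - x') + enorm (y - y) <= 14 * r.
    rewrite subrr enorm0 addr0; have := enorm_triangle3 x x0 x'.
    by rewrite [enorm (x0 - x')]enormBC; move: Nx Nx'; rewrite !ltr_pdivrMr//; lra.
  apply: le_trans (holderB c14 hc) _; rewrite lerD2l.
  have -> : 14 * bet * A = bet * A * 14 by ring.
  by rewrite ler_wpM2l ?pow1// mulr_ge0// ltW.
have qq' : q x' y <= 15 / h * q x y.
  have hqr : h * r <= dist r x y by rewrite -ler_pdivlMr.
  rewrite mulrA ler_wpM2r ?invr_ge0 ?(ltW r0)//.
  have hd : dist r x y <= dist r x y / h by rewrite ler_peMr ?invf_ge1// ltW// dist_gt0.
  have hr : r <= dist r x y / h by rewrite ler_pdivlMr// mulrC.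
  have -> : 15 / h * dist r x y = 15 * (dist r x y / h) by ring.
  have rr := r0.
  rewrite {1}/dist; case: ifP => _; first by lra.
  have t1 := enorm_triangle3 x' x0 y; have t2 := enorm_triangle3 x0 x y.
  have t3 := enorm_le_dist x y r0; rewrite [enorm (x0 - x)]enormBC in t2.
  by move: Nx Nx'; rewrite !ltr_pdivrMr//; lra.
have Q0 := q0 x y; have Q0' := q0 x' y.
move: hq qq' Q0 Q0'; move: (q x y) (q x' y) => Q Q' hq qq' Q0 Q0'.
pose W := 15 / h; have W0 : 0 < W by rewrite divr_gt0.
have W1 : 1 <= W by rewrite ler_pdivlMr//; lra.
have inv_e e : 0 <= e -> e <= m.+1%:R -> (Q `^ e)^-1 <= W ^+ m.+1 * (Q' `^ e)^-1.
  move=> e0 em; have Qe : 0 < Q `^ e by rewrite powR_gt0.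
  have Qe' : 0 < Q' `^ e by rewrite powR_gt0.
  rewrite -[leLHS]div1r ler_pdivrMr// mulrAC ler_pdivlMr// mul1r.
  apply: (@le_trans _ _ ((W * Q) `^ e)).
    have WQ0 := mulr_ge0 (ltW W0) (ltW Q0).
    by apply: ler_wpowR; rewrite ?(ltW Q0').
  rewrite powRM ?(ltW W0) ?(ltW Q0)// ler_wpM2r ?(ltW Qe)//.
  by rewrite -(powR_mulrn _ (ltW W0)); apply: ler_powR.
have inv_n : (Q ^+ n)^-1 <= W ^+ n * (Q' ^+ n)^-1.
  rewrite -[leLHS]div1r ler_pdivrMr ?exprn_gt0// mulrAC ler_pdivlMr ?exprn_gt0// mul1r.
  have WQ0 := mulr_ge0 (ltW W0) (ltW Q0).
  by rewrite -exprMn lerXn2r ?nnegrE ?(ltW Q0').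
have hts : (Q `^ tu)^-1 <= (Q `^ sg)^-1 / h.
  have Qs : 0 < Q `^ sg by rewrite powR_gt0.
  rewrite -invfM lef_pV2 ?posrE ?mulr_gt0 ?powR_gt0//.
  have -> : tu = sg + (tu - sg) by ring.
  rewrite powRD; last by rewrite (gt_eqF Q0) implybT.
  rewrite ler_wpM2l ?(ltW Qs)//.
  apply: (@le_trans _ _ (h `^ (tu - sg))); last first.
    by apply: ler_wpowR; rewrite ?subr_ge0 ?(ltW sgtu) ?(ltW h0) ?(ltW Q0).
  by apply: ger1_powR => //; rewrite h0.
have t14 : 0 <= 14 * bet by rewrite mulr_ge0.
have main : phase Q (B x y) <=
   (1 + 14 * bet) / h * W ^+ m.+1 * phase Q' (B x' y).
  have hi : 1 <= h^-1 by rewrite invf_ge1.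
  have Qti : 0 <= (Q `^ tu)^-1 by rewrite invr_ge0 powR_ge0.
  have Qsi : 0 <= (Q `^ sg)^-1 by rewrite invr_ge0 powR_ge0.
  have step1 : phase Q (B x y) <=
     (1 + 14 * bet) / h * phase Q (B x' y).
    apply: (@le_trans _ _ (A * (Q `^ sg)^-1 + (B x' y + 14 * bet * A) * (Q `^ tu)^-1)).
      by rewrite lerD2l ler_wpM2r.
    have k1 : 14 * bet * A * (Q `^ tu)^-1 <= 14 * bet * A * ((Q `^ sg)^-1 / h).
      by apply: ler_wpM2l => //; rewrite mulr_ge0// ltW.
    have a1 : 0 <= A * (Q `^ sg)^-1 by rewrite mulr_ge0// ltW.
    have a2 : 0 <= B x' y * (Q `^ tu)^-1 by rewrite mulr_ge0.
    have k2 : A * (Q `^ sg)^-1 <= A * (Q `^ sg)^-1 / h by rewrite ler_peMr.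
    have k3 : B x' y * (Q `^ tu)^-1 <= (1 + 14 * bet) / h * (B x' y * (Q `^ tu)^-1).
      rewrite ler_peMl//; apply: (@le_trans _ _ (1 * 1)); first by rewrite mulr1.
      by apply: ler_pM => //; lra.
    by lra.
  apply: le_trans step1 _; rewrite -[leRHS]mulrA; apply: ler_wpM2l.
    by rewrite divr_ge0 ?(ltW h0)//; lra.
  rewrite mulrDr; apply: lerD.
    rewrite mulrCA; apply: ler_wpM2l; first exact: ltW.
    by apply: inv_e; [exact: ltW|have := sgtu; have := tup; have := pm; lra].
  rewrite mulrCA; apply: ler_wpM2l => //.
  by apply: inv_e; [exact: ltW|have := tup; have := pm; lra].
have -> : (1 + 14 * bet) * 15 ^+ (n + m.+1) / h ^+ (n + m.+2) *
   (V^-1 * ((Q' ^+ n)^-1 * phase Q' (B x' y))) =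
   V^-1 * ((W ^+ n * (Q' ^+ n)^-1) * ((1 + 14 * bet) / h * W ^+ m.+1 * phase Q' (B x' y))).
  have e : 15 ^+ (n + m.+1) / h ^+ (n + m.+2) = W ^+ n * W ^+ m.+1 / h.
    have -> : W ^+ n * W ^+ m.+1 = 15 ^+ (n + m.+1) / h ^+ (n + m.+1).
      by rewrite -exprD /W exprMn exprVn.
    have -> : (n + m.+2 = (n + m.+1).+1)%N by rewrite addnS.
    by rewrite (exprS h) invfM; ring.
  transitivity ((1 + 14 * bet) * (15 ^+ (n + m.+1) / h ^+ (n + m.+2)) *
     (V^-1 * ((Q' ^+ n)^-1 * phase Q' (B x' y)))).
    by congr (_ * _); rewrite mulrA.
  by rewrite e; ring.
apply: ler_wpM2l; first by rewrite invr_ge0 ltW.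
have Qti : 0 <= (Q `^ tu)^-1 by rewrite invr_ge0 powR_ge0.
have Qsi : 0 <= (Q `^ sg)^-1 by rewrite invr_ge0 powR_ge0.
apply: ler_pM => //; first by rewrite invr_ge0 exprn_ge0// ltW.
by apply: addr_ge0; apply: mulr_ge0 => //; exact: ltW.
Qed.

Variable J1 : Rn * Rn -> R.
Hypotheses (mJ1 : measurable_fun setT J1) (symJ1 : forall x y, J1 (x, y) = J1 (y, x)).
Hypothesis J1_bounds : forall x y, nu * model r b x y <= J1 (x, y) <= L * model r b x y.

Let J (z : Rn * Rn) : R := J1 z / G.

Let J_low x y : nu * (model r b x y / G) <= J (x, y).
Proof.
by rewrite /J mulrA ler_wpM2r ?invr_ge0 ?(ltW G0)//; case/andP: (J1_bounds x y).
Qed.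

Let J_up x y : J (x, y) <= L * (model r b x y / G).
Proof.
by rewrite /J mulrA ler_wpM2r ?invr_ge0 ?(ltW G0)//; case/andP: (J1_bounds x y).
Qed.

Lemma model_ge0 x y : 0 <= model r b x y.
Proof. by rewrite /model addr_ge0 ?mulr_ge0 ?invr_ge0 ?powR_ge0. Qed.

Let J_ge0 z : 0 <= J z.
Proof.
case: z => x y; apply: le_trans (J_low x y).
by rewrite mulr_ge0 ?(ltW nu0)// divr_ge0 ?model_ge0 ?(ltW G0).
Qed.

Let mN : measurable_fun setT (fun x => N x).
Proof.
apply: measurable_funM => //.
by apply: measurable_enorm => //; exact: measurable_cst.
Qed.

Let mJ : measurable_fun setT J.
Proof. exact: measurable_funM. Qed.

Let ballE c : 0 < c -> [set x | N x < c] = eball x0 (c * r).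
Proof. by move=> c0; apply/seteqP; split => x /=; rewrite /eball /= ltr_pdivrMr. Qed.

Let J_dist x y : N x < 10 -> N y < 10 ->
  low_const / V * (q x y `^ (n%:R + sg))^-1 <= J (x, y).
Proof. by move=> Nx Ny; apply: le_trans (model_low Nx Ny) (J_low x y). Qed.

Let singleton_null x : mu [set x] = 0%E.
Proof.
have -> : [set x] = [set y : Rn | forall i, [set x ord0 i] (y ord0 i)].
  by apply/seteqP; split=> y /= => [->//|H]; apply/rowP => i; exact: H.
rewrite (@lebesgue_rV_box R n (fun i => [set x ord0 i])).
  have [i _] : exists i : 'I_n, true by exists (Ordinal n0).
  by rewrite (bigD1 i)//= lebesgue_measure_set1 mul0e.
by move=> i; exact: measurable_set1.
Qed.

(** The ball about x of radius del r, with del^n = 2 n^n a, has measure at least 2 a V; at most half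
    of this is lost to the superlevel set. On the rest the kernel is at least of order del^-(n + sg)
    / V, which multiplied by a V gives a^(-sg / n). *)
Let small_set (f : Rn -> R) k x S h a : measurable_fun setT f ->
  N x < S -> 0 < h -> h <= 1 -> S + h <= 10 -> 0 < a -> a <= h ^+ n / Lam ->
  (\int[mu]_y ((N y < S + h)%R%:R * (k < f y)%R%:R)%:E <= (a * V)%:E)%E ->
  ((a `^ (sg / n%:R) * Lam)^-1%:E <=
    \int[mu]_y ((N y < S + h)%R%:R * (f y <= k)%R%:R * J (x, y))%:E)%E.
Proof.
move=> mf Nx h0 h1 Sh a0 ah hmu.
have Lam0 : 0 < Lam := space_const_gt0.
have nn0 : 0 < n%:R ^+ n :> R by rewrite exprn_gt0.
pose w := 2 * n%:R ^+ n * a; have w0 : 0 < w by rewrite !mulr_gt0.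
pose del := w `^ n%:R^-1.
have del0 : 0 < del by rewrite powR_gt0.
have deln : del ^+ n = w.
  by rewrite -(powR_mulrn n (ltW del0)) /del -powRrM mulVf ?powRr1 ?(ltW w0)// gt_eqF.
have delh : del <= h.
  rewrite -(@ler_pXn2r _ n)// ?nnegrE ?(ltW del0) ?(ltW h0)// deln.
  have : w <= Lam * a by rewrite ler_wpM2r ?(ltW a0).
  by move=> /le_trans; apply; rewrite mulrC -ler_pdivlMr.
have Nx10 : N x < 10 by lra.
pose c := low_const / V * (del `^ (n%:R + sg))^-1.
have c0 : 0 < c by rewrite /c; posi.
have mE := @measurable_enorm R n _ _ (fun y => y) (fun=> x) (@measurable_id _ _ setT) (measurable_cst x).
have mJx : measurable_fun setT (fun y => J (x, y)).
  exact: (measurableT_comp mJ (pair1_measurable x)).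
have mball : measurable_fun setT (fun y : Rn => (enorm (y - x) < del * r)%R%:R : R).
  exact: (measurable_lt_indic mE (measurable_cst _)).
have key : ((c * (w / n%:R ^+ n * V))%:E <=
    \int[mu]_y ((N y < S + h)%R%:R * (f y <= k)%R%:R * J (x, y))%:E + (c * (a * V))%:E)%E.
  apply: (@le_trans _ _ (\int[mu]_y (c * (enorm (y - x) < del * r)%R%:R)%:E)%E).
    rewrite integral_EFinZ; [|exact: ltW|exact: mball|by nneg].
    rewrite EFinM; apply: lee_pmul; rewrite ?lee_fin ?(ltW c0)//.
      by rewrite mulr_ge0 ?(ltW V0)// divr_ge0 ?(ltW w0) ?(ltW nn0).
    rewrite integral_lt_indic//.
    apply: le_trans (@eball_measure_ge R n x (del * r) n0 _); last by rewrite mulr_gt0.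
    by rewrite lee_fin -deln !exprMn exprVn mulrAC.
  apply: (@le_trans _ _ (\int[mu]_y ((N y < S + h)%R%:R * (f y <= k)%R%:R * J (x, y) +
      c * ((N y < S + h)%R%:R * (k < f y)%R%:R))%:E)%E).
    apply: ae_le_integral_inner.
    - by move=> y; rewrite lee_fin; nneg.
    - by move=> y; rewrite lee_fin; nneg; exact: J_ge0.
    (* At y = x, [dist] is r by convention and need not be below del r, so this single point is
       discarded. *)
    exists [set x]; split; [|exact: singleton_null|].
      have -> : [set x] = ~` [set y | 0 < enorm (y - x)].
        apply/seteqP; split => y /=; first by move=> ->; rewrite subrr enorm0 ltxx.
        move=> /negP; rewrite lt_def enorm_ge0 andbT negbK enorm_eq0 subr_eq0 => /eqP//.
      apply: measurableC; rewrite -[X in measurable X]setTI.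
      have m0 := measurable_fun_ltr (@measurable_cst _ _ Rn R setT 0) mE.
      exact: (m0 measurableT [set true]).
    move=> y; apply: contra_notP => /= yx; rewrite lee_fin.
    have [yb|yb] := ltrP (enorm (y - x)) (del * r); last first.
      by rewrite mulr0; nneg; exact: J_ge0.
    have Ny : N y < S + h.
      rewrite ltr_pdivrMr// mulrDl; have := enorm_triangle3 y x x0.
      have := ler_wpM2r (ltW r0) delh; move: Nx; rewrite ltr_pdivrMr//; lra.
    have Ny10 : N y < 10 by lra.
    rewrite Ny !mul1r mulr1; have [fk|fk] := lerP (f y) k; last first.
      by rewrite mul0r add0r mulr1.
    rewrite mul1r mulr0 addr0; apply: le_trans (J_dist Nx10 Ny10).
    rewrite /c; apply: ler_wpM2l; first by rewrite divr_ge0 ?(ltW low0) ?(ltW V0).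
    have qd : q x y <= del.
      rewrite ler_pdivrMr// /dist; case: eqP => [|_]; last by rewrite enormBC ltW.
      by move/eqP; rewrite enorm_eq0 subr_eq0 => /eqP xy; case: yx.
    rewrite lef_pV2 ?posrE ?powR_gt0//; apply: ler_wpowR; rewrite ?(ltW (q0 _ _)) ?(ltW del0)//.
    by rewrite addr_ge0// ltW.
  rewrite integral_EFinD; [|by apply: measurable_funM => //; mfun|by mfun| |]; first last.
  - by nneg.
  - by nneg; exact: J_ge0.
  rewrite integral_EFinZ; [|exact: ltW|by mfun|by nneg].
  by apply: leeD => //; apply: EFin_mul_le; [exact: ltW|exact: hmu].
have wE : w / n%:R ^+ n = 2 * a by rewrite /w; field; rewrite gt_eqF.
move: key; rewrite wE => key.
apply: (@le_trans _ _ (c * (a * V))%:E); last first.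
  have -> : c * (a * V) = c * (2 * a * V) - c * (a * V) by ring.
  by rewrite EFinB leeBlDr.
rewrite lee_fin /c.
have delE : del `^ (n%:R + sg) = w * (2 * n%:R ^+ n) `^ (sg / n%:R) * a `^ (sg / n%:R).
  rewrite powRD; last by rewrite (gt_eqF del0) implybT.
  rewrite (powR_mulrn n (ltW del0)) deln -mulrA; congr (_ * _).
  by rewrite /del -powRrM [_ * sg]mulrC /w (powRM _ (ltW s1) (ltW a0)).
rewrite delE; set kap := sg / n%:R.
have ak0 : 0 < a `^ kap by rewrite powR_gt0.
have wk0 : 0 < (2 * n%:R ^+ n) `^ kap :> R by rewrite powR_gt0 ?mulr_gt0.
have -> : low_const / V * (w * (2 * n%:R ^+ n) `^ kap * a `^ kap)^-1 * (a * V) =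
   (a `^ kap)^-1 * (2 * n%:R ^+ n * (2 * n%:R ^+ n) `^ kap / low_const)^-1.
  rewrite /w; field; by rewrite !gt_eqF.
rewrite invfM ler_wpM2l ?invr_ge0 ?(ltW ak0)// lef_pV2 ?posrE//.
Qed.

Lemma model_nonlocal_space :
  nonlocal_space p Lam (sg / n%:R) (n + m.+2) n mu V (fun x => N x) J.
Proof.
have Lam0 : 0 < Lam := space_const_gt0.
split => //.
- by move=> x y; rewrite /J symJ1.
- rewrite ballE// mul1r; apply: le_trans (eball_measure_ge x0 n0 r0).
  rewrite lee_fin exprMn exprVn ler_wpM2l ?(ltW V0)// lef_pV2 ?posrE ?exprn_gt0//.
  apply: le_trans le1; rewrite ler_peMl ?exprn_ge0//.
  by rewrite ler1n.
- rewrite ballE//; apply: le_trans (eball_measure_le x0 _) _.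
    by rewrite mulr_ge0 ?(ltW r0).
  rewrite lee_fin mulrA exprMn ler_wpM2r ?(ltW V0)//.
  by have -> : 2 * 10 = 20 :> R by ring.
- move=> x y Nx Ny; apply: le_trans (J_dist Nx Ny).
  have qd := q_lt20 Nx Ny; have q1 := q0 x y.
  have l1 : (20 `^ (n%:R + sg))^-1 <= (q x y `^ (n%:R + sg))^-1.
    rewrite lef_pV2 ?posrE ?powR_gt0//; apply: ler_wpowR; rewrite ?(ltW q1)//.
    by rewrite addr_ge0// ltW.
  apply: (@le_trans _ _ (low_const / V * (20 `^ (n%:R + sg))^-1)); last first.
    by rewrite ler_wpM2l// divr_ge0 ?(ltW low0) ?(ltW V0).
  have pp : 0 < 20 `^ (n%:R + sg) :> R by rewrite powR_gt0.
  have -> : low_const / V * (20 `^ (n%:R + sg))^-1 = V^-1 * (20 `^ (n%:R + sg) / low_const)^-1.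
    by field; rewrite !gt_eqF.
  by rewrite invfM mulrC ler_wpM2l ?invr_ge0 ?(ltW V0)// lef_pV2 ?posrE.
- move=> x Nx.
  apply: (@le_trans _ _ (\int[mu]_y (L * ((2 + 21 * bet) / V) * profile n gam (q x y))%:E)%E).
    apply: le_integral_EFin => y; first by nneg; exact: J_ge0.
    apply: (@le_trans _ _ (minr 1 `|N x - N y| `^ p * (L * (model r b x y / G)))).
      by rewrite ler_wpM2l ?powR_ge0.
    have hm := ler_wpM2l (ltW L0) (model_up y Nx).
    apply: (le_trans (le_trans _ hm)); apply: le_of_eq; ring.
  have c0 : 0 <= L * ((2 + 21 * bet) / V).
    by rewrite mulr_ge0 ?(ltW L0)// divr_ge0 ?(ltW V0)// addr_ge0// mulr_ge0.
  have pf0 y : 0 <= profile n gam (q x y).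
    by rewrite /profile mulr_ge0 ?powR_ge0// invr_ge0 exprn_ge0// ltW.
  rewrite integral_EFinZ//; last first.
    have mq : measurable_fun setT (fun y => q x y).
      by apply: measurable_funM => //; exact: measurable_dist2.
    by rewrite /profile; mfun.
  apply: le_trans (EFin_mul_le c0 _) _; first exact: radial_integral.
  rewrite lee_fin; apply: le_trans le4.
  apply: le_of_eq; field; exact: lt0r_neq0.
- move=> x x' y h Nx Nx' h0 h1 Ny; apply: le_trans (J_up x y) _.
  have mc := model_comparable Nx Nx' h0 h1 Ny.
  apply: (@le_trans _ _ (L * ((1 + 14 * bet) * 15 ^+ (n + m.+1) / h ^+ (n + m.+2) * (J (x', y) / nu)))).
    apply: ler_wpM2l; first exact: ltW.
    apply: le_trans mc _; apply: ler_wpM2l.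
      by rewrite divr_ge0 ?exprn_ge0 ?(ltW h0)// mulr_ge0 ?exprn_ge0// addr_ge0// mulr_ge0.
    by rewrite ler_pdivlMr// mulrC J_low.
  have -> : L * ((1 + 14 * bet) * 15 ^+ (n + m.+1) / h ^+ (n + m.+2) * (J (x', y) / nu)) =
    (L / nu * (1 + 14 * bet) * 15 ^+ (n + m.+1)) * ((h ^+ (n + m.+2))^-1 * J (x', y)) by ring.
  rewrite -[leRHS]mulrA; apply: ler_wpM2r => //.
  by rewrite mulr_ge0 ?J_ge0// invr_ge0 exprn_ge0// ltW.
Qed.

End ball.
End model_kernel.

(** * Hölder coefficients: measurability, bounds, change of exponent *)

Section holder_coefficient.
Context {R : realType} (n : nat).
Local Notation Rn := 'rV[R]_n.
Local Notation mu := (@lebesgue_rV R n).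
Variables (b : Rn -> Rn -> R) (be al : R).
Hypotheses (be0 : 0 <= be) (al0 : 0 < al) (hb : holder_coeff be al b).

Let modulus (e : R) : 0 < e -> exists2 del, 0 < del & be * del `^ al < e.
Proof.
move=> e0; have be1 : 0 < be + 1 by rewrite ltr_wpDl.
exists ((e / (be + 1)) `^ al^-1); first by rewrite powR_gt0// divr_gt0.
rewrite -powRrM mulVf ?gt_eqF// powRr1; last by rewrite divr_ge0 ?ltW.
by rewrite mulrA ltr_pdivrMr//; nra.
Qed.

(* McShane's formula: [b] is the supremum over rational [q] of
   [b q - be * (distance to q) ^ al]. *)
Lemma measurable_holder : measurable_fun setT (fun z : Rn * Rn => b z.1 z.2).
Proof.
pose rv (q : 'rV[rat]_n) : Rn := map_mx ratr q.
pose h (q : 'rV[rat]_n * 'rV[rat]_n) (z : Rn * Rn) :=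
  b (rv q.1) (rv q.2) - be * (enorm (z.1 - rv q.1) + enorm (z.2 - rv q.2)) `^ al.
have mh q : measurable_fun setT (h q).
  have m1 : measurable_fun setT (fun z : Rn * Rn => enorm (z.1 - rv q.1)).
    by apply: measurable_enorm; [exact: measurable_fst|exact: measurable_cst].
  have m2 : measurable_fun setT (fun z : Rn * Rn => enorm (z.2 - rv q.2)).
    by apply: measurable_enorm; [exact: measurable_snd|exact: measurable_cst].
  by rewrite /h; mfun.
apply: (measurability _ (RGenOInfty.measurableE R)) => //.
move=> _ [_ [c ->] <-]; rewrite setTI.
rewrite (_ : _ @^-1` _ = \bigcup_i
  (if unpickle i is Some q then h q @^-1` `]c, +oo[%classic else set0)).
  apply: bigcup_measurable => i _; case: unpickle => [q|]; last exact: measurable0.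
  by rewrite -[X in measurable X]setTI; apply: mh => //; exact: measurable_itv.
apply/seteqP; split=> [[x y]|[x y] [i _]]; rewrite /= ?in_itv /= ?andbT; last first.
  case: unpickle => [q|//]; rewrite /= in_itv /= andbT => /lt_le_trans; apply.
  have := hb (rv q.1) (rv q.2) x y; rewrite ler_norml /h /= => /andP[_].
  by rewrite [enorm (rv q.1 - _)]enormBC [enorm (rv q.2 - _)]enormBC; lra.
move=> cb; have [del del0 hdel] : exists2 del, 0 < del & be * del `^ al < (b x y - c) / 2.
  by apply: modulus; rewrite divr_gt0// subr_gt0.
(* Coordinates within rho give distance at most n rho <= del / 2; using n + 1 avoids a division by
   0. *)
pose rho := del / (2 * n.+1%:R).
have rho0 : 0 < rho by rewrite divr_gt0// mulr_gt0.
have dense (w : Rn) : exists q, enorm (w - rv q) <= del / 2.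
  have ex i : exists q : rat, `|w ord0 i - ratr q| <= rho.
    have : w ord0 i - rho < w ord0 i + rho by lra.
    move=> /rat_in_itvoo[q]; rewrite in_itv /= => /andP[q1 q2]; exists q.
    by rewrite ler_norml; lra.
  have [f fP] := choice ex; exists (\row_i f i).
  apply: (@le_trans _ _ (n%:R * rho)).
    by apply: enorm_le_max; [move=> i; rewrite !mxE|exact: ltW].
  rewrite /rho mulrA ler_pdivrMr ?mulr_gt0//.
  have -> : del / 2 * (2 * n.+1%:R) = del * n.+1%:R by field.
  by rewrite mulrC ler_wpM2l ?(ltW del0)// ler_nat.
have [q1 hq1] := dense x; have [q2 hq2] := dense y.
exists (pickle (q1, q2)) => //; rewrite pickleK /= in_itv /= andbT /h /=.
have dle : enorm (x - rv q1) + enorm (y - rv q2) <= del by lra.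
have e0 : 0 <= enorm (x - rv q1) + enorm (y - rv q2) by rewrite addr_ge0 ?enorm_ge0.
have hp : (enorm (x - rv q1) + enorm (y - rv q2)) `^ al <= del `^ al.
  by apply: ler_wpowR; rewrite ?(ltW al0) ?(ltW del0).
have := hb x y (rv q1) (rv q2); rewrite ler_norml => /andP[_].
by have := ler_wpM2l be0 hp; lra.
Qed.

(** By continuity, a violation at one point persists on a product of two balls, which has positive
    measure. *)
Lemma holder_ae_le (M : R) : (0 < n)%N ->
  {ae (mu \x mu)%E, forall z : Rn * Rn, b z.1 z.2 <= M} -> forall x y, b x y <= M.
Proof.
move=> n0 [N [mN N0 hN]] x y; rewrite leNgt; apply/negP => Mb.
have [del del0 hdel] : exists2 del, 0 < del & be * del `^ al < b x y - M.
  by apply: modulus; rewrite subr_gt0.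
pose E := eball x (del / 2) `*` eball y (del / 2).
have mE : measurable E by apply: measurableX; exact: measurable_eball.
have EN : E `<=` N.
  move=> [x' y'] [/= x'x y'y]; apply: hN => /= bM.
  have := hb x y x' y'; rewrite ler_norml => /andP[_] h.
  have e0 : 0 <= enorm (x - x') + enorm (y - y') by rewrite addr_ge0 ?enorm_ge0.
  have le : enorm (x - x') + enorm (y - y') <= del.
    rewrite [enorm (x - x')]enormBC [enorm (y - y')]enormBC.
    by move: x'x y'y; rewrite /eball /=; lra.
  have hp : (enorm (x - x') + enorm (y - y')) `^ al <= del `^ al.
    by apply: ler_wpowR; rewrite ?(ltW al0) ?(ltW del0).
  by have := ler_wpM2l be0 hp; lra.
have : ((mu \x mu) E <= (mu \x mu) N)%E.
  by apply: le_measure; rewrite ?inE.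
rewrite N0 product_measure1E; [|exact: measurable_eball|exact: measurable_eball].
have d2 : 0 < del / 2 by rewrite divr_gt0.
have pos w : (0 < mu (eball w (del / 2)))%E.
  apply: lt_le_trans (eball_measure_ge w n0 d2).
  by rewrite lte_fin exprn_gt0// divr_gt0// ltr0n.
by rewrite leNgt (mule_gt0 (pos x) (pos y)).
Qed.

(** For displacements below 1 the smaller exponent gives the larger power; above 1 the bound M on
    the oscillation is enough. *)
Lemma holder_lower_exponent (M ga : R) : (forall x y, 0 <= b x y <= M) -> 0 < ga -> ga <= al ->
  holder_coeff (be + M) ga b.
Proof.
move=> bM ga0 gaal x1 y1 x2 y2.
have M0 : 0 <= M by have /andP[] := bM x1 y1; exact: le_trans.
have e0 : 0 <= enorm (x1 - x2) + enorm (y1 - y2) by rewrite addr_ge0 ?enorm_ge0.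
have h := hb x1 y1 x2 y2; move: e0 h; set t := enorm _ + _ => e0 h.
have [t1|t1] := lerP t 1.
  apply: le_trans h _; rewrite mulrDl -[leLHS]addr0; apply: lerD; last first.
    by rewrite mulr_ge0// powR_ge0.
  apply: ler_wpM2l => //; have := e0; rewrite le_eqVlt => /predU1P[<-|tp].
    by rewrite !powR0 ?gt_eqF.
  by apply: ger_powR; rewrite ?tp.
have /andP[b1 b1'] := bM x1 y1; have /andP[b2 b2'] := bM x2 y2.
apply: (@le_trans _ _ (M * 1)); first by rewrite ler_norml; lra.
apply: ler_pM => //; first by rewrite lerDr.
by have := @ler_powR _ t (ltW t1) 0 ga (ltW ga0); rewrite powRr0.
Qed.

End holder_coefficient.

Section swap.
Context d (T : measurableType d) (R : realType).
Variable mu : {sigma_finite_measure set T -> \bar R}.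

Lemma ae_swap (P : T * T -> Prop) : {ae (mu \x mu)%E, forall z, P z} ->
  {ae (mu \x mu)%E, forall z, P (z.2, z.1)}.
Proof.
move=> [N [mN N0 hN]].
have mN' : measurable ((fun z : T * T => (z.2, z.1)) @^-1` N).
  by rewrite -[X in measurable X]setTI; exact: measurable_swap.
exists ((fun z : T * T => (z.2, z.1)) @^-1` N); split => //.
  rewrite -(setIT (_ @^-1` _)) -integral_indic//.
  have mi : measurable_fun setT (\1_N : T * T -> R) by exact: measurable_indic.
  have := @tonelli_swap _ _ _ mu (\1_N : T * T -> R) mi (fun z => ler0n _ _).
  rewrite -(tonelli_integral mu mi (fun z => ler0n _ _)).
  have -> : (\int[mu \x mu]_z (\1_N z)%:E = 0 :> \bar R)%E.
    by rewrite integral_indic// setIT; exact: N0.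
  move=> <-.
  have mi' : measurable_fun setT (\1_((fun z : T * T => (z.2, z.1)) @^-1` N) : T * T -> R).
    exact: measurable_indic.
  rewrite (tonelli_integral mu mi' (fun z => ler0n _ _)).
  apply: eq_integral => x _; apply: eq_integral => y _; rewrite !indicE.
  by congr ((nat_of_bool _)%:R%:E); apply/idP/idP => /set_mem H; exact/mem_set.
by move=> z nP; apply: (hN (z.2, z.1)).
Qed.

End swap.

(** * Weak solutions *)

Section gball_inverse.
Context {R : realType} (n : nat).
Local Notation Rn := 'rV[R]_n.
Variables (s t p M : R) (a b : Rn -> Rn -> R) (x0 : Rn) (r : R).
Hypotheses (p1 : 1 < p) (r0 : 0 < r).
Hypotheses (a1 : forall x y, a x y = 1) (bM : forall x y, 0 <= b x y <= M).

Let p10 : 0 < p - 1. Proof. by rewrite subr_gt0. Qed.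
Let p0 : 0 < p. Proof. exact: lt_trans ltr01 p1. Qed.

Definition growth : R := fine (Gball s t p a b x0 r 1).

Let center : eball x0 r x0. Proof. by rewrite /eball /= subrr enorm0. Qed.

Let Gball1E : Gball s t p a b x0 r 1 = ereal_sup
  [set ((r `^ (s * p))^-1 + b z.1 z.2 * (r `^ (t * p))^-1)%:E | z in eball x0 r `*` eball x0 r].
Proof.
rewrite /Gball; congr ereal_sup; apply: eq_imagel => z _.
by rewrite a1 powR1 !mul1r.
Qed.

Let Gball_fin : Gball s t p a b x0 r 1 \is a fin_num.
Proof.
have rt : 0 <= (r `^ (t * p))^-1 by rewrite invr_ge0 powR_ge0.
rewrite Gball1E fin_numE; apply/andP; split.
  rewrite gt_eqF//; apply: lt_le_trans (ltNyr _) _; last first.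
    apply: ereal_sup_ubound; exists (x0, x0) => //=; split; exact: center.
rewrite lt_eqF//; apply: le_lt_trans (ltry ((r `^ (s * p))^-1 + M * (r `^ (t * p))^-1)).
apply: ge_ereal_sup => _ [z _ <-]; rewrite lee_fin lerD2l ler_wpM2r//.
by case/andP: (bM z.1 z.2).
Qed.

Lemma growth_ub x y : enorm (x - x0) < r -> enorm (y - x0) < r ->
  (r `^ (s * p))^-1 + b x y * (r `^ (t * p))^-1 <= growth.
Proof.
move=> xr yr; rewrite -lee_fin /growth fineK// Gball1E.
by apply: ereal_sup_ubound; exists (x, y).
Qed.

Lemma growth_lub c : (forall x y, enorm (x - x0) < r -> enorm (y - x0) < r ->
  (r `^ (s * p))^-1 + b x y * (r `^ (t * p))^-1 <= c) -> growth <= c.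
Proof.
move=> H; rewrite -lee_fin /growth fineK// Gball1E.
by apply: ge_ereal_sup => _ [[x y] [/= xr yr] <-]; rewrite lee_fin; exact: H.
Qed.

Lemma growth_gt0 : 0 < growth.
Proof.
apply: lt_le_trans (growth_ub center center).
have /andP[b0 _] := bM x0 x0.
by rewrite ltr_pwDl ?invr_gt0 ?powR_gt0// mulr_ge0// invr_ge0 powR_ge0.
Qed.

Let gballE tau : 0 <= tau -> gball s t p a b x0 r tau = (growth * tau `^ (p - 1))%:E.
Proof.
move=> tau0; rewrite /gball.
have -> : Gball s t p a b x0 r tau = ((tau `^ p)%:E * Gball s t p a b x0 r 1)%E.
  rewrite -ereal_supZl ?powR_ge0//; last first.
    by apply/set0P; eexists; exists (x0, x0); [split; exact: center|reflexivity].
  congr ereal_sup; apply/seteqP; split => y.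
    move=> [z zB <-]; eexists; first by exists z; [exact: zB|reflexivity].
    by rewrite /= -EFinM; congr (_%:E); rewrite powR1; ring.
  move=> [_ [z zB <-] <-]; exists z => //.
  by rewrite -EFinM; congr (_%:E); rewrite powR1; ring.
rewrite -(fineK Gball_fin) -/growth -!EFinM; congr (_%:E).
have [->|taun0] := eqVneq tau 0.
  by rewrite powR0 ?gt_eqF// !mul0r powR0 ?mulr0// gt_eqF.
have tp : 0 < tau by rewrite lt_neqAle eq_sym taun0.
rewrite (@powRS _ tau p) ?(ltW tp) ?gt_eqF//; field; rewrite gt_eqF//.
Qed.

(** The partial inverse is meaningful only on the image, so an explicit preimage of T, the root of
    order p - 1 of T / growth, is exhibited first. *)
Lemma gball_invP T : (0 <= T)%E -> T \is a fin_num ->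
  let d := gball_inv s t p a b x0 r T in 0 <= d /\ T = (growth * d `^ (p - 1))%:E.
Proof.
move=> T0 Tfin d; have G0 := growth_gt0.
have im : [set gball s t p a b x0 r x | x in `[0, +oo[%classic] T.
  exists ((fine T / growth) `^ (p - 1)^-1).
    by rewrite /= in_itv /= andbT powR_ge0.
  rewrite gballE ?powR_ge0// -powRrM mulVf ?gt_eqF// powRr1; last first.
    by apply: divr_ge0; [exact: fine_ge0|exact: ltW].
  by rewrite mulrC divfK ?gt_eqF// fineK.
have dA : `[0, +oo[%classic d.
  have sj : set_surj `[0, +oo[%classic [set gball s t p a b x0 r x | x in `[0, +oo[%classic]
    (gball s t p a b x0 r) by [].
  by apply: (surjpinv_image_sub sj); exists T.
have d0 : 0 <= d by move: dA; rewrite /= in_itv /= andbT.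
split=> //; rewrite -gballE//.
by rewrite /d /gball_inv pinvK//; exact/mem_set.
Qed.

End gball_inverse.

(** * Admissibility of the test functions *)

Section test_energy.
Context {R : realType} (p Lam kap : R) (Q nn m : nat).
Context d (T : measurableType d) (mu : {sigma_finite_measure set T -> \bar R})
  (V : R) (N : T -> R) (J : T * T -> R) (u : T -> R).
Hypotheses (p1 : 1 < p) (Lam0 : 0 < Lam).
Hypotheses (sp : nonlocal_space p Lam kap Q nn mu V N J) (mU : measurable_fun setT u).
Variables (S h l : R) (Phi : R -> R).
Hypotheses (h0 : 0 < h) (h1 : h <= 1) (S9 : S + h <= 9) (mPhi : measurable_fun setT Phi).
Hypothesis Phi_lip : forall a b, `|Phi a - Phi b| <= l * `|a - b|.

Let p0 : 0 < p. Proof. exact: lt_trans ltr01 p1. Qed.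

Let l0 : 0 <= l.
Proof. by have := Phi_lip 1 0; rewrite subr0 normr1 mulr1; apply: le_trans. Qed.

Local Notation cut x := (cutoff S h (N x) ^+ m.+1).
Local Notation phi x := (cut x * Phi (u x)).

Lemma test_Lp : (\int[mu]_x ((N x < 9)%R%:R * `|u x| `^ p)%:E < +oo)%E ->
  (\int[mu]_x ((N x < 9)%R%:R * `|Phi (u x)| `^ p)%:E < +oo)%E.
Proof.
move=> fin; have mN := ns_mN sp.
apply: (@le_lt_trans _ _ (\int[mu]_x (2 `^ p * `|Phi 0| `^ p * (N x < 10)%R%:R +
    2 `^ p * l `^ p * ((N x < 9)%R%:R * `|u x| `^ p))%:E)%E).
  apply: le_integral_EFin => x; first by nneg.
  have [Nx|Nx] := ltrP (N x) 9; last by rewrite !mul0r mulr0 addr0; nneg.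
  have -> : (N x < 10) = true by lra.
  rewrite !mul1r mulr1; apply: (@le_trans _ _ ((`|Phi 0| + l * `|u x|) `^ p)).
    apply: ler_wpowR; rewrite ?(ltW p0)//.
    have := Phi_lip (u x) 0; rewrite subr0 => H.
    by apply: le_trans (lerD (lexx _) H); rewrite -lerBlDl; apply: le_trans (lerB_dist _ _).
  apply: le_trans (powRD_le (ltW p0) _ _) _; [by nneg|by nneg|].
  by rewrite mulrDr powRM// mulrA.
split_sum.
pull_const.
pull_const.
apply: lte_add_pinfty; (apply: lte_mul_pinfty; [by rewrite lee_fin; nneg|by []|]) => //.
by rewrite integral_lt_indic//; apply: le_lt_trans (ns_ball10 sp) _; rewrite ltry.
Qed.

(** Product rule: the increment of the cutoff times Phi(u) is integrated with [ns_upper], and the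
    cutoff times the increment of Phi(u) is bounded by the energy of u. Only pairs with a point
    inside radius 9 contribute. *)
Lemma test_seminorm :
  (\int[mu]_x ((N x < 9)%R%:R * `|Phi (u x)| `^ p)%:E < +oo)%E ->
  (\int[mu \x mu]_z (((N z.1 < 9)%R%:R + (N z.2 < 9)%R%:R) *
     `|u z.1 - u z.2| `^ p * J z)%:E < +oo)%E ->
  (\int[mu \x mu]_z (`|phi z.1 - phi z.2| `^ p * J z)%:E < +oo)%E.
Proof.
move=> fin Ju; have mN := ns_mN sp; have mJ := ns_mJ sp; have J0 := ns_J0 sp.
pose K : R := 2 `^ p * (m.+1%:R / h) `^ p.
pose g (z : T * T) := K * ((N z.1 < 9)%R%:R * `|Phi (u z.1)| `^ p *
  (minr 1 `|N z.1 - N z.2| `^ p * J z)).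
pose e (z : T * T) := 2 `^ p * l `^ p * (((N z.1 < 9)%R%:R + (N z.2 < 9)%R%:R) *
     `|u z.1 - u z.2| `^ p * J z).
have K0 : 0 <= K by rewrite /K; nneg.
have g0 z : 0 <= g z by rewrite /g; nneg.
have e0 z : 0 <= e z by rewrite /e; nneg.
have cut_lip x y : `|cut x - cut y| <= m.+1%:R / h * minr 1 `|N x - N y|.
  have /andP[c0 c1] := cutoff01 S h (N x); have /andP[c0' c1'] := cutoff01 S h (N y).
  apply: (@le_trans _ _ (m.+1%:R * `|cutoff S h (N x) - cutoff S h (N y)|)); last first.
    rewrite -mulrA ler_wpM2l// mulrC; exact: cutoff_lipschitz.
  have aux (X Y : R) : 0 <= X -> X <= Y -> Y <= 1 -> `|X ^+ m.+1 - Y ^+ m.+1| <= m.+1%:R * `|X - Y|.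
    move=> X0 XY Y1; rewrite distrC [`|X - Y|]distrC.
    have Y0 := le_trans X0 XY.
    have XYm : X ^+ m.+1 <= Y ^+ m.+1 by rewrite lerXn2r// nnegrE.
    rewrite (ger0_norm (x := Y - X)) ?subr_ge0// (ger0_norm (x := _ - _)) ?subr_ge0//.
    have H := exprB_le m X0 XY; apply: (le_trans H); rewrite ler_wpM2r ?subr_ge0// ler_piMr//.
    by rewrite exprn_ile1.
  have /orP[xy|xy] := le_total (cutoff S h (N x)) (cutoff S h (N y)); first exact: aux.
  by rewrite distrC [X in _ * X]distrC; exact: aux.
have c0 x y : 0 <= m.+1%:R / h * minr 1 `|N x - N y| := le_trans (normr_ge0 _) (cut_lip x y).
have near x y : N x < 9 -> `|phi x - phi y| `^ p * J (x, y) <= g (x, y) + e (x, y).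
  move=> Nx; have /andP[cy0 cy1] := cutoffX01 S h (N y) m.+1.
  apply: (@le_trans _ _ ((2 `^ p * ((m.+1%:R / h * minr 1 `|N x - N y| * `|Phi (u x)|) `^ p +
     (l * `|u x - u y|) `^ p)) * J (x, y))).
    apply: ler_wpM2r => //; apply: le_trans (powRD_le (ltW p0) _ _); [|by rewrite mulr_ge0|by nneg].
    apply: ler_wpowR; rewrite ?(ltW p0)//.
    have -> : phi x - phi y = (cut x - cut y) * Phi (u x) + cut y * (Phi (u x) - Phi (u y)) by ring.
    apply: le_trans (ler_normD _ _) _; rewrite !normrM; apply: lerD.
      by rewrite ler_wpM2r.
    rewrite (ger0_norm cy0) -[leRHS]mul1r; apply: ler_pM => //.
  rewrite /g /e /= Nx mul1r mulrDr mulrDl; apply: lerD.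
    rewrite (powRM _ (c0 x y))// powRM ?divr_ge0 ?(ltW h0)//.
    by rewrite /K; apply: le_of_eq; ring.
  rewrite powRM//; set D := `|u x - u y| `^ p.
  rewrite (_ : _ * J (x, y) = 2 `^ p * l `^ p * (D * J (x, y))); last by ring.
  by apply: ler_wpM2l; [nneg|rewrite -mulrA ler_peMl ?lerDl// /D; nneg].
have esym x y : e (y, x) = e (x, y).
  by rewrite /e /= distrC (ns_sym sp) (addrC (N x < 9)%R%:R).
have ptw z : `|phi z.1 - phi z.2| `^ p * J z <= g z + g (z.2, z.1) + e z.
  case: z => x y /=; have [Nx|Nx] := ltrP (N x) 9.
    by apply: le_trans (near x y Nx) _; have := g0 (y, x); lra.
  have [Ny|Ny] := ltrP (N y) 9.
    rewrite distrC (ns_sym sp); apply: le_trans (near y x Ny) _.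
    by rewrite esym; have := g0 (x, y); lra.
  rewrite (cutoff_eq0 h0 (le_trans S9 Nx)) (cutoff_eq0 h0 (le_trans S9 Ny)) expr0n /=.
  by rewrite !mul0r subrr normr0 powR0 ?gt_eqF// mul0r !addr_ge0.
have mg : measurable_fun setT g by rewrite /g; mfun.
have me : measurable_fun setT e by rewrite /e; mfun.
have mgs : measurable_fun setT (fun z : T * T => g (z.2, z.1)).
  by apply: (measurableT_comp mg); mfun.
apply: (@le_lt_trans _ _ (\int[mu \x mu]_z (g z + g (z.2, z.1) + e z)%:E)%E).
  by apply: le_integral_EFin => // z; nneg.
have gfin : (\int[mu]_x \int[mu]_y (g (x, y))%:E < +oo)%E.
  apply: (@le_lt_trans _ _ (\int[mu]_x (K * Lam * ((N x < 9)%R%:R * `|Phi (u x)| `^ p))%:E)%E).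
    apply: le_integral_inner => x; first exact: integral_EFin_ge0.
    have [Nx|Nx] := ltrP (N x) 9; last first.
      rewrite mul0r mulr0 integral0_eq// => y _.
      by rewrite /g /= ltNge Nx /= !mul0r mulr0.
    rewrite /g /= Nx; under eq_integral do rewrite mulrA.
    have mJx : measurable_fun setT (fun y => minr 1 `|N x - N y| `^ p * J (x, y)) by mfun.
    rewrite integral_EFinZ//; [|by nneg|by nneg].
    rewrite mul1r (_ : K * Lam * _ = K * `|Phi (u x)| `^ p * Lam); last by ring.
    by apply: EFin_mul_le; [nneg|apply: (ns_upper sp); lra].
  pull_const.
  by apply: lte_mul_pinfty => //; rewrite lee_fin; nneg.
rewrite integral_EFinD//; [|exact: measurable_funD|by move=> z; rewrite addr_ge0].
apply: lte_add_pinfty; last first.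
  rewrite /e integral_EFinZ; [|by nneg|by mfun|by nneg].
  by apply: lte_mul_pinfty => //; rewrite lee_fin; nneg.
rewrite integral_EFinD//; apply: lte_add_pinfty; first by rewrite tonelli_integral.
have g0s z : 0 <= g (z.2, z.1) by [].
by rewrite (tonelli_integral mu mgs g0s) (tonelli_swap mu mg g0).
Qed.

End test_energy.

(** * Replacing almost everywhere data by everywhere defined ones *)

Section almost_everywhere.
Context d (T : measurableType d) (R : realType) (mu : {sigma_finite_measure set T -> \bar R}).

Lemma ae_fst (P : T -> Prop) : {ae mu, forall x, P x} ->
  {ae (mu \x mu)%E, forall z, P z.1}.
Proof.
move=> [N [mN N0 hN]]; exists (N `*` setT); split.
- exact: measurableX.
- by rewrite product_measure1E//= [X in (X * _)%E]N0 mul0e.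
- by move=> z hz; split => //; exact: hN.
Qed.

Lemma ae_fst_snd (P : T -> Prop) : {ae mu, forall x, P x} ->
  {ae (mu \x mu)%E, forall z, P z.1 /\ P z.2}.
Proof.
by move=> hP; have h1 := ae_fst hP; apply: filterS2 h1 (ae_swap h1) => z /=.
Qed.

(** The pointwise inequalities need nonnegativity at every point of the ball and a function
    measurable without completion; truncating a representative at 0 on B gives both. *)
Lemma ae_nonneg_representative (B : set T) (u : T -> R) : measurable B ->
  ae_measurable mu u -> {ae mu, forall x, B x -> 0 <= u x} ->
  exists v : T -> R, [/\ measurable_fun setT v, (forall x, B x -> 0 <= v x) &
    {ae mu, forall x, u x = v x}].
Proof.
move=> mB [g mg ug] u0.
exists (fun x => g x + \1_B x * (maxr 0 (g x) - g x)); split.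
- by apply: measurable_funD => //; apply: measurable_funM => //; mfun.
- move=> x Bx; rewrite indicE mem_set// mul1r addrC subrK.
  by rewrite le_max lexx.
- apply: filterS2 ug u0 => x ux u0.
  have [Bx|nBx] := pselect (B x).
    by rewrite indicE mem_set// mul1r addrC subrK -ux; apply/esym/max_idPr/u0.
  by rewrite indicE memNset// mul0r addr0.
Qed.

(* The almost everywhere bounds on a kernel are made pointwise by averaging it
   over the two orders of the variables and clamping the result. *)
Lemma symmetric_representative (K : T -> T -> R) (k : T * T -> R) (P : set (T * T)) (nu L : R) :
  0 <= nu -> nu <= L -> measurable_fun setT k -> (forall z, 0 <= k z) ->
  (forall x y, k (x, y) = k (y, x)) ->
  ae_measurable (mu \x mu)%E (fun z => K z.1 z.2) -> (forall x y, K x y = K y x) ->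
  {ae (mu \x mu)%E, forall z, P z -> nu * k z <= K z.1 z.2 <= L * k z} ->
  exists J : T * T -> R, [/\ measurable_fun setT J, (forall x y, J (x, y) = J (y, x)),
    (forall x y, nu * k (x, y) <= J (x, y) <= L * k (x, y)) &
    {ae (mu \x mu)%E, forall z, P z -> K z.1 z.2 = J z}].
Proof.
move=> nu0 nuL mk k0 ksym [g mg Kg] Ksym Kk.
exists (fun z => maxr (nu * k z) (minr (L * k z) ((g z + g (z.2, z.1)) / 2))); split.
- have mgs : measurable_fun setT (fun z : T * T => g (z.2, z.1)).
    by apply: (measurableT_comp mg); mfun.
  by mfun.
- by move=> x y /=; rewrite ksym (addrC (g (x, y))).
- move=> x y /=; rewrite le_max lexx /= ge_max ler_wpM2r//= ge_min lexx//.
- apply: filterS3 Kg (ae_swap Kg) Kk => z gz gz' kz Pz.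
  have /andP[l1 l2] := kz Pz.
  rewrite -gz -gz' /= (Ksym z.2).
  have -> : (K z.1 z.2 + K z.1 z.2) / 2 = K z.1 z.2 by field.
  by rewrite (min_idPr l2) (max_idPr l1).
Qed.

End almost_everywhere.

(** * From the weak equation to the abstract setting *)

Section solution.
Context {R : realType} (n : nat).
Local Notation Rn := 'rV[R]_n.
Local Notation mu := (@lebesgue_rV R n).
Local Notation mu2 := (mu \x mu)%E.
Variables (s t p nu L M bet : R) (m : nat).
Hypotheses (n0 : (0 < n)%N) (s0 : 0 < s) (st : s < t) (t1 : t < 1) (p1 : 1 < p).
Hypotheses (stp : t * p - s * p <= 1) (pm : p <= m.+1%:R).
Hypotheses (nu0 : 0 < nu) (L1 : 1 <= L) (bet0 : 0 <= bet).
Variables (Omega : set Rn) (Ksp Ktp a b : Rn -> Rn -> R) (u v : Rn -> R) (x0 : Rn) (r : R).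
Hypotheses (a1 : forall x y, a x y = 1) (bM : forall x y, 0 <= b x y <= M).
Hypotheses (bsym : forall x y, b x y = b y x) (mb : measurable_fun setT (fun z : Rn * Rn => b z.1 z.2)).
Hypothesis b_holder : holder_coeff bet (t * p - s * p) b.
Hypotheses (r0 : 0 < r) (sub : forall x, enorm (x - x0) < 10 * r -> Omega x).
Hypotheses (sol : weak_solution s t p Ksp Ktp a b Omega u) (tail : tail_space s t p a b u).
Variable J1 : Rn * Rn -> R.
Local Notation k := (fun z : Rn * Rn => model (s * p) (t * p) r b z.1 z.2).
Hypotheses (mJ1 : measurable_fun setT J1) (symJ1 : forall x y, J1 (x, y) = J1 (y, x)).
Hypothesis J1_bounds : forall x y, nu * k (x, y) <= J1 (x, y) <= L * k (x, y).
Hypothesis J1_ae : {ae mu2, forall z, z.1 != z.2 ->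
  a z.1 z.2 * Ksp z.1 z.2 + b z.1 z.2 * Ktp z.1 z.2 = J1 z}.
Hypotheses (mv : measurable_fun setT v) (v0 : forall x, enorm (x - x0) < 10 * r -> 0 <= v x).
Hypothesis uv : {ae mu, forall x, u x = v x}.

Local Notation G := (growth s t p a b x0 r).
Local Notation N x := (enorm (x - x0) / r).
Local Notation J := (fun z => J1 z / G).
Local Notation Lam := (space_const n p (s * p) (t * p) nu L bet m).

Let p0 : 0 < p. Proof. exact: lt_trans ltr01 p1. Qed.
Let pn0 : p != 0. Proof. by rewrite gt_eqF. Qed.
Let sg0 : 0 < s * p. Proof. exact: mulr_gt0. Qed.
Let sgtu : s * p < t * p. Proof. by rewrite ltr_pM2r. Qed.
Let tup : t * p < p. Proof. by rewrite gtr_pMl. Qed.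
Let tu0 : 0 < t * p. Proof. exact: lt_trans sg0 sgtu. Qed.
Let G0 : 0 < G. Proof. exact: (growth_gt0 s t p x0 r0 a1 bM). Qed.
Let b0 x y : 0 <= b x y. Proof. by case/andP: (bM x y). Qed.
Let k0 z : 0 <= k z. Proof. exact: model_ge0. Qed.
Let L0 : 0 < L. Proof. exact: lt_le_trans ltr01 L1. Qed.

Lemma solution_space : nonlocal_space p Lam (s * p / n%:R) (n + m.+2) n mu
  (r ^+ n) (fun x : Rn => N x) J.
Proof.
apply: (model_nonlocal_space n0 sg0 sgtu tup stp pm nu0 L1 bet0 b0 b_holder r0 G0 _ _ mJ1 symJ1) => //.
- by move=> x y; exact: (growth_ub s t p r0 a1 bM).
- by move=> c; exact: (growth_lub r0 a1 bM).
Qed.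
Let sp := solution_space.

Let N_Omega x : N x < 10 -> Omega x.
Proof. by rewrite ltr_pdivrMr// => /sub. Qed.

Let v_ge0 x : N x < 10 -> 0 <= v x.
Proof. by rewrite ltr_pdivrMr// => /v0. Qed.

Local Notation density f z := (a z.1 z.2 * (`|f z.1 - f z.2| `^ p /
                         enorm (z.1 - z.2) `^ (n%:R + s * p)) +
          b z.1 z.2 * (`|f z.1 - f z.2| `^ p /
                         enorm (z.1 - z.2) `^ (n%:R + t * p))).

Let model_off z : z.1 != z.2 -> k z = (enorm (z.1 - z.2) `^ (n%:R + s * p))^-1 +
   b z.1 z.2 * (enorm (z.1 - z.2) `^ (n%:R + t * p))^-1.
Proof. by move=> z12; rewrite /model /dist enorm_eq0 subr_eq0 (negPf z12). Qed.

Let density_ge0 (f : Rn -> R) (z : Rn * Rn) : 0 <= density f z.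
Proof. by rewrite a1 addr_ge0// mulr_ge0// divr_ge0 ?powR_ge0. Qed.

Let densityE (f : Rn -> R) z : density f z = `|f z.1 - f z.2| `^ p * k z.
Proof.
have [->|z12] := eqVneq z.1 z.2.
  by rewrite !subrr normr0 powR0// !mul0r !mulr0 addr0.
by rewrite model_off// a1; ring.
Qed.

Let v_Lp : (\int[mu]_x ((N x < 9)%R%:R * `|v x| `^ p)%:E < +oo)%E.
Proof.
have [_ uLp _] := sol.1; apply: le_lt_trans uLp; rewrite [leRHS]integral_mkcond.
apply: ae_le_integral_inner.
- by move=> x; rewrite lee_fin; nneg.
- by move=> x; rewrite /patch; case: ifP => // _; rewrite lee_fin powR_ge0.
- apply: filterS uv => x <-; rewrite /patch.
  have [Nx|Nx] := ltrP (N x) 9; last first.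
    by rewrite mul0r; case: ifP => // _; rewrite lee_fin powR_ge0.
  by rewrite mul1r mem_set//; apply: N_Omega; lra.
Qed.

Let mk : measurable_fun setT k.
Proof. by have := measurable_dist (n := n) r; rewrite /model => mD; mfun. Qed.

Let v_seminorm : (\int[mu2]_z (((N z.1 < 9)%R%:R + (N z.2 < 9)%R%:R) *
     `|v z.1 - v z.2| `^ p * J z)%:E < +oo)%E.
Proof.
have mN1 : measurable_fun setT (fun z : Rn * Rn => enorm (z.1 - x0)).
  by apply: measurable_enorm; [exact: measurable_fst|exact: measurable_cst].
have mN2 : measurable_fun setT (fun z : Rn * Rn => enorm (z.2 - x0)).
  by apply: measurable_enorm; [exact: measurable_snd|exact: measurable_cst].
(* The sum of the two indicators is at most 2 and vanishes outside the domain of integration of the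
   energy; halved, it lies below the indicator of that domain. *)
pose f (z : Rn * Rn) : R := ((N z.1 < 9)%R%:R + (N z.2 < 9)%R%:R) / 2 *
  (`|v z.1 - v z.2| `^ p * k z).
have f0 z : 0 <= f z by rewrite /f; nneg.
apply: (@le_lt_trans _ _ (\int[mu2]_z (2 * L / G * f z)%:E)%E).
  apply: le_integral_EFin => z.
    by have := ns_J0 sp z; nneg.
  have -> : 2 * L / G * f z = ((N z.1 < 9)%R%:R + (N z.2 < 9)%R%:R) *
    `|v z.1 - v z.2| `^ p * (L * k z / G) by rewrite /f; field; rewrite gt_eqF.
  apply: ler_wpM2l; first by nneg.
  rewrite ler_wpM2r ?invr_ge0 ?(ltW G0)//; case: z => x y.
  by case/andP: (J1_bounds x y).
rewrite integral_EFinZ//; [|by rewrite !mulr_ge0 ?invr_ge0 ?ltW|]; last first.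
  by rewrite /f; mfun.
apply: lte_mul_pinfty => //; first by rewrite lee_fin !mulr_ge0 ?invr_ge0 ?ltW.
have [_ _ ufin] := sol.1; apply: le_lt_trans ufin; rewrite [leRHS]integral_mkcond.
apply: ae_le_integral_inner.
- by move=> z; rewrite lee_fin.
- by move=> z; rewrite /patch; case: ifP => // _; rewrite lee_fin.
- apply: filterS (ae_fst_snd uv) => z [u1 u2]; rewrite /patch.
  case: ifPn => [_|]; rewrite lee_fin.
    rewrite densityE u1 u2 /f ler_piMl ?mulr_ge0 ?powR_ge0// ler_pdivrMr// mul1r.
    by apply: lerD; rewrite lern1 leq_b1.
  move=> /negP zC; rewrite /f !ltNge.
  have [N1|N1] := ltrP (N z.1) 9.
    by case: zC; apply/mem_set => -[/= O1 _]; apply: O1; apply: N_Omega; lra.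
  have [N2|N2] := ltrP (N z.2) 9.
    by case: zC; apply/mem_set => -[/= _ O2]; apply: O2; apply: N_Omega; lra.
  by rewrite /= addr0 !mul0r.
Qed.

Lemma solution_weak_form : weak_form p m mu (fun x : Rn => N x) J v.
Proof.
move=> S h Phi l S1 h0 h1 S9 mPhi Phi_lip.
(* The normalisation 1 / G of the kernel is moved into the test function, so that the original
   equation applies. *)
pose phi (f : Rn -> R) (x : Rn) : R := cutoff S h (N x) ^+ m.+1 * (Phi (f x) / G).
have phi0 f x : 9 <= N x -> phi f x = 0.
  by move=> Nx; rewrite /phi (cutoff_eq0 h0 (le_trans S9 Nx)) expr0n mul0r.
have out x : ~ Omega x -> 9 <= N x.
  by move=> Ox; rewrite leNgt; apply/negP => Nx; apply: Ox; apply: N_Omega; lra.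
have PhiG_lip c d : `|Phi c / G - Phi d / G| <= l / G * `|c - d|.
  rewrite -mulrBl normrM [`|G^-1|]gtr0_norm ?invr_gt0// mulrAC.
  by rewrite ler_wpM2r ?invr_ge0 ?(ltW G0).
have mPhiG : measurable_fun setT (fun c => Phi c / G) by mfun.
have mN := ns_mN sp.
have mphi : measurable_fun setT (phi v).
  by have mPv := measurableT_comp mPhi mv; rewrite /phi /cutoff; mfun.
have phi_Lp := test_Lp p1 sp mv PhiG_lip v_Lp.
have phi_fin := test_seminorm m p1 (space_const_gt0 m n0 sg0 tup nu0 L1 bet0) sp mv h0 h1 S9 mPhiG PhiG_lip phi_Lp v_seminorm.
have phi_energy : energy_space s t p a b Omega (phi v).
  split; first by exists (phi v) => //; exact: aeW.
    apply: le_lt_trans phi_Lp; rewrite [leLHS]integral_mkcond.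
    apply: le_integral_inner => x.
      by rewrite /patch; case: ifP => // _; rewrite lee_fin powR_ge0.
    rewrite /patch; case: ifP => _; rewrite lee_fin; last by nneg.
    have [Nx|Nx] := ltrP (N x) 9; last by rewrite phi0// normr0 powR0// mul0r.
    rewrite mul1r; apply: ler_wpowR; rewrite ?(ltW p0)//.
    by have /andP[c0 c1] := cutoffX01 S h (N x) m.+1; rewrite /phi normrM ger0_norm// ler_piMl.
  apply: (@le_lt_trans _ _ (\int[mu2]_z (G / nu * (`|phi v z.1 - phi v z.2| `^ p * J z))%:E)%E).
    rewrite [leLHS]integral_mkcond; apply: le_integral_inner => z.
      by rewrite /patch; case: ifP => // _; rewrite lee_fin.
    have gJ : density (phi v) z <= G / nu * (`|phi v z.1 - phi v z.2| `^ p * J z).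
      rewrite densityE (_ : G / nu * _ = `|phi v z.1 - phi v z.2| `^ p * (J1 z / nu)).
        rewrite ler_wpM2l ?powR_ge0// ler_pdivlMr// mulrC; case: z => x y.
        by case/andP: (J1_bounds x y).
      by field; rewrite !gt_eqF.
    rewrite /patch; case: ifP => _; rewrite lee_fin//.
    exact: le_trans (density_ge0 _ _) gJ.
  have J0 := ns_J0 sp; have mJ := ns_mJ sp.
  rewrite integral_EFinZ; [|by nneg|by mfun|]; last first.
    by move=> z; apply: mulr_ge0; [nneg|exact: J0].
  by apply: lte_mul_pinfty => //; rewrite lee_fin; nneg.
have phi_out : {ae mu, forall x, ~ Omega x -> phi v x = 0}.
  by apply: aeW => x Ox; apply: phi0; exact: out.
have [_ /(_ _ phi_energy phi_out)] := sol.
rewrite integral_mkcond => <-; apply: ae_eq_integral_inner.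
apply: filterS2 (ae_fst_snd uv) J1_ae => z [u1 u2] Kz.
rewrite /patch; case: ifPn => [_|].
  rewrite u1 u2; congr (_%:E).
  (* The kernels are identified off the diagonal only; on it the integrand vanishes. *)
  have [z12|z12] := eqVneq z.1 z.2.
    by rewrite /Jp z12 !subrr !mulr0 !mul0r.
  by rewrite (Kz z12) /Jp /phi; ring.
move=> /negP zC.
have [zO1 zO2] : ~ Omega z.1 /\ ~ Omega z.2.
  by split => O; apply: zC; apply/mem_set => -[].
rewrite (cutoff_eq0 h0 (le_trans S9 (out _ zO1))) (cutoff_eq0 h0 (le_trans S9 (out _ zO2))).
by rewrite expr0n /= !mul0r subrr mulr0 mul0r.
Qed.

Local Notation tail_neg := (nonlocal_tail s t p a b (u^\-) x0 (10 * r) (10 * r)).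
Local Notation gap := (gball_inv s t p a b x0 r tail_neg).

Let r10 : 0 < 10 * r. Proof. exact: mulr_gt0. Qed.

Local Notation tail_term f x y := (
  a x y * (`|f y| `^ (p - 1) / enorm (y - x0) `^ (n%:R + s * p)) +
       b x y * (`|f y| `^ (p - 1) / enorm (y - x0) `^ (n%:R + t * p))).

Let tail_term_ge0 (f : Rn -> R) x y : 0 <= tail_term f x y.
Proof. by rewrite a1 addr_ge0// mulr_ge0// divr_ge0 ?powR_ge0. Qed.

Let tail_neg_fin : (0 <= tail_neg)%E /\ tail_neg \is a fin_num.
Proof.
have T0 : (0 <= tail_neg)%E.
  apply: le_trans (ereal_sup_ubound _); last first.
    by exists x0; [rewrite /eball /= subrr enorm0|reflexivity].
  by apply: integral_ge0 => y _; rewrite lee_fin.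
split => //; rewrite ge0_fin_numE//.
have [_ _ /(_ x0 _ _ r10 r10)] := tail; apply: le_lt_trans.
apply: ge_ereal_sup => _ [x xr <-].
apply: (@le_trans _ _ (\int[mu]_(y in ~` eball x0 (10 * r))
  (tail_term u x y)%:E)%E); last first.
  by apply: ereal_sup_ubound; exists x.
rewrite [leLHS]integral_mkcond [leRHS]integral_mkcond.
apply: le_integral_inner => y.
  by rewrite /patch; case: ifP => // _; rewrite lee_fin.
rewrite /patch; case: ifP => // _; rewrite lee_fin.
have uu : `|(u^\-) y| `^ (p - 1) <= `|u y| `^ (p - 1).
  apply: ler_wpowR; rewrite ?subr_ge0 ?(ltW p1)//.
  rewrite /funrneg ger0_norm ?le_max ?lexx ?orbT// ge_max normr_ge0 andbT.
  by rewrite -normrN ler_norm.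
by apply: lerD; apply: ler_wpM2l; rewrite ?a1//; apply: ler_wpM2r; rewrite ?invr_ge0 ?powR_ge0.
Qed.

Lemma solution_gap_ge0 : 0 <= gap.
Proof.
by have [T0 Tfin] := tail_neg_fin; case: (gball_invP s t x0 p1 r0 a1 bM T0 Tfin).
Qed.

(** With x inside radius 9 and y outside 10, |y - x0| <= 10 |x - y|, which costs 10^(n + m + 1) and
    turns the kernel into the weight of the tail. The tail equals G gap^(p-1), so the normalisation
    by G cancels. *)
Lemma solution_tail x : N x < 9 -> (\int[mu]_y ((10 <= N y)%R%:R * maxr 0 (- v y) `^ (p - 1) * J (x, y))%:E <=
   (Lam * gap `^ (p - 1))%:E)%E.
Proof.
move=> Nx; have rp := r0; have [T0 Tfin] := tail_neg_fin.
have [d0 TE] := gball_invP s t x0 p1 r0 a1 bM T0 Tfin.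
have mE : measurable_fun setT (fun y : Rn => enorm (y - x0)).
  by apply: measurable_enorm; [exact: measurable_id|exact: measurable_cst].
have mbx : measurable_fun setT (b x) by exact: (measurableT_comp mb (pair1_measurable x)).
pose W (y : Rn) : R := (10 <= N y)%R%:R * maxr 0 (- v y) `^ (p - 1) *
  ((enorm (y - x0) `^ (n%:R + s * p))^-1 + b x y * (enorm (y - x0) `^ (n%:R + t * p))^-1).
have W0 y : 0 <= W y.
  by rewrite /W mulr_ge0//; [nneg|rewrite addr_ge0 ?mulr_ge0 ?invr_ge0 ?powR_ge0].
have mW : measurable_fun setT W by rewrite /W; mfun.
have WT : (\int[mu]_y (W y)%:E <= tail_neg)%E.
  have xr : eball x0 (10 * r) x by move: Nx; rewrite ltr_pdivrMr// /eball /=; lra.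
  apply: le_trans (ereal_sup_ubound _); last by exists x; [exact: xr|reflexivity].
  rewrite [leRHS]integral_mkcond; apply: ae_le_integral_inner.
  - by move=> y; rewrite lee_fin.
  - by move=> y; rewrite /patch; case: ifP => // _; rewrite lee_fin.
  - apply: filterS uv => y uvy; rewrite /patch /W.
    have [Ny|Ny] := lerP 10 (N y); last first.
      by rewrite !mul0r; case: ifP => // _; rewrite lee_fin.
    rewrite mem_set; last first.
      by rewrite /eball /= => H; move: Ny; rewrite ler_pdivlMr//; lra.
    rewrite lee_fin a1 /funrneg uvy ger0_norm ?le_max ?lexx ?orbT//.
    by rewrite maxC !mul1r; apply: le_of_eq; ring.
apply: (@le_trans _ _ (\int[mu]_y (L * 10 ^+ (n + m.+1) / G * W y)%:E)%E).
  apply: le_integral_EFin => y.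
    by rewrite mulr_ge0//; [nneg|exact: (ns_J0 sp)].
  rewrite /W; have [Ny|Ny] := lerP 10 (N y); last by rewrite !mul0r mulr0.
  have Jk : J (x, y) <= L * k (x, y) / G.
    by rewrite ler_wpM2r ?invr_ge0 ?(ltW G0)//; case/andP: (J1_bounds x y).
  have far : enorm (y - x0) <= 10 * enorm (x - y).
    move: Nx Ny; rewrite ltr_pdivrMr// ler_pdivlMr// => Nx Ny.
    by have := enorm_triangle3 y x x0; rewrite (enormBC y x); lra.
  have y0 : 0 < enorm (y - x0) by move: Ny; rewrite ler_pdivlMr//; lra.
  have xy0 : 0 < enorm (x - y) by lra.
  have xy : x != y by rewrite -subr_eq0 -enorm_eq0 gt_eqF.
  have pw e : 0 <= e -> e <= p -> (enorm (x - y) `^ (n%:R + e))^-1 <=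
      10 ^+ (n + m.+1) * (enorm (y - x0) `^ (n%:R + e))^-1.
    move=> e0 ep; rewrite ler_pdivlMr ?powR_gt0// mulrC ler_pdivrMr ?powR_gt0//.
    apply: le_trans (ge0_ler_powR _ _ _ far) _; rewrite ?nnegrE ?enorm_ge0//.
    - by rewrite addr_ge0.
    - by rewrite mulr_ge0// enorm_ge0.
    rewrite powRM ?enorm_ge0// ler_wpM2r ?powR_ge0// -powR_mulrn//.
    by apply: ler_powR; [lra|rewrite natrD lerD2l; exact: le_trans ep pm].
  have kW : k (x, y) <= 10 ^+ (n + m.+1) * ((enorm (y - x0) `^ (n%:R + s * p))^-1 +
      b x y * (enorm (y - x0) `^ (n%:R + t * p))^-1).
    rewrite (model_off (z := (x, y)) xy) mulrDr; apply: lerD.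
      by apply: pw; [exact: ltW|exact: ltW (lt_trans sgtu tup)].
    by rewrite mulrCA ler_wpM2l//; apply: pw; exact: ltW.
  rewrite !mul1r [leRHS]mulrCA; apply: ler_wpM2l; first exact: powR_ge0.
  apply: le_trans Jk _; rewrite [leRHS]mulrAC ler_wpM2r ?invr_ge0 ?(ltW G0)//.
  by rewrite -[leRHS]mulrA ler_wpM2l ?(ltW L0).
rewrite integral_EFinZ; [|by nneg|by []|by []].
rewrite TE in WT.
apply: le_trans (EFin_mul_le _ WT) _; first by nneg.
rewrite lee_fin (_ : _ / G * _ = L * 10 ^+ (n + m.+1) * gap `^ (p - 1)); last first.
  by field; rewrite gt_eqF.
by rewrite ler_wpM2r ?powR_ge0//; exact: (space_const_ge_tail m n0 sg0 tup nu0 L1 bet0).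
Qed.

Let v_shift_fin dd : 0 < dd -> (\int[mu]_x ((N x < 9)%R%:R * (v x + dd) `^ p)%:E < +oo)%E.
Proof.
move=> dd0; have lip c d : `|(c + dd) - (d + dd)| <= 1 * `|c - d|.
  by rewrite mul1r opprD addrACA subrr addr0.
apply: le_lt_trans (test_Lp p1 solution_space mv lip v_Lp); apply: le_integral_EFin => x.
  by nneg.
have [Nx|Nx] := ltrP (N x) 9; last by rewrite !mul0r.
by rewrite ger0_norm// addr_ge0 ?(ltW dd0)//; apply: v_ge0; lra.
Qed.

Lemma solution_harnack (c1 c2 : R) : 0 < c1 -> 0 < c2 ->
  (forall dd, 0 < dd -> weak_form p m mu (fun x : Rn => N x) J v ->
    (forall x, N x < 9 ->
      (\int[mu]_y ((10 <= N y)%R%:R * maxr 0 (- v y) `^ (p - 1) * J (x, y))%:E <=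
       (Lam * dd `^ (p - 1))%:E)%E) ->
    (\int[mu]_x ((N x < 9)%R%:R * (v x + dd) `^ p)%:E < +oo)%E ->
    exists2 k, 0 < k & {ae mu, forall x, N x < 1 -> c1 * k <= v x + dd <= c2 * k}) ->
  (ess_sup_on mu (eball x0 r) u <=
     (c2 / c1)%:E * ess_inf_on mu (eball x0 r) u + (c2 / c1 * gap)%:E)%E.
Proof.
move=> c10 c20 hm; set c := c2 / c1; have c0 : 0 < c by rewrite divr_gt0.
apply/lee_addgt0Pr => e e0; have g0 := solution_gap_ge0.
(* The surplus keeps the shift positive when the tail vanishes and costs exactly e in the final
   inequality. *)
pose dd := gap + e / c; have ec0 : 0 < e / c by rewrite divr_gt0.
have dd0 : 0 < dd by rewrite ltr_wpDl.
have [|k kp hk] := hm dd dd0 solution_weak_form _ (v_shift_fin dd0).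
  move=> x Nx; apply: le_trans (solution_tail Nx) _; rewrite lee_fin ler_wpM2l//.
    exact: ltW (space_const_gt0 m n0 sg0 tup nu0 L1 bet0).
  by apply: ler_wpowR; rewrite ?subr_ge0 ?(ltW p1) ?(ltW dd0)// lerDl ltW.
have in1 x : eball x0 r x -> N x < 1 by rewrite ltr_pdivrMr// mul1r.
have sup_le : (ess_sup_on mu (eball x0 r) u <= (c2 * k)%:E)%E.
  apply: ereal_inf_lbound; apply: filterS2 hk uv => x hx -> /in1 /hx /andP[_].
  by rewrite lee_fin; lra.
have inf_ge : ((c1 * k - dd)%:E <= ess_inf_on mu (eball x0 r) u)%E.
  apply: ereal_sup_ubound; apply: filterS2 hk uv => x hx -> /in1 /hx /andP[+ _].
  by rewrite lee_fin; lra.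
apply: le_trans sup_le _.
have -> : c2 * k = c * (c1 * k - dd) + c * gap + e.
  by rewrite /dd /c; field; rewrite !gt_eqF.
rewrite EFinD (EFinD (c * _)) EFinM; do 2 (apply: leeD => //).
by apply: lee_wpmul2l => //; rewrite lee_fin ltW.
Qed.

End solution.

(** * Choice of the constants and conclusion *)

Unset Implicit Arguments.

Theorem theorem1p4 (R : realType) (n : nat) (s t p nu L alpha balpha : R)
    (hn : (0 < n)%N)
    (hs : 0 < s) (hst : s < t) (ht : t < 1) (hp : 1 < p)
    (hnu : 0 < nu) (hnu1 : nu <= 1) (hL : 1 <= L)
    (hbalpha : 0 <= balpha) (halpha : 0 < alpha) (halpha1 : alpha <= 1)
    (hstp : (t - s) * p <= alpha) :
  exists2 c : R, 0 < c &
    forall (R0 : R) (Omega : set 'rV[R]_n)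
      (Ksp Ktp a b : 'rV[R]_n -> 'rV[R]_n -> R)
      (u : 'rV[R]_n -> R) (x0 : 'rV[R]_n) (r : R),
    0 < R0 -> R0 < 1 -> balpha * (2 * R0) `^ alpha <= nu / 8 ->
    bounded_domain Omega ->
    measurable_symmetric Ksp -> measurable_symmetric Ktp ->
    measurable_symmetric a -> measurable_symmetric b ->
    (forall x y, 0 <= a x y) -> (forall x y, 0 <= b x y) ->
    kernel_bounds nu L s p Ksp -> kernel_bounds nu L t p Ktp ->
    coeff_bounds nu L a b ->
    holder_coeff balpha alpha b ->
    (forall x y, a x y = 1) ->
    tail_space s t p a b u ->
    weak_solution s t p Ksp Ktp a b Omega u ->
    0 < r -> 10 * r <= R0 ->
    compactly_contained (eball x0 (10 * r)) Omega ->
    {ae lebesgue_rV n, forall x, eball x0 (10 * r) x -> 0 <= u x} ->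
    (ess_sup_on (lebesgue_rV n) (eball x0 r) u <=
       c%:E * ess_inf_on (lebesgue_rV n) (eball x0 r) u +
       (c * gball_inv s t p a b x0 r
              (nonlocal_tail s t p a b (u^\-) x0 (10 * r) (10 * r)))%:E)%E.
Proof.
have p0 : 0 < p := lt_trans ltr01 hp.
pose m := truncn p; have pm : p <= m.+1%:R := ltW (truncnS_gt p).
have sg0 : 0 < s * p by exact: mulr_gt0.
have ga0 : 0 < (t - s) * p by rewrite mulr_gt0 ?subr_gt0.
have stp : t * p - s * p <= 1 by rewrite -mulrBl (le_trans hstp).
have tup : t * p < p by rewrite gtr_pMl.
have bet0 : 0 <= balpha + L by rewrite addr_ge0// (le_trans ler01).
pose Lam := space_const n p (s * p) (t * p) nu L (balpha + L) m.
have Lam0 : 0 < Lam := space_const_gt0 m hn sg0 tup hnu hL bet0.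
have kap0 : 0 < s * p / n%:R by rewrite divr_gt0// ltr0n.
(* The first summand lets the measure gain absorb the losses of a De Giorgi step; the second covers
   the exponent n in the measure threshold. *)
pose D := ((truncn ((m.+1 + (n + m.+2))%:R / (s * p / n%:R))).+1 + n)%N.
have hD : (m.+1 + (n + m.+2))%:R <= D%:R * (s * p / n%:R).
  rewrite -ler_pdivrMr//; apply: le_trans (ltW (truncnS_gt _)) _.
  by rewrite ler_nat leq_addr.
have mQ : (m < n + m.+2)%N by rewrite (leq_trans _ (leq_addl _ _)).
have [c1 [c2 [c10 c20 hm]]] := harnack_mean hp pm Lam0 kap0 mQ (leq_addl _ _) hD.
exists (c2 / c1); first exact: divr_gt0.
move=> R0 Omega Ksp Ktp a b u x0 r _ _ _ _ [mKs symKs] [mKt symKt] _ [_ symb] _ b0.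
move=> Ks_b Kt_b ab_b hb a1 utail usol r0 _ [_ cl] u0.
(* With a = 1, the bound a + b <= L gives the upper bound almost everywhere; Hölder continuity
   extends it to every pair. *)
have bL x y : 0 <= b x y <= L.
  rewrite b0 /=; apply: (holder_ae_le hbalpha halpha hb) => //.
  by apply: filterS ab_b => z; rewrite a1 => /andP[_]; lra.
have mb := measurable_holder hbalpha halpha hb.
have hb' : holder_coeff (balpha + L) (t * p - s * p) b.
  by rewrite -mulrBl; exact: (holder_lower_exponent hbalpha halpha hb bL ga0 hstp).
have sub x : enorm (x - x0) < 10 * r -> Omega x.
  by move=> xr; apply: cl; exact: subset_closure.
have [mu_u _ _] := utail.
have [v [mv v0 uv]] := ae_nonneg_representative (measurable_eball x0 (10 * r)) mu_u u0.
pose k (z : 'rV[R]_n * 'rV[R]_n) := model (s * p) (t * p) r b z.1 z.2.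
have mk : measurable_fun setT k.
  by have := measurable_dist (n := n) r; rewrite /k /model => mD; mfun.
have ksym x y : k (x, y) = k (y, x) by rewrite /k /model /= distC symb.
pose K x y := a x y * Ksp x y + b x y * Ktp x y.
have symK x y : K x y = K y x by rewrite /K !a1 symKs symKt symb.
have mK : ae_measurable (lebesgue_rV n \x lebesgue_rV n)%E (fun z => K z.1 z.2).
  have [g mg hg] := mKs; have [h mh hh] := mKt.
  exists (fun z => g z + b z.1 z.2 * h z); first by mfun.
  by apply: filterS2 hg hh => z <- <-; rewrite /K a1 mul1r.
have Kk : {ae (lebesgue_rV n \x lebesgue_rV n)%E, forall z : 'rV[R]_n * 'rV[R]_n,
    z.1 != z.2 -> nu * k z <= K z.1 z.2 <= L * k z}.
  apply: filterS2 Ks_b Kt_b => z hs' ht' z12.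
  have /andP[s1 s2] := hs' z12; have /andP[t1 t2] := ht' z12.
  rewrite /K a1 mul1r /k /model /dist enorm_eq0 subr_eq0 (negPf z12) !mulrDr.
  rewrite ![_ * (b _ _ * _)]mulrCA.
  by apply/andP; split; apply: lerD => //; apply: ler_wpM2l.
have [J [mJ symJ J_b KJ]] := symmetric_representative (ltW hnu) (le_trans hnu1 hL) mk
  (fun z => model_ge0 _ _ r b0 z.1 z.2) ksym mK symK Kk.
have sp := solution_space hn hs hst ht hp stp pm hnu hL bet0 x0 a1 bL hb' r0 mJ symJ J_b.
apply: (solution_harnack hn hs hst ht hp stp pm hnu hL bet0 a1 bL mb hb'
  r0 sub usol utail mJ symJ J_b KJ mv v0 uv c10 c20) => dd dd0 wf tl fin.
apply: (hm _ _ _ _ _ _ _ _ sp mv _ dd0 wf tl fin).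
by move=> x; rewrite ltr_pdivrMr// => /v0.
Qed.
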